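(* Let $k$ be an algebraically closed field of characteristic zero, $R=k[x,y,z]$, and let $X=V(f)\subset\mathbb P^2_k$ denote a reduced nodal curve of degree $d+1\geq 2$. One has: (i) $e:=\operatorname{indeg}(\operatorname{Syz}(J_f))\geq d-1$. (ii) The following bounds hold: $$\operatorname{Bour}(X)\geq\begin{cases} d(d-1)/2 & \text{if } e=d,\\ d(d-3)/2-1 & \text{if } e=d-1.\end{cases}$$ If, moreover, $f$ is irreducible then $$\operatorname{Bour}(X)\geq\begin{cases} d(d+1)/2 & \text{if } e=d,\\ 1+d(d-1)/2 & \text{if } e=d-1.\end{cases}$$ (iii) If $f$ is irreducible then $X$ is not a free divisor. If $X$ is a free divisor then $\deg f\leq 3$ and, moreover, $f=xy$ or else $f=xyz$ up to a linear change of variables.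
   Context: A nodal curve is a reduced curve all of whose singular points are simple nodes (ordinary double points, i.e. with completed local ring isomorphic to $k[[u,v]]/(uv)$). $J_f=(f_x,f_y,f_z)\subset R$ is the gradient ideal. $\operatorname{Syz}(J_f)=\{(a,b,c)\in R^3: af_x+bf_y+cf_z=0\}$ is graded as a submodule of $R^3$ (a syzygy has degree $n$ if its coordinates are forms of degree $n$). For a graded module $M=\bigoplus_{i\ge 0}M_i$, $\operatorname{indeg}(M)=\min\{i: M_i\ne 0\}$. The curve $X$ (or $f$) is a free divisor if $\operatorname{Syz}(J_f)$ is a free $R$-module. Bourbaki degree: let $e=\operatorname{indeg}(\operatorname{Syz}(J_f))$. If $f$ is a free divisor, set $\operatorname{Bour}(X)=0$. Otherwise choose a minimal generator $\epsilon\in\operatorname{Syz}(J_f)$ of degree $e$; the cokernel of $R(-e)\stackrel{\epsilon}{\to}\operatorname{Syz}(J_f)$ is isomorphic, by a degree-zero graded isomorphism, to $I_\epsilon(e-d)$ for a proper homogeneous ideal $I_\epsilon\subset R$ of codimension two, and $\operatorname{Bour}(X):=\deg(R/I_\epsilon)$ (algebraic multiplicity), which does not depend on the choice of $\epsilon$ of degree $e$. *)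

(* Defs.v *)
From HB Require Import structures.
From mathcomp Require Import all_boot all_order all_algebra ring_quotient.
From mathcomp Require Import boolp.
From mathcomp Require Import mpoly.

Set Implicit Arguments.
Unset Strict Implicit.
Unset Printing Implicit Defensive.

Import GRing.Theory.
Local Open Scope ring_scope.

Record powser (n : nat) (R : Type) := PowSer { pscoef : 'X_{1..n} -> R }.

HB.instance Definition _ n R := gen_eqMixin (powser n R).
HB.instance Definition _ n R := gen_choiceMixin (powser n R).

Section PowerSeries.
Context (n : nat) (R : comNzRingType).
Implicit Types (a b c : powser n R) (m : 'X_{1..n}) (N : nat).

Lemma powserP a b : pscoef a =1 pscoef b -> a = b.
Proof. by case: a b => [a] [b] /= /funext ->. Qed.

Definition ps_of_mpoly (p : {mpoly R[n]}) : powser n R :=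
  PowSer (fun m => p@_m).

Definition ps_add a b := PowSer (fun m => pscoef a m + pscoef b m).
Definition ps_opp a := PowSer (fun m => - pscoef a m).
Definition ps_scale (r : R) a := PowSer (fun m => r * pscoef a m).
Definition ps_mul a b : powser n R := PowSer (fun m =>
  \sum_(k : 'X_{1..n < (mdeg m).+1, (mdeg m).+1} | m == (k.1 + k.2)%MM)
     pscoef a k.1 * pscoef b k.2).

Definition ps_trunc N a : {mpoly R[n]} :=
  \sum_(m : 'X_{1..n < N}) pscoef a m *: 'X_[m].

Lemma ps_truncE N a m : (mdeg m < N)%N -> (ps_trunc N a)@_m = pscoef a m.
Proof. exact: mcoeff_mpoly. Qed.

Lemma mcoeffM_eq (p q p' q' : {mpoly R[n]}) m :
    (forall k, (mdeg k <= mdeg m)%N -> p@_k = p'@_k) ->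
    (forall k, (mdeg k <= mdeg m)%N -> q@_k = q'@_k) ->
  (p * q)@_m = (p' * q')@_m.
Proof.
move=> hp hq; rewrite !mcoeffM; apply: eq_bigr => k _.
by rewrite hp ?hq // -ltnS bmdeg.
Qed.

Lemma ps_mulE N a b m : (mdeg m < N)%N ->
  pscoef (ps_mul a b) m = (ps_trunc N a * ps_trunc N b)@_m.
Proof.
move=> mN; rewrite mcoeffM /=; apply: eq_bigr => k _.
by rewrite !ps_truncE // (leq_trans _ mN) ?bmdeg.
Qed.

Lemma ps_truncM N a b m : (mdeg m < N)%N ->
  (ps_trunc N (ps_mul a b))@_m = (ps_trunc N a * ps_trunc N b)@_m.
Proof. by move=> mN; rewrite ps_truncE // (ps_mulE _ _ mN). Qed.

Lemma ps_addA : associative ps_add.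
Proof. by move=> a b c; apply: powserP => m /=; rewrite addrA. Qed.
Lemma ps_addC : commutative ps_add.
Proof. by move=> a b; apply: powserP => m /=; rewrite addrC. Qed.
Lemma ps_add0 : left_id (PowSer (fun=> 0)) ps_add.
Proof. by move=> a; apply: powserP => m /=; rewrite add0r. Qed.
Lemma ps_addN : left_inverse (PowSer (fun=> 0)) ps_opp ps_add.
Proof. by move=> a; apply: powserP => m /=; rewrite addNr. Qed.

HB.instance Definition _ := GRing.isZmodule.Build (powser n R)
  ps_addA ps_addC ps_add0 ps_addN.

Lemma ps_mulA : associative ps_mul.
Proof.
move=> a b c; apply: powserP => m; rewrite !(ps_mulE _ _ (ltnSn (mdeg m))).
set N := (mdeg m).+1.
transitivity (ps_trunc N a * (ps_trunc N b * ps_trunc N c))@_m.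
  by apply: mcoeffM_eq => // l hl; rewrite ps_truncM.
rewrite mulrA; apply: mcoeffM_eq => // l hl.
by rewrite ps_truncM.
Qed.

Lemma ps_mulC : commutative ps_mul.
Proof.
move=> a b; apply: powserP => m.
by rewrite !(ps_mulE _ _ (ltnSn (mdeg m))) mulrC.
Qed.

Lemma ps_mul1 : left_id (ps_of_mpoly 1) ps_mul.
Proof.
move=> a; apply: powserP => m; rewrite (ps_mulE _ _ (ltnSn (mdeg m))).
rewrite (@mcoeffM_eq _ _ 1 (ps_trunc (mdeg m).+1 a)) ?mul1r ?ps_truncE //.
by move=> k hk; rewrite ps_truncE.
Qed.

Lemma ps_mulDl : left_distributive ps_mul +%R.
Proof.
move=> a b c; apply: powserP => m /=; rewrite -big_split /=.
by apply: eq_bigr => k _; rewrite mulrDl.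
Qed.

Lemma ps_1neq0 : ps_of_mpoly 1 != 0.
Proof.
apply/eqP => /(congr1 (fun a => pscoef a 0%MM)) /=.
by rewrite mcoeff1 eqxx; apply/eqP/oner_neq0.
Qed.

HB.instance Definition _ := GRing.Zmodule_isComNzRing.Build (powser n R)
  ps_mulA ps_mulC ps_mul1 ps_mulDl ps_1neq0.

Lemma ps_scaleA (r s : R) a : ps_scale r (ps_scale s a) = ps_scale (r * s) a.
Proof. by apply: powserP => m /=; rewrite mulrA. Qed.
Lemma ps_scale1 : left_id 1 ps_scale.
Proof. by move=> a; apply: powserP => m /=; rewrite mul1r. Qed.
Lemma ps_scaleDr : right_distributive ps_scale +%R.
Proof. by move=> r a b; apply: powserP => m /=; rewrite mulrDr. Qed.
Lemma ps_scaleDl a : {morph ps_scale^~ a : r s / r + s}.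
Proof. by move=> r s; apply: powserP => m /=; rewrite mulrDl. Qed.

HB.instance Definition _ := GRing.Zmodule_isLmodule.Build R (powser n R)
  ps_scaleA ps_scale1 ps_scaleDr ps_scaleDl.

Lemma ps_scaleAl (r : R) (a b : powser n R) : r *: (a * b) = (r *: a) * b.
Proof.
apply: powserP => m /=; rewrite big_distrr /=.
by apply: eq_bigr => k _; rewrite mulrA.
Qed.

HB.instance Definition _ := GRing.Lmodule_isLalgebra.Build R (powser n R)
  ps_scaleAl.
HB.instance Definition _ := GRing.Lalgebra_isComAlgebra.Build R (powser n R).

End PowerSeries.

Definition principal (A : nzRingType) (g : A) : A -> Prop :=
  fun h => exists a, h = a * g.

(* An isomorphism A/I ~ B/J of k-algebras, given as a common quotient C. *)
Definition quot_iso (k : fieldType) (A B : comAlgType k)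
    (I : A -> Prop) (J : B -> Prop) : Prop :=
  exists (C : comAlgType k)
         (p : {lrmorphism A -> C}) (q : {lrmorphism B -> C}),
    [/\ forall z, exists a, p a = z,
        forall z, exists b, q b = z,
        forall a, p a = 0 <-> I a
      & forall b, q b = 0 <-> J b].

Section PlaneCurves.
Context (k : fieldType).
Notation R := {mpoly k[3]}.
Implicit Types (f p : R) (I P : {pred R}) (s : 'rV[R]_3).

(* Equation, in the affine coordinates of the chart x_i = v_i centred at the
   point v, of the curve f = 0. *)
Definition local_eq f (v : 'I_3 -> k) (i : 'I_3) : {mpoly k[2]} :=
  f \mPo [tuple (v j)%:MP + oapp (fun h => 'X_h) 0 (unlift i j) | j < 3].

(* With g the local equation, the completed local ring of the curve at v is
   k[[u,w]]/(g), the completion of k[u,w]/(g) at the ideal (u,w). *)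
Definition simple_node f (v : 'I_3 -> k) (i : 'I_3) : Prop :=
  quot_iso (principal (ps_of_mpoly (local_eq f v i)))
           (principal (ps_of_mpoly ('X_0 * 'X_1 : {mpoly k[2]}))).

(* R/(f) has no nonzero nilpotents. *)
Definition reduced f : Prop :=
  forall p m, principal f (p ^+ m) -> principal f p.

(* [v i != 0] says that the point with homogeneous coordinates v lies in the
   i-th standard chart. *)
Definition nodal f : Prop :=
  reduced f /\
  forall (v : 'I_3 -> k) (i : 'I_3), v i != 0 ->
    f.@[v] = 0 -> (forall j, f^`M(j).@[v] = 0) -> simple_node f v i.

Definition irreducible f : Prop :=
  f \isn't a GRing.unit /\
  forall p q, f = p * q -> p \is a GRing.unit \/ q \is a GRing.unit.

(* Syz(J_f), with triples as row vectors. *)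
Definition syz f s : Prop := \sum_i s 0 i * f^`M(i) = 0.

Definition homog_row n s : Prop := forall i, s 0 i \is n.-homog.

(* 0 when M has no nonzero homogeneous element. *)
Definition indeg (M : 'rV[R]_3 -> Prop) : nat :=
  if pselect (exists n, `[< exists s, [/\ M s, s != 0 & homog_row n s] >])
    is left h then ex_minn h else 0%N.

Definition free_module (M : 'rV[R]_3 -> Prop) : Prop :=
  exists r (B : 'M[R]_(r, 3)), (forall i, M (row i B)) /\
    forall s, M s -> exists! c : 'rV[R]_r, s = c *m B.

Definition free_divisor f : Prop := free_module (syz f).

(* By graded Nakayama, a homogeneous element of M belongs to a minimal set of
   homogeneous generators iff it is not in (x,y,z)M. *)
Definition minimal_generator (M : 'rV[R]_3 -> Prop) s : Prop :=
  M s /\ ~ exists t : 'M[R]_3,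
    (forall i, M (row i t)) /\ s = \sum_i 'X_i *: row i t.

Definition homog_ideal I : Prop :=
  forall p n, p \in I -> pihomog mdeg n p \in I.

Definition prime_ideal P : Prop := idealr_closed P /\ prime_idealr_closed P.

(* There is a strict chain of n+1 primes ending at the prime P. *)
Fixpoint height_ge n P : Prop :=
  if n is n'.+1 then
    exists Q : {pred R}, [/\ prime_ideal Q, {subset Q <= P},
                             ~ {subset P <= Q} & height_ge n' Q]
  else True.

Definition codim I n : Prop :=
  (forall P, prime_ideal P -> {subset I <= P} -> height_ge n P) /\
  (exists P, [/\ prime_ideal P, {subset I <= P} & ~ height_ge n.+1 P]).

(* dim_k (R/I)_n = h. *)
Definition hilbert_fun I n h : Prop :=
  exists B : 'I_h -> R, (forall i, B i \is n.-homog) /\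
    forall p, p \is n.-homog ->
      exists! c : 'rV[k]_h, p - \sum_i c 0 i *: B i \in I.

(* The multiplicity of R/I, for R/I of dimension D >= 1, is (D-1)! times the
   leading coefficient of its Hilbert polynomial H, and D = deg H + 1 = size H. *)
Definition multiplicity I mu : Prop :=
  exists H : {poly rat},
    [/\ exists N, forall n, (N <= n)%N ->
          exists h, hilbert_fun I n h /\ H.[n%:R] = h%:R,
        H != 0
      & mu%:R = ((size H).-1)`!%:R * lead_coef H].

(* R_j, which is zero for j < 0. *)
Definition homog_int (j : int) p : bool :=
  if j is Posz n then p \is n.-homog else p == 0.

(* phi induces a graded isomorphism of degree zero from Syz(J_f)/(R eps) onto
   I(e-d): it is defined on syzygies only, R-linear there, with kernel R eps
   and image I, and it maps degree n to I(e-d)_n = I_(n+e-d). *)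
Definition bourbaki_ideal d e f eps I : Prop :=
  exists phi : 'rV[R]_3 -> R,
    [/\ forall a s t, syz f s -> syz f t ->
          phi (a *: s + t) = a * phi s + phi t,
        forall s, syz f s -> (phi s = 0 <-> exists a, s = a *: eps),
        forall p, p \in I <-> exists s, syz f s /\ phi s = p
      & forall n s, syz f s -> homog_row n s ->
          homog_int (n%:Z + e%:Z - d%:Z) (phi s)].

(* b = deg(R/I_eps) for some choice of eps. *)
Definition is_bour d f b : Prop :=
  let e := indeg (syz f) in
  exists eps I,
    [/\ minimal_generator (syz f) eps, homog_row e eps,
        [/\ idealr_closed I, homog_ideal I & codim I 2],
        bourbaki_ideal d e f eps I & multiplicity I b].

(* The Bourbaki degree of the curve f = 0 of degree d + 1. The value does not
   depend on the choice of eps; the final default 0 is a junk value. *)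
Definition Bour d f : nat :=
  if pselect (free_divisor f) then 0%N
  else if pselect (exists b, is_bour d f b) is left h then sval (cid h) else 0%N.

Definition linear_change (A : 'M[k]_3) f : R :=
  f \mPo [tuple \sum_j A i j *: 'X_j | i < 3].

End PlaneCurves.

(* Main.v *)
From HB Require Import structures.
Require Import Defs.
From mathcomp Require Import all_boot all_order all_algebra.
From mathcomp Require Import boolp ring lra zify.
From mathcomp Require Import mpoly.

(** A syzygy [s] of degree [e] of the partial derivatives is a vector field
    tangent to the curve; it vanishes at the nodes. With [p = (x,y,z) x s] one has
    [p_i f_j = p_j f_i] modulo [f], so [s] is given by the function [g = p_j / f_j],
    of degree [e + 1 - d]. At a node the partials generate the maximal ideal, so
    [p] lies in the saturation of the Jacobian ideal [J], and [g], or [l g] with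
    [l] a linear form when [e + 2 = d], is an endomorphism of degree zero of [J] in
    high degree. Modulo an irreducible component it has an eigenvalue and is thus
    equal to it. In degree [e + 2 = d] varying [l] forces [g = 0], and the case
    [e + 2 < d] follows by multiplying [s] with a form; if [f] is irreducible and
    [e + 1 = d], then [p] is proportional to the gradient, and Euler's formula gives
    [g = 0]. Hence [e >= d - 1], and [e >= d] for irreducible [f].

    If the syzygies are free with basis [s, t], then [s x t] is a multiple of the
    gradient by a constant, so [2 e <= d] and [d <= 2].

    Otherwise the Bourbaki ideal of [eps] is the ideal [I] of all [h] such that
    [h] times the gradient is [s x eps] for a syzygy [s]. It is saturated and
    starts in degree [2 e - d], so the Hilbert function of [R/I] is nondecreasing,
    and the degree of [R/I] is at least the dimension of [R] in degree
    [2 e - d - 1]. For [e = d] and [e = d - 1] this gives the bounds, the second one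
    for irreducible [f] being vacuous. *)

Set Implicit Arguments.
Unset Strict Implicit.
Unset Printing Implicit Defensive.

Import Order.TTheory GRing.Theory Num.Theory.
Local Open Scope ring_scope.

Lemma unit_neq0 (D : unitRingType) (u : D) : u \is a GRing.unit -> u != 0.
Proof. by apply: contraTneq => ->; rewrite unitr0. Qed.

(** * Unique factorization *)

Section Factorial.
Variable D : idomainType.
Implicit Types (a b c p q u : D) (s t : seq D).

Definition prime_elt (p : D) : Prop :=
  [/\ p != 0, p \isn't a GRing.unit
    & forall a b, principal p (a * b) -> principal p a \/ principal p b].

Definition factorial_ring : Prop :=
  forall a, a != 0 -> exists u s, [/\ u \is a GRing.unit,
    forall p, p \in s -> prime_elt p & a = u * \prod_(p <- s) p].

Lemma principal_refl a : principal a a.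
Proof. by exists 1; rewrite mul1r. Qed.

Lemma principal_mull a b c : principal a b -> principal a (c * b).
Proof. by case=> x ->; exists (c * x); rewrite mulrA. Qed.

Lemma principal_mulr a b c : principal a b -> principal a (b * c).
Proof. by move=> h; rewrite mulrC; exact: principal_mull. Qed.

Lemma principal_trans a b c : principal a b -> principal b c -> principal a c.
Proof. by move=> hab [x ->]; exact: principal_mull. Qed.

Lemma principalD a b c : principal a b -> principal a c -> principal a (b + c).
Proof. by case=> x -> [y ->]; exists (x + y); rewrite mulrDl. Qed.

Lemma principalN a b : principal a b -> principal a (- b).
Proof. by case=> x ->; exists (- x); rewrite mulNr. Qed.

Lemma principalB a b c : principal a b -> principal a c -> principal a (b - c).
Proof. by move=> hb hc; apply: principalD => //; apply: principalN. Qed.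

Lemma principal0 a : principal a 0.
Proof. by exists 0; rewrite mul0r. Qed.

Lemma principal_sum a (I : Type) (r : seq I) (P : pred I) (F : I -> D) :
  (forall i, P i -> principal a (F i)) -> principal a (\sum_(i <- r | P i) F i).
Proof.
by move=> h; elim/big_ind: _ => //; [exact: principal0 | move=> *; exact: principalD].
Qed.

Lemma principal_unit a u : u \is a GRing.unit -> principal a u -> a \is a GRing.unit.
Proof. by move=> hu [x e]; move: hu; rewrite e unitrM => /andP[]. Qed.

Lemma unit_principal a u : u \is a GRing.unit -> principal u a.
Proof. by move=> hu; exists (a / u); rewrite divrK. Qed.

Lemma prime_eltX p a n : prime_elt p -> principal p (a ^+ n) -> principal p a.
Proof.
move=> [p0 pu pp]; elim: n => [|n IH]; last by rewrite exprS => /pp [].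
by rewrite expr0 => /(principal_unit (unitr1 _)) h; rewrite h in pu.
Qed.

Lemma prime_elt_prod p (I : eqType) (s : seq I) (F : I -> D) : prime_elt p ->
  principal p (\prod_(i <- s) F i) -> exists2 i, i \in s & principal p (F i).
Proof.
move=> [p0 pu pp]; elim: s => [|x s IH].
  by rewrite big_nil => /(principal_unit (unitr1 _)) h; rewrite h in pu.
rewrite big_cons => /pp[h|/IH[i hi h]]; first by exists x => //; rewrite mem_head.
by exists i => //; rewrite inE hi orbT.
Qed.

Lemma prime_eltU p u : u \is a GRing.unit -> prime_elt p -> prime_elt (u * p).
Proof.
move=> hu [p0 pu pp].
have e x : principal (u * p) x <-> principal p x.
  split=> [[y ->]|[y ->]]; first by exists (y * u); rewrite mulrA.
  by exists (y / u); rewrite mulrA divrK.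
split; first by rewrite mulf_neq0 // unit_neq0.
  by rewrite unitrM (negPf pu) andbF.
by move=> a b /e/pp[]/e; [left|right].
Qed.

Hypothesis HF : factorial_ring.

Lemma factorial_ind (P : D -> Prop) :
  (forall u, u \is a GRing.unit -> P u) ->
  (forall p a, prime_elt p -> a != 0 -> P a -> P (p * a)) ->
  forall a, a != 0 -> P a.
Proof.
move=> P1 PS a a0; have [u [s [uu hs ->]]] := HF a0.
suff [] : P (u * \prod_(p <- s) p) /\ u * \prod_(p <- s) p != 0 by [].
elim: s hs => [|p s IH] hs.
  by rewrite big_nil mulr1; split; [exact: P1 | exact: unit_neq0].
have [h1 h2] : P (u * \prod_(p <- s) p) /\ u * \prod_(p <- s) p != 0.
  by apply: IH => q qs; apply: hs; rewrite inE qs orbT.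
have pp := hs p (mem_head _ _).
rewrite big_cons mulrCA; split; first exact: PS.
by rewrite mulf_neq0 //; case: pp.
Qed.

Lemma prime_divisor a : a != 0 -> a \isn't a GRing.unit ->
  exists2 p, prime_elt p & principal p a.
Proof.
move=> a0; elim/factorial_ind: a / a0 => [u -> //|p a pp _ _ _].
by exists p => //; exact/principal_mulr/principal_refl.
Qed.

Lemma irreducible_prime a : a != 0 -> a \isn't a GRing.unit ->
  (forall p q, a = p * q -> p \is a GRing.unit \/ q \is a GRing.unit) ->
  prime_elt a.
Proof.
move=> a0 au irr; have [p pp [x e]] := prime_divisor a0 au.
case: (irr _ _ e) => [xu|pu]; first by rewrite e; exact: prime_eltU.
by case: pp; rewrite pu.
Qed.

(* If [a * w = b * g] with [g] without common prime factor, [w] is a multiple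
   of [g]: the primes of [a] divide [b] and can be cancelled one at a time. *)
Lemma primitive_proportional (I : Type) (w g : I -> D) a b : a != 0 ->
  (forall p, prime_elt p -> ~ forall i, principal p (g i)) ->
  (forall i, a * w i = b * g i) -> exists h, forall i, w i = h * g i.
Proof.
move=> a0 hg; elim/factorial_ind: a / a0 b => [u uu|p a pp a0 IH] b e.
  by exists (u^-1 * b) => i; rewrite -mulrA -e mulKr.
have [c ec] : principal p b.
  have [i hi] : exists i, ~ principal p (g i) by apply/existsNP/hg.
  have [_ _ /(_ b (g i))[]//] := pp.
  by rewrite -e -mulrA; exact/principal_mulr/principal_refl.
apply: (IH c) => i; have p0 : p != 0 by case: pp.
by apply: (mulfI p0); rewrite mulrA e ec; ring.
Qed.

End Factorial.

(** * Gauss's lemma: polynomials over a factorial domain *)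

Section FactorialPoly.
Variable D : idomainType.
Hypothesis HF : factorial_ring D.
Implicit Types (F G H P Q W : {poly D}) (p c : D).

(** If [p] divides a product, it divides the product of the leading coefficients, hence one of them.
    Removing that leading term ([tl]) allows induction on the sum of the sizes. *)
Lemma prime_polyC p : prime_elt p -> prime_elt p%:P.
Proof.
move=> [p0 pu pp]; split; first by rewrite polyC_eq0.
  by rewrite poly_unitE coefC eqxx (negPf pu) andbF.
move=> F G; move: {2}(size F + size G)%N (leqnn (size F + size G)) => n.
elim: n F G => [|n IH] F G.
  rewrite leqn0 addn_eq0 size_poly_eq0 => /andP[/eqP-> _] _.
  by left; exact: principal0.
have [->|F0] := eqVneq F 0; first by left; exact: principal0.
have [->|G0] := eqVneq G 0; first by right; exact: principal0.
pose tl H := H - (lead_coef H)%:P * 'X^((size H).-1).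
have stl H : H != 0 -> (size (tl H) < size H)%N.
  move=> H0; rewrite (polySpred H0) ltnS; apply/leq_sizeP => j hj.
  rewrite /tl coefB coefCM coefXn; case: eqVneq => [->|nj].
    by rewrite mulr1 subrr.
  rewrite mulr0 subr0 nth_default // (polySpred H0) ltn_neqAle hj andbT.
  by rewrite eq_sym.
have etl H : H = (lead_coef H)%:P * 'X^((size H).-1) + tl H by rewrite addrC subrK.
have lift H : principal p (lead_coef H) -> principal p%:P (tl H) -> principal p%:P H.
  move=> [x ex] h2; rewrite [H]etl; apply: principalD => //.
  by apply: principal_mulr; exists x%:P; rewrite -polyCM ex.
move=> hn hFG.
have hl : principal p (lead_coef F * lead_coef G).
  rewrite -lead_coefM; case: hFG => Q ->; exists (lead_coef Q).
  by rewrite lead_coefM lead_coefC.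
have [h|h] := pp _ _ hl.
  have : principal p%:P (tl F * G).
    rewrite mulrBl; apply: principalB => //; apply: principal_mulr.
    by apply: principal_mulr; case: h => x ->; exists x%:P; rewrite -polyCM.
  case/IH => [|h'|h']; [|by left; exact: lift|by right].
  by rewrite -ltnS; apply: leq_trans hn; rewrite ltn_add2r stl.
have : principal p%:P (F * tl G).
  rewrite mulrBr; apply: principalB => //; apply: principal_mull.
  by apply: principal_mulr; case: h => x ->; exists x%:P; rewrite -polyCM.
case/IH => [|h'|h']; [|by left|by right; exact: lift].
by rewrite -ltnS; apply: leq_trans hn; rewrite ltn_add2l stl.
Qed.

Definition primitive_poly F : Prop := forall p, prime_elt p -> ~ principal p%:P F.

(** A constant prime dividing [F] divides its leading coefficient, so only finitely many primes have
    to be tried. In the induction [s] holds the factors of the leading coefficient still to be tried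
    and [t] those known not to divide [F]. *)
Lemma primitive_part F : F != 0 ->
  exists c F0, [/\ c != 0, primitive_poly F0 & F = c%:P * F0].
Proof.
move=> F0; have l0 : lead_coef F != 0 by rewrite lead_coef_eq0.
have [u [s [uu hs es]]] := HF l0.
have : exists t, [/\ (forall p, p \in t -> prime_elt p),
    (forall p, p \in t -> ~ principal p%:P F) &
    lead_coef F = u * (\prod_(p <- s) p * \prod_(p <- t) p)].
  by exists [::]; rewrite big_nil mulr1.
elim: s F F0 {l0 es} hs => [|p s IH] F F0 hs [t [ht hF e]].
  exists 1, F; split; rewrite ?oner_eq0 ?mul1r // => p pp pF.
  have : principal p (lead_coef F).
    by case: pF => Q ->; exists (lead_coef Q); rewrite lead_coefM lead_coefC.
  rewrite e big_nil mul1r; have [p0 pu pm] := pp; case/pm.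
    by move/(principal_unit uu) => h; rewrite h in pu.
  case/(prime_elt_prod pp) => q qt [x eq]; apply: (hF q qt).
  have [q0 qu qm] := ht q qt.
  have [|[y ex]|[y ep]] := qm x p; first by rewrite -eq; exact: principal_refl.
    case/negP: pu; apply/unitrPr; exists y; apply: (mulIf q0).
    by rewrite mul1r {2}eq ex; ring.
  by apply: principal_trans pF; exists y%:P; rewrite -polyCM ep.
have hs' q : q \in s -> prime_elt q by move=> qs; apply: hs; rewrite inE qs orbT.
have pp := hs p (mem_head _ _); have p0 : p != 0 by case: pp.
have [[G eG]|npF] := pselect (principal p%:P F); last first.
  apply: (IH F F0 hs'); exists (p :: t); split.
  - by move=> q; rewrite inE => /predU1P[->|/ht].
  - by move=> q; rewrite inE => /predU1P[->|/hF].
  by rewrite e !big_cons; ring.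
have G0 : G != 0 by apply: contraNneq F0 => h; rewrite eG h mul0r.
have [|c [F1 [c0 h1 h2]]] := IH G G0 hs'.
  exists t; split => //.
    by move=> q qt h; apply: (hF q qt); rewrite eG; exact: principal_mulr.
  by apply: (mulIf p0); move: e; rewrite eG lead_coefM lead_coefC big_cons => ->; ring.
exists (p * c), F1; split; rewrite ?mulf_neq0 //.
by rewrite eG h2 polyCM; ring.
Qed.

(** The primes of [c] divide [F * W] but not [F], so they can be cancelled from [W] one at a
    time. *)
Lemma primitive_strip F G W c : primitive_poly F -> c != 0 ->
  c%:P * G = F * W -> principal F G.
Proof.
move=> pF c0; elim/(factorial_ind HF): c / c0 W => [u uu|p c pp c0 IH] W e.
  exists (u^-1%:P * W); rewrite -mulrA [W * F]mulrC -e mulrA -polyCM.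
  by rewrite mulVr // mul1r.
have [p0 _ _] := pp; have [_ _ pm] := prime_polyC pp.
have [||[W1 e1]] := pm F W; last 1 first.
- apply: (IH W1); have p0' : p%:P != 0 by rewrite polyC_eq0.
  by apply: (mulfI p0'); rewrite mulrA -polyCM e e1; ring.
- by rewrite -e polyCM -mulrA; exact/principal_mulr/principal_refl.
by move/(pF p pp).
Qed.

(** Each prime of [c] divides [P] or [Q] and is cancelled there, which leaves the sizes
    unchanged. *)
Lemma const_split F P Q c : c != 0 -> c%:P * F = P * Q ->
  exists P' Q', [/\ F = P' * Q', size P' = size P & size Q' = size Q].
Proof.
move=> c0; elim/(factorial_ind HF): c / c0 P Q => [u uu|p c pp c0 IH] P Q e.
  exists (u^-1%:P * P), Q; split=> //.
    by rewrite -mulrA -e mulrA -polyCM mulVr // mul1r.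
  by rewrite mul_polyC size_scale // unit_neq0 // unitrV.
have [p0 _ _] := pp; have [p0' _ pm] := prime_polyC pp.
have szp H : size (H * p%:P) = size H.
  by rewrite mulrC mul_polyC size_scale.
have [||[W eW]] := pm P Q.
- by rewrite -e polyCM -mulrA; exact/principal_mulr/principal_refl.
- case=> W eW; have [|P' [Q' [h1 h2 h3]]] := IH W Q.
    by apply: (mulfI p0'); rewrite mulrA -polyCM e eW; ring.
  by exists P', Q'; rewrite h1 h2 h3 eW szp.
have [|P' [Q' [h1 h2 h3]]] := IH P W.
  by apply: (mulfI p0'); rewrite mulrA -polyCM e eW; ring.
by exists P', Q'; rewrite h1 h2 h3 eW szp.
Qed.

(** Pseudo-division gives gcds and Bezout relations up to constant factors, as over the fraction
    field; [const_split] and [primitive_strip] remove these constants. The gcd of [F] and [G] is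
    then [F] or a constant, and in the second case Bezout makes [F] divide [H]. *)
Lemma primitive_irreducible_prime F : primitive_poly F -> (1 < size F)%N ->
  (forall P Q, F = P * Q -> (size P <= 1)%N \/ (size Q <= 1)%N) -> prime_elt F.
Proof.
move=> pF sF irr; have F0 : F != 0 by rewrite -size_poly_gt0; lia.
split=> //; first by rewrite poly_unitE; case: eqP => // h; rewrite h in sF.
move=> G H [W eW]; have g0 : gcdp F G != 0 by rewrite gcdp_eq0 (negPf F0).
have [[c q] /= c0 e1] := Pdiv.Idomain.dvdpP _ _ (dvdp_gcdl F G).
have [P' [Q' [eF sP sQ]]] := const_split c0 (etrans (mul_polyC _ _) e1).
case: (irr _ _ eF); rewrite ?sP ?sQ => hs.
  left; have [[c' r] /= c'0 e2] := Pdiv.Idomain.dvdpP _ _ (dvdp_gcdr F G).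
  have eq : q = (q`_0)%:P by apply: size1_polyC.
  have q0 : q`_0 != 0.
    apply: contraNneq F0 => h; move: e1; rewrite eq h polyC0 mul0r -mul_polyC.
    by move/eqP; rewrite mulf_eq0 polyC_eq0 (negPf c0).
  apply: (@primitive_strip F G (r * c%:P) (q`_0 * c')) => //.
    by rewrite mulf_neq0.
  rewrite polyCM -mulrA [c'%:P * G]mul_polyC e2 mulrCA -eq -e1 -mul_polyC; ring.
have : coprimep F G.
  by rewrite /coprimep eqn_leq hs /= lt0n size_poly_eq0.
case/Pdiv.Idomain.Bezout_coprimepP => [[u v]] /= /eqpP[[c1 c2] /= /andP[c10 c20] e2].
right; apply: (@primitive_strip F H (c1%:P * (u * H + v * W)) c2) => //.
rewrite -[c2%:P]mulr1 mul_polyC -e2 -mul_polyC.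
have -> : F * (c1%:P * (u * H + v * W)) = c1%:P * (u * F * H + v * (W * F)) by ring.
by rewrite -eW; ring.
Qed.

Lemma primitive_factor F : F != 0 -> primitive_poly F ->
  exists (u : {poly D}) (s : seq {poly D}),
    [/\ u \is a GRing.unit, forall P, P \in s -> prime_elt P
      & F = u * \prod_(P <- s) P].
Proof.
move: {2}(size F) (leqnn (size F)) => n; elim: n F => [|n IH] F.
  by rewrite leqn0 size_poly_eq0 => ->.
move=> sF F0 pF; have [s1|s1] := leqP (size F) 1.
  have eF := size1_polyC s1.
  have f0 : F`_0 != 0 by move: F0; rewrite {1}eF polyC_eq0.
  exists F, [::]; rewrite big_nil mulr1; split=> //.
  rewrite poly_unitE eqn_leq s1 lt0n size_poly_eq0 F0 /=.
  apply/negPn/negP => fu; have [p pp [x ex]] := prime_divisor HF f0 fu.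
  by apply: (pF p pp); rewrite eF ex; exists x%:P; rewrite polyCM.
have [irr|] := pselect (forall P Q, F = P * Q -> (size P <= 1)%N \/ (size Q <= 1)%N).
  exists 1, [:: F]; rewrite big_seq1 mul1r unitr1; split=> // p; rewrite inE => /eqP->.
  exact: primitive_irreducible_prime.
move/existsNP => [P /existsNP[Q /not_implyP[eF /not_orP[/negP hP /negP hQ]]]].
have P0 : P != 0 by apply: contraNneq F0 => h; rewrite eF h mul0r.
have Q0 : Q != 0 by apply: contraNneq F0 => h; rewrite eF h mulr0.
have sz : (size F).+1 = (size P + size Q)%N.
  by rewrite eF size_mul // prednK // addn_gt0 size_poly_gt0 P0.
have [|//||u [s [uu hs es]]] := IH P; first by lia.
  by move=> p pp pP; apply: (pF p pp); rewrite eF; exact: principal_mulr.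
have [|//||v [t [vu ht et]]] := IH Q; first by lia.
  by move=> p pp pQ; apply: (pF p pp); rewrite eF; exact: principal_mull.
exists (u * v), (s ++ t); split; first by rewrite unitrM uu.
  by move=> p; rewrite mem_cat => /orP[/hs|/ht].
by rewrite big_cat /= eF es et; ring.
Qed.

Lemma factorial_poly : factorial_ring {poly D}.
Proof.
move=> F F0; have [c [G [c0 pG eF]]] := primitive_part F0.
have G0 : G != 0 by apply: contraNneq F0 => h; rewrite eF h mulr0.
have [u [s [uu hs es]]] := primitive_factor G0 pG.
have [v [t [vu ht et]]] := HF c0.
exists (v%:P * u), ([seq p%:P | p <- t] ++ s); split.
- by rewrite unitrM uu andbT poly_unitE size_polyC coefC eqxx vu unit_neq0.
- by move=> p; rewrite mem_cat => /orP[/mapP[q /ht hq ->]|/hs //]; exact: prime_polyC.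
rewrite big_cat big_map /= eF es et polyCM.
have -> : (\prod_(j <- t) j)%:P = \prod_(j <- t) j%:P :> {poly D}.
  exact: (rmorph_prod polyC).
by ring.
Qed.

End FactorialPoly.

Lemma factorial_iso (D D' : idomainType) (g : {rmorphism D -> D'})
    (h : {rmorphism D' -> D}) :
  cancel g h -> cancel h g -> factorial_ring D -> factorial_ring D'.
Proof.
move=> gK hK HF a a0.
have [|u [s [uu hs es]]] := HF (h a); first by rewrite raddf_eq0 //; exact: can_inj hK.
have gU x : (g x \is a GRing.unit) = (x \is a GRing.unit).
  by apply/idP/idP => [/(rmorph_unit h)|/(rmorph_unit g)]; rewrite ?gK.
exists (g u), [seq g p | p <- s]; split; first by rewrite gU.
  move=> _ /mapP[p /hs[p0 pu pp] ->]; split; rewrite ?gU //.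
    by rewrite raddf_eq0 //; exact: can_inj gK.
  move=> x y [w ew]; case: (pp (h x) (h y)) => [|[z ez]|[z ez]].
  - by rewrite -rmorphM ew; exists (h w); rewrite rmorphM gK.
  - by left; exists (g z); rewrite -rmorphM -ez hK.
  by right; exists (g z); rewrite -rmorphM -ez hK.
by rewrite big_map -rmorph_prod -rmorphM -es hK.
Qed.

(** * Induction on the number of variables *)

Section MPolyFactorial.
Variables (k : fieldType).

Definition of_muni n : {poly {mpoly k[n]}} -> {mpoly k[n.+1]} :=
  horner_eval 'X_ord_max \o map_poly (@mwiden n k).

HB.instance Definition _ n := GRing.RMorphism.on (@of_muni n).

Lemma of_muniD n : {morph @of_muni n : p q / p + q}.
Proof. exact: rmorphD. Qed.

Lemma of_muniM n : {morph @of_muni n : p q / p * q}.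
Proof. exact: rmorphM. Qed.

Lemma of_muniC n (c : {mpoly k[n]}) : of_muni c%:P = mwiden c.
Proof. by rewrite /of_muni /= /horner_eval map_polyC hornerC. Qed.

Lemma of_muniX n : of_muni 'X = 'X_ord_max :> {mpoly k[n.+1]}.
Proof. by rewrite /of_muni /= /horner_eval map_polyX hornerX. Qed.

Lemma of_muniXn n i : of_muni 'X^i = 'X_ord_max ^+ i :> {mpoly k[n.+1]}.
Proof.
elim: i => [|i IH]; first by rewrite !expr0 of_muniC mwiden1.
by rewrite !exprS of_muniM IH of_muniX.
Qed.

Lemma muniX n (m : 'X_{1..n.+1}) : muni 'X_[k, m] =
  'X_[[multinom m (widen_ord (leqnSn n) i) | i < n]] *: 'X^(m ord_max).
Proof. by rewrite muniE msuppX big_seq1 mcoeffX eqxx scale1r. Qed.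

Lemma muni_mwiden n (c : {mpoly k[n]}) : muni (mwiden c) = c%:P.
Proof.
elim/mpolyind: c => [|a m p _ _ IH]; first by rewrite mwiden0 muni0.
rewrite mwidenD mwidenZ muniD IH muniZ mwidenX muniX mnmwiden_ordmax expr0.
rewrite polyCD; congr (_ + _).
rewrite -mul_mpolyC polyCM -!mul_polyC mulr1; congr (_ * 'X_[_]%:P).
by apply/mnmP => i; rewrite mnmE mnmwiden_widen.
Qed.

Lemma of_muniK n : cancel (@of_muni n) (@muni n k).
Proof.
elim/poly_ind => [|p c IH]; first by rewrite raddf0 muni0.
rewrite of_muniD of_muniM muniD muniM IH of_muniX of_muniC muni_mwiden.
congr (_ * _ + _); rewrite muniX mnm1E eqxx expr1.
have -> : [multinom (U_(ord_max) : 'X_{1..n.+1})%MM (widen_ord (leqnSn n) i)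
           | i < n] = 0%MM.
  by apply/mnmP => i; rewrite mnmE mnm0E mnm1E eqE /= gtn_eqF // ltn_ord.
by rewrite mpolyX0 scale1r.
Qed.

Lemma muniK n : cancel (@muni n k) (@of_muni n).
Proof.
elim/mpolyind => [|a m p _ _ IH]; first by rewrite muni0 raddf0.
rewrite muniD muniZ of_muniD IH; congr (_ + _).
rewrite muniX -!mul_polyC !of_muniM of_muniXn !of_muniC mwidenC mwidenX.
rewrite -mul_mpolyC; congr (_ * _); rewrite mpolyXn -mpolyXD.
congr 'X_[_]; apply/mnmP => i; rewrite mnmDE mulmnE mnm1E.
case: (unliftP ord_max i) => [j ->|->]; last first.
  by rewrite mnmwiden_ordmax eqxx mul1n.
have -> : lift ord_max j = widen_ord (leqnSn n) j.
  by apply: val_inj; rewrite /= /bump leqNgt ltn_ord.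
by rewrite mnmwiden_widen mnmE eqE /= gtn_eqF ?ltn_ord // mul0n addn0.
Qed.

Lemma factorial_mpoly n : factorial_ring {mpoly k[n]}.
Proof.
elim: n => [|n IH]; last first.
  exact: factorial_iso (@of_muniK n) (@muniK n) (factorial_poly IH).
move=> p p0; exists p, [::]; rewrite big_nil mulr1; split=> //.
have e : p = (p@_0)%:MP.
  apply/mpolyP => m; rewrite mcoeffC.
  by have -> : m = 0%MM; [apply/mnmP => -[] | rewrite eqxx mulr1].
have a0 : p@_0 != 0 by apply: contraNneq p0 => h; rewrite e h.
by rewrite e; apply: (rmorph_unit (@mpolyC 0 k)); rewrite unitfE.
Qed.

End MPolyFactorial.

(** * Homogeneous components *)

Notation hcomp := (pihomog mdeg).

Section Homogeneous.
Variables (k : fieldType) (n : nat).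
Implicit Types (p q r f : {mpoly k[n]}) (d e : nat).

Lemma mcoeff_hcomp d p m : (hcomp d p)@_m = if mdeg m == d then p@_m else 0.
Proof.
elim/mpolyind: p => [|c m' p _ _ IH]; first by rewrite raddf0 mcoeff0 if_same.
rewrite raddfD /= linearZ /= pihomogX mcoeffD IH mcoeffD !mcoeffZ mcoeffX.
have [<-|ne] := eqVneq m' m.
  by case: ifP => _; rewrite ?mcoeffX ?eqxx ?mcoeff0 ?mulr0 ?addr0.
rewrite mulr0 add0r; case: ifP => _; last by rewrite mcoeff0 mulr0 add0r.
by rewrite mcoeffX (negPf ne) mulr0 add0r.
Qed.

Lemma hcompZ d c p : hcomp d (c *: p) = c *: hcomp d p.
Proof. exact: linearZ. Qed.

Lemma hcompM d p q :
  hcomp d (p * q) = \sum_(i < d.+1) hcomp i p * hcomp (d - i) q.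
Proof.
elim/mpolyind: p => [|c a p _ _ IH].
  by rewrite mul0r raddf0 big1 // => i _; rewrite raddf0 mul0r.
rewrite mulrDl pihomogD {}IH -scalerAl hcompZ.
under [in RHS]eq_bigr do rewrite pihomogD mulrDl hcompZ -scalerAl.
rewrite big_split /= -scaler_sumr; congr (c *: _ + _).
elim/mpolyind: q => [|b m q _ _ IH].
  by rewrite mulr0 raddf0 big1 // => i _; rewrite raddf0 mulr0.
rewrite mulrDr pihomogD {}IH -scalerAr hcompZ.
under [in RHS]eq_bigr do rewrite pihomogD mulrDr hcompZ -scalerAr.
rewrite big_split /= -scaler_sumr; congr (b *: _ + _).
rewrite -mpolyXD pihomogX /= mdegD; have [<-|ne] := eqVneq (mdeg a + mdeg m)%N d.
  have la : (mdeg a < (mdeg a + mdeg m).+1)%N by rewrite ltnS leq_addr.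
  rewrite (bigD1 (Ordinal la)) //= !pihomogX eqxx addKn eqxx mpolyXD big1 ?addr0 //.
  by move=> i ni; rewrite pihomogX eq_sym -(inj_eq val_inj) in ni *; rewrite (negPf ni) mul0r.
rewrite big1 // => i _; rewrite !pihomogX; case: eqP => [ea|]; last by rewrite mul0r.
case: eqP => [em|]; last by rewrite mulr0.
by case/eqP: ne; rewrite ea em subnKC // -ltnS.
Qed.

Lemma hcomp_dhomog d e p : p \is d.-homog -> hcomp e p = if d == e then p else 0.
Proof.
move=> hp; case: eqVneq => [<-|ne]; first exact: pihomog_dE.
exact: pihomog_ne0 hp.
Qed.

Lemma hcompMr d e p q : q \is e.-homog -> hcomp (d + e) (p * q) = hcomp d p * q.
Proof.
move=> hq; rewrite hcompM.
have ld : (d < (d + e).+1)%N by rewrite ltnS leq_addr.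
rewrite (bigD1 (Ordinal ld)) //= addKn (hcomp_dhomog _ hq) eqxx big1 ?addr0 //.
move=> i ni; rewrite (hcomp_dhomog _ hq); case: eqP => [ee|]; last by rewrite mulr0.
by case/eqP: ni; apply: val_inj => /=; move: (ltn_ord i); lia.
Qed.

Lemma hcompMr_lt d e p q : q \is e.-homog -> (d < e)%N -> hcomp d (p * q) = 0.
Proof.
move=> hq lt; rewrite hcompM big1 // => i _; rewrite (hcomp_dhomog _ hq).
by case: eqP => [ee|]; rewrite ?mulr0 //; lia.
Qed.

Lemma hcompM_low a b p q d : (forall i, (i < a)%N -> hcomp i p = 0) ->
    (forall i, (i < b)%N -> hcomp i q = 0) -> (d <= a + b)%N ->
  hcomp d (p * q) = if d == (a + b)%N then hcomp a p * hcomp b q else 0.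
Proof.
move=> hp hq led; rewrite hcompM; case: eqVneq => [->|ne].
  have la : (a < (a + b).+1)%N by rewrite ltnS leq_addr.
  rewrite (bigD1 (Ordinal la)) //= addKn big1 ?addr0 // => i ni.
  have [lt|ge] := ltnP i a; first by rewrite hp // mul0r.
  rewrite hq ?mulr0 //; have : (i != a :> nat) by [].
  by move: (ltn_ord i); lia.
rewrite big1 // => i _; have [lt|ge] := ltnP i a; first by rewrite hp // mul0r.
by rewrite hq ?mulr0 //; move: (ltn_ord i) ne; lia.
Qed.

Lemma hcomp_ge d p : (msize p <= d)%N -> hcomp d p = 0.
Proof.
move=> hs; apply/mpolyP => m; rewrite mcoeff_hcomp mcoeff0; case: eqP => // em.
by apply/memN_msupp_eq0/msize_mdeg_ge; rewrite em.
Qed.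

Lemma hcomp_sum p N : (msize p <= N)%N -> p = \sum_(i < N) hcomp i p.
Proof. exact: pihomog_partitionE. Qed.

Lemma hcomp_eq0 p : (forall i, hcomp i p = 0) -> p = 0.
Proof. by move=> h; rewrite (hcomp_sum (leqnn (msize p))) big1. Qed.

Lemma low_degree p : p != 0 -> exists a, hcomp a p != 0 /\
  forall i, (i < a)%N -> hcomp i p = 0.
Proof.
move=> p0; have ex : exists a, hcomp a p != 0.
  apply: contrapT => /forallNP h; case/negP: p0; apply/eqP/hcomp_eq0 => i.
  by apply/eqP/negPn/negP/h.
case: (ex_minnP ex) => a ha hmin; exists a; split=> // i lt.
by apply/eqP; apply: contraTT lt => /hmin; rewrite -leqNgt.
Qed.

Lemma dhomog_msizeE d p : p != 0 -> p \is d.-homog -> msize p = d.+1.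
Proof.
move=> p0 h; have h' := dhomog_msize h.
have := dhomog_uniq p0 h h' => ->.
by rewrite [LHS](mpolySpred mdeg p0).
Qed.

Lemma low_msize a p : p != 0 -> (forall i, (i < a)%N -> hcomp i p = 0) ->
  (a < msize p)%N.
Proof.
move=> p0 h; rewrite ltnNge; apply: contra p0 => hs; apply/eqP/hcomp_eq0 => i.
by have [/h//|ge] := ltnP i a; apply: hcomp_ge; apply: leq_trans hs ge.
Qed.

Lemma low_msize_dhomog d p : (forall i, (i < d)%N -> hcomp i p = 0) ->
  (msize p <= d.+1)%N -> p \is d.-homog.
Proof.
move=> h hs; rewrite homog_piE; apply/eqP; rewrite [RHS](hcomp_sum hs) (bigD1 ord_max) //= big1 ?addr0 //.
move=> i; rewrite -(inj_eq val_inj) /= => ni; apply: h.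
by move: (ltn_ord i); lia.
Qed.

(** The lowest degrees of the factors add up to [d], and so do their highest degrees; each factor
    thus has equal lowest and highest degree. *)
Lemma dhomog_factors d p q : p * q != 0 -> p * q \is d.-homog ->
  exists d1 d2, [/\ p \is d1.-homog, q \is d2.-homog & (d1 + d2 = d)%N].
Proof.
move=> pq0 hpq; have /norP[p0 q0] : ~~ ((p == 0) || (q == 0)) by rewrite -mulf_eq0.
have [d1 [ha la]] := low_degree p0; have [d2 [hb lb]] := low_degree q0.
have eab : (d1 + d2 = d)%N.
  have := hcompM_low la lb (leqnn _); rewrite eqxx (hcomp_dhomog _ hpq).
  case: eqP => // _ h; have := mulf_neq0 ha hb; rewrite -h eqxx //.
have sz : (msize p + msize q = d.+2)%N.
  have := dhomog_msizeE pq0 hpq; rewrite msizeM //.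
  have := low_msize p0 la; move: (msize p) (msize q) => x y; lia.
have sa := low_msize p0 la; have sb := low_msize q0 lb.
exists d1, d2; split=> //; apply: low_msize_dhomog => //; lia.
Qed.

Lemma dhomog_principal d p q : q != 0 -> q \is d.-homog -> principal p q ->
  exists2 d1, p \is d1.-homog & (d1 <= d)%N.
Proof.
move=> q0 hq [c e]; rewrite e in q0 hq.
by have [d1 [d2 [_ hb <-]]] := dhomog_factors q0 hq; exists d2 => //; rewrite leq_addl.
Qed.

Lemma dhomog_quotient d e p q : p != 0 -> p \is d.-homog -> q \is (d + e).-homog ->
  principal p q -> exists2 c, c \is e.-homog & q = c * p.
Proof.
move=> p0 hp hq [c ec]; exists (hcomp e c); first exact: pihomogP.
rewrite -(hcompMr _ _ hp) -ec addnC.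
by rewrite (hcomp_dhomog _ hq) eqxx.
Qed.

Lemma principal_lt d e p q : p \is d.-homog -> q \is e.-homog -> (e < d)%N ->
  principal p q -> q = 0.
Proof.
move=> hp hq lt [c ec]; rewrite -(pihomog_dE hq) ec.
exact: hcompMr_lt hp lt.
Qed.

Lemma dhomog0_const p : p \is 0.-homog -> p = (p@_0)%:MP.
Proof.
move=> hp; apply/mpolyP => m; rewrite mcoeffC.
have [->|m0] := eqVneq m 0%MM; first by rewrite mulr1.
by rewrite mulr0 (dhomog_nemf_coeff hp) //= mdeg_eq0.
Qed.

Lemma mpolyC_unit (c : k) : ((c%:MP : {mpoly k[n]}) \is a GRing.unit) = (c != 0).
Proof.
apply/idP/idP => [/unit_neq0|c0]; first by rewrite mpolyC_eq0.
by apply: (rmorph_unit (@mpolyC n k)); rewrite unitfE.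
Qed.

Lemma mpoly_unit_const p : p \is a GRing.unit -> exists2 c, c != 0 & p = c%:MP.
Proof.
move=> pu; have p0 := unit_neq0 pu.
have [d1 [d2 [ha hb]]] : exists d1 d2, [/\ p \is d1.-homog, p^-1 \is d2.-homog & (d1 + d2 = 0)%N].
  by apply: dhomog_factors; rewrite ?divrr ?oner_neq0 // dhomog1.
move=> /eqP; rewrite addn_eq0 => /andP[/eqP ea _]; rewrite ea in ha.
have e := dhomog0_const ha; exists p@_0 => //.
by apply: contraNneq p0 => h; rewrite e h.
Qed.

Lemma dhomogC (c : k) : (c%:MP : {mpoly k[n]}) \is 0.-homog.
Proof. by rewrite -[c%:MP]mulr1 mul_mpolyC; apply: dhomogZ; exact: dhomog1. Qed.

Lemma unit_dhomog0 p : p \is a GRing.unit -> p \is 0.-homog.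
Proof.
by case/mpoly_unit_const => c _ ->; exact: dhomogC.
Qed.

Lemma dhomogS_nonunit d p : p \is d.+1.-homog -> p \isn't a GRing.unit.
Proof.
move=> hp; apply/negP => hu.
by have := dhomog_uniq (unit_neq0 hu) hp (unit_dhomog0 hu).
Qed.

Lemma nonunit_dhomog_gt0 d p : p != 0 -> p \is d.-homog -> p \isn't a GRing.unit ->
  (0 < d)%N.
Proof.
case: d => // p0 hp; rewrite (dhomog0_const hp) mpolyC_unit negbK => /eqP h.
by move: p0; rewrite (dhomog0_const hp) h eqxx.
Qed.

Lemma dhomog_mderiv d p i : p \is d.+1.-homog -> p^`M(i) \is d.-homog.
Proof.
move=> hp; apply/dhomogP => m; rewrite mcoeff_msupp mcoeff_mderiv => h.
have /(dhomog_mf hp) : (m + U_(i))%MM \in msupp p.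
  by rewrite mcoeff_msupp; apply: contraNneq h => ->; rewrite mul0rn.
by rewrite /= mdegD mdeg1 addn1 => -[].
Qed.

Lemma euler d p : p \is d.-homog -> \sum_i 'X_i * p^`M(i) = d%:R *: p.
Proof.
move=> hp; apply/mpolyP => m; rewrite mcoeffZ raddf_sum /=.
have e i : ('X_i * p^`M(i))@_m = p@_m *+ m i.
  elim/mpolyind: (p) => [|c a q _ _ IH]; first by rewrite mderiv0 mulr0 !mcoeff0 mul0rn.
  rewrite mderivD mderivZ mderivX mulrDr !mcoeffD IH mulrnDl; congr (_ + _).
  rewrite -!scalerAr !mcoeffZ mcoeffX -mulrnAr; congr (_ * _).
  have [a0|a0] := posnP (a i).
    by rewrite a0 mul0r; case: eqP => [<-|_]; rewrite ?a0 ?mul0rn.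
  rewrite -mpolyXD addmC submK; last by rewrite lep1mP -lt0n.
  rewrite mcoeffX; case: eqP => [->|_]; last by rewrite mulr0 mul0rn.
  by rewrite mulr1.
rewrite (eq_bigr _ (fun i _ => e i)) sumrMnr -mdegE.
have [h|h] := eqVneq p@_m 0; first by rewrite h mul0rn mulr0.
have -> : mdeg m = d by apply: (dhomog_mf hp); rewrite mcoeff_msupp.
by rewrite mulr_natl.
Qed.

Lemma mderivXU i j : ('X_i : {mpoly k[n]})^`M(j) = ((i == j)%:R)%:MP.
Proof.
rewrite mderivX mnm1E; case: eqP => [->|_]; last by rewrite scale0r mpolyC0.
have -> : (U_(j) - U_(j))%MM = 0%MM :> 'X_{1..n}.
  by apply/mnmP => l; rewrite mnmBE mnm0E subnn.
by rewrite scale1r mpolyX0 mpolyC1.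
Qed.

Lemma dhomogXU i : ('X_i : {mpoly k[n]}) \is 1.-homog.
Proof. by rewrite dhomogX /= mdeg1. Qed.

End Homogeneous.

(** * Hilbert functions *)

Section VectorFacts.
Variables (K : fieldType) (aT rT : vectType K).

(** Membership is only a proposition, so the subspace is obtained as one of maximal dimension among
    those contained in [P]: a further vector of [P] would enlarge it. *)
Lemma predicate_vspace (P : aT -> Prop) : P 0 ->
  (forall c u v, P u -> P v -> P (c *: u + v)) ->
  exists U : {vspace aT}, forall v, v \in U <-> P v.
Proof.
move=> P0 PD.
pose Q (U : {vspace aT}) := forall v, v \in U -> P v.
pose D m := `[< exists U, Q U /\ \dim U = m >].
have exD : exists m, D m.
  exists 0%N; apply/asboolP; exists 0%VS; rewrite dimv0; split=> // v.
  by rewrite memv0 => /eqP ->.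
have ubD m : D m -> (m <= \dim {:aT})%N.
  by move=> /asboolP[U [_ <-]]; exact/dimvS/subvf.
case: (ex_maxnP exD ubD) => m /asboolP[U [QU dU]] mmax; exists U => v; split=> [/QU//|Pv].
apply: contrapT => /negP vU.
have /mmax : D (\dim (U + <[v]>)).
  apply/asboolP; exists (U + <[v]>)%VS; split=> // w /memv_addP[u uU [w' /vlineP[c ->] ->]].
  by rewrite addrC; apply: PD => //; exact: QU.
rewrite dimv_disjoint_sum; last first.
  apply/eqP; rewrite -subv0; apply/subvP => w /memv_capP[wU /vlineP[c ew]].
  rewrite memv0 ew; case: (eqVneq c 0) => [->|c0]; first by rewrite scale0r.
  case/negP: vU; rewrite -[v](scalerK c0) -ew; exact: memvZ.
rewrite dim_vline dU; case: eqVneq => [v0|_]; last by rewrite addn1 ltnn.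
by case/negP: vU; rewrite v0 mem0v.
Qed.

Lemma linear_lfun (F : aT -> rT) : linear F ->
  exists f : 'Hom(aT, rT), forall u, f u = F u.
Proof.
move=> lF; pose F' := HB.pack_for {linear aT -> rT} F (GRing.isLinear.Build _ _ _ _ F lF).
by exists (linfun F') => u; rewrite lfunE.
Qed.

(** A complement of [U] is mapped injectively onto a space that meets [W] in zero. *)
Lemma codim_le (f : 'Hom(aT, rT)) (U : {vspace aT}) (W : {vspace rT}) :
  (forall u, f u \in W -> u \in U) ->
  (\dim {:aT} - \dim U <= \dim {:rT} - \dim W)%N.
Proof.
move=> h; rewrite -dimv_compl; set V := (U^C)%VS.
have capUV : (U :&: V)%VS = 0%VS by exact: capv_compl.
have kerV u : u \in V -> f u \in W -> u = 0.
  move=> uV /h uU; apply/eqP; rewrite -memv0 -capUV; exact/memv_capP.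
rewrite -(@limg_dim_eq _ _ _ f V); last first.
  apply/eqP; rewrite -subv0; apply/subvP => u /memv_capP[uV].
  by rewrite memv_ker => /eqP fu; rewrite memv0 (kerV u) ?eqxx // fu mem0v.
rewrite -(leq_add2r (\dim W)) subnK ?dimvS ?subvf // -dimv_disjoint_sum.
  exact/dimvS/subvf.
apply/eqP; rewrite -subv0; apply/subvP => w /memv_capP[/memv_imgP[u uV ->] fuW].
by rewrite memv0 (kerV u uV fuW) linear0.
Qed.

End VectorFacts.

Section Hilbert.
Variables (k : fieldType) (n : nat).
Local Notation R := {mpoly k[n.+1]}.
Local Notation V := (dhomog n.+1 k).
Implicit Types (p q a b : R) (d e m : nat).

Definition proj_homog d p : V d := DHomog (pihomogP mdeg d p).

Lemma proj_homog_linear d : linear (proj_homog d).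
Proof. by move=> c p q; apply: val_inj; rewrite /= pihomogD hcompZ. Qed.

Lemma val_proj_homog d p : p \is d.-homog -> val (proj_homog d p) = p.
Proof. exact: pihomog_dE. Qed.

Definition linear_closed (I : R -> Prop) : Prop :=
  I 0 /\ forall c p q, I p -> I q -> I (c *: p + q).

Lemma graded_piece_exists (I : R -> Prop) d : linear_closed I ->
  exists U : {vspace V d}, forall u, u \in U <-> I (val u).
Proof. by case=> I0 ID; apply: predicate_vspace => // c u v; exact: ID. Qed.

(** For a set closed under linear combinations [graded_piece_exists] rules out the default zero
    space. *)
Definition graded_piece (I : R -> Prop) d : {vspace V d} :=
  if pselect (exists U : {vspace V d}, forall u, u \in U <-> I (val u))
  is left h then sval (cid h) else 0%VS.

Lemma graded_pieceP (I : R -> Prop) d u : linear_closed I ->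
  u \in graded_piece I d <-> I (val u).
Proof.
move=> /(graded_piece_exists d) ex; rewrite /graded_piece.
by case: pselect => // h; case: (cid h).
Qed.

Definition hf (I : R -> Prop) d : nat := (\dim {:V d} - \dim (graded_piece I d))%N.

Lemma dim_homog d : \dim {:V d} = 'C(d + n, d).
Proof. by rewrite dimvf. Qed.

Lemma hf_le (I J : R -> Prop) d e (g : R -> R) :
  linear_closed I -> linear_closed J -> linear g ->
  (forall p, p \is d.-homog -> g p \is e.-homog) ->
  (forall p, p \is d.-homog -> J (g p) -> I p) -> (hf I d <= hf J e)%N.
Proof.
move=> cI cJ lg hg IJ.
have [|f ef] := @linear_lfun _ (V d) (V e) (fun u => proj_homog e (g (val u))).
  by move=> c u v; rewrite linearP lg proj_homog_linear.
apply: (codim_le (f := f)) => u; rewrite ef => /(graded_pieceP _ cJ).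
rewrite val_proj_homog; last by apply: hg; exact: dhomog_is_dhomog.
move=> h; apply/(graded_pieceP _ cI); apply: IJ => //; exact: dhomog_is_dhomog.
Qed.

Lemma hf_eq_full (I : R -> Prop) d : linear_closed I ->
  (forall p, p \is d.-homog -> I p -> p = 0) -> hf I d = 'C(d + n, d).
Proof.
move=> cI h; rewrite /hf dim_homog (_ : graded_piece I d = 0%VS) ?dimv0 ?subn0 //.
apply/eqP; rewrite -subv0; apply/subvP => u /(graded_pieceP _ cI) hu.
rewrite memv0; apply/eqP/val_inj; rewrite linear0.
by apply: h => //; exact: dhomog_is_dhomog.
Qed.

Lemma hf_gt0 (I : R -> Prop) d p : linear_closed I -> p \is d.-homog -> ~ I p ->
  (0 < hf I d)%N.
Proof.
move=> cI hp Ip; rewrite subn_gt0 ltn_neqAle dimvS ?subvf // andbT.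
apply: contra_notN Ip => /eqP e.
have /eqP eU : graded_piece I d == {:V d}%VS by rewrite eqEdim subvf e leqnn.
rewrite -(val_proj_homog hp); apply/(graded_pieceP _ cI).
by rewrite eU memvf.
Qed.

(** Koszul complex of [a] and [b]: [f] maps pairs of forms of degree m + e into the ideal, and by
    coprimality every relation is a multiple of (b, -a), so that its kernel is at most the image of
    the forms of degree [m] under [g]. *)
Lemma coprime_hf_bound (I : R -> Prop) a b e m : linear_closed I ->
    (forall p, I (p * a)) -> (forall p, I (p * b)) ->
    a \is e.-homog -> b \is e.-homog -> b != 0 ->
    (forall p, principal b (p * a) -> principal b p) ->
  (hf I (m + e + e) + 2 * 'C(m + e + n, m + e) <=
    'C(m + e + e + n, m + e + e) + 'C(m + n, m))%N.
Proof.
move=> cI Ia Ib ha hb b0 cop.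
have [|f ef] := @linear_lfun _ (V (m + e) * V (m + e))%type (V (m + e + e))
   (fun u => proj_homog _ (val u.1 * a + val u.2 * b)).
  move=> c u v; apply: val_inj; rewrite /= -hcompZ -pihomogD; congr pihomog.
  by rewrite -!mul_mpolyC; ring.
have [|g eg] := @linear_lfun _ (V m) (V (m + e) * V (m + e))%type
   (fun u => (proj_homog _ (val u * b), proj_homog _ (- (val u * a)))).
  move=> c u v;
  congr pair; apply: val_inj; rewrite /= -hcompZ -pihomogD; congr pihomog.
    by rewrite -!mul_mpolyC; ring.
  by rewrite -!mul_mpolyC; ring.
have hab (u : V (m + e) * V (m + e)) :
    val u.1 * a + val u.2 * b \is (m + e + e).-homog.
  by apply: rpredD; apply: dhomogM => //; exact: dhomog_is_dhomog.
have img : (limg f <= graded_piece I (m + e + e))%VS.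
  apply/subvP => _ /memv_imgP[u _ ->]; apply/(graded_pieceP _ cI); rewrite ef.
  rewrite val_proj_homog; last exact: hab.
  rewrite -[val u.1 * a]scale1r; case: cI => _; exact.
have ker : (lker f <= limg g)%VS.
  apply/subvP => u; rewrite memv_ker ef => /eqP /(congr1 val) /=.
  rewrite pihomog_dE; last exact: hab.
  move=> e0; have e1 : val u.1 * a = - val u.2 * b.
    by apply/eqP; rewrite -subr_eq0 mulNr opprK e0.
  have pb : principal b (val u.1) by apply: cop; rewrite e1; exists (- val u.2).
  have [|c hc ec] := @dhomog_quotient _ _ e m b (val u.1) b0 hb _ pb.
    by move: (val u.1) (dhomog_is_dhomog u.1) => x; rewrite addnC.
  apply/memv_imgP; exists (DHomog hc); rewrite ?memvf // eg /=.
  have e2 : val u.2 = - (c * a).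
    apply: (mulIf b0); apply: oppr_inj; rewrite -mulNr -e1 ec; ring.
  case: u {e0 e1 pb} ec e2 => u1 u2 /= ec e2.
  congr pair; apply: val_inj; rewrite /= pihomog_dE.
  - by [].
  - exact: dhomogM.
  - by [].
  - by rewrite rpredN; exact: dhomogM.
have k1 := limg_ker_dim f fullv; rewrite capfv in k1.
have k2 := dimvS img; have k3 := dimvS ker.
have k4 := limg_ker_dim g fullv; rewrite capfv in k4.
have k5 : (\dim (graded_piece I (m + e + e)) <= \dim {:V (m + e + e)})%N.
  exact/dimvS/subvf.
have k6 : \dim {:(V (m + e) * V (m + e))%type} = ('C(m + e + n, m + e) * 2)%N.
  by rewrite dimvf muln2 -addnn.
rewrite /hf -?dim_homog in k1 k2 k3 k4 k5 k6 *; rewrite k6 in k1.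
move: k1 k2 k3 k4 k5 {k6}; rewrite -?dim_homog.
set x1 := \dim (lker f); set x2 := \dim (limg f).
set x3 := \dim (limg g); set x4 := \dim (lker g).
set x5 := \dim (graded_piece _ _); set x6 := \dim {:V (m + e + e)}.
set x7 := \dim {:V (m + e)}; set x8 := \dim {:V m}.
lia.
Qed.

(** Unique reduction modulo the ideal means that [B] is a basis of a complement of the graded
    piece. *)
Lemma hilbert_funP (I : {pred R}) d h : linear_closed (fun p => p \in I) ->
  (exists B : 'I_h -> R, (forall i, B i \is d.-homog) /\
    forall p, p \is d.-homog ->
      exists! c : 'rV[k]_h, p - \sum_i c 0 i *: B i \in I) <->
  h = hf (fun p => p \in I) d.
Proof.
move=> cI; set J := fun p => p \in I; set U := graded_piece J d.
have sumB (B : 'I_h -> R) : (forall i, B i \is d.-homog) -> forall c : 'rV[k]_h,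
    \sum_i c 0 i *: B i \is d.-homog.
  by move=> hB c; apply: rpred_sum => i _; apply: rpredZ.
have JB p q : J (p - q) -> forall r, J (p - r) -> J (r - q).
  case: cI => _ ID h1 r h2; have := ID (-1) _ _ h2 h1.
  by rewrite scaleN1r opprB addrA subrK.
split=> [[B [hB exB]]|eh].
  have [|f ef] := @linear_lfun _ 'rV[k]_h (V d)
      (fun c => proj_homog d (\sum_i c 0 i *: B i)).
    move=> c u v; rewrite -proj_homog_linear; congr proj_homog.
    rewrite scaler_sumr -big_split /=; apply: eq_bigr => i _.
    by rewrite !mxE scalerDl scalerA.
  have vf c : val (f c) = \sum_i c 0 i *: B i.
    by rewrite ef val_proj_homog //; exact: sumB.
  (* Independence is the uniqueness of the coefficients that represent the zero polynomial. *)
  have kf : lker f = 0%VS.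
    apply/eqP; rewrite -subv0; apply/subvP => c; rewrite memv_ker memv0 => /eqP fc.
    have [|c0 [_ uc]] := exB 0; first exact: dhomog0.
    have := vf c; rewrite fc linear0 => e0.
    have c00 : c0 = 0.
      by apply: uc; rewrite big1 ?subr0 ?(proj1 cI) // => i _; rewrite mxE scale0r.
    by apply/eqP; rewrite -c00; symmetry; apply: uc; rewrite -e0 subr0; exact: (proj1 cI).
  have capU : (limg f :&: U = 0)%VS.
    apply/eqP; rewrite -subv0; apply/subvP => w /memv_capP[/memv_imgP[c _ ->]].
    move/(graded_pieceP _ cI) => Jc; rewrite memv0.
    have [|c0 [_ uc]] := exB 0; first exact: dhomog0.
    have c00 : c0 = 0.
      by apply: uc; rewrite big1 ?subr0 ?(proj1 cI) // => i _; rewrite mxE scale0r.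
    suff -> : c = 0 by rewrite linear0.
    rewrite -c00; symmetry; apply: uc; rewrite sub0r -vf.
    by have := proj2 cI (-1) _ _ Jc (proj1 cI); rewrite scaleN1r addr0.
  have fullU : (limg f + U = fullv)%VS.
    apply: subv_anti.
    rewrite subvf /=; apply/subvP => u _.
    have [|c [Jc _]] := exB (val u); first exact: dhomog_is_dhomog.
    rewrite -[u](subrK (f c)) addrC; apply: memv_add; first exact: memv_img (memvf _).
    by apply/(graded_pieceP _ cI); rewrite /= vf.
  have e1 := dimv_disjoint_sum capU; rewrite fullU in e1.
  have e2 : \dim (limg f) = h.
    by rewrite limg_dim_eq ?kf ?capv0 // dimvf /= /dim /= mul1n.
  by rewrite /hf -/U e1 e2 addnK.
have -> : h = \dim (U^C)%VS by rewrite eh dimv_compl.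
pose X := vbasis (U^C)%VS; have bX : basis_of (U^C)%VS X := vbasisP _.
pose S (c : 'rV[k]_(\dim (U^C)%VS)) : V d := \sum_i c 0 i *: X`_i.
have valS c : val (S c) = \sum_i c 0 i *: val X`_i.
  by rewrite /S raddf_sum.
have capU : (U :&: U^C = 0)%VS by exact: capv_compl.
exists (fun i => val X`_i); split=> [i|p hp]; first exact: dhomog_is_dhomog.
have /memv_addP[z zU [w wU euv]] : proj_homog d p \in (U + U^C)%VS.
  by rewrite addv_complf memvf.
have ew : S (\row_i coord X i w) = w.
  by rewrite [RHS](coord_basis bX wU); apply: eq_bigr => i _; rewrite mxE.
have ez : p - val w = val z.
  by rewrite -{1}(val_proj_homog hp) euv raddfD addrK.
have Jz : J (p - val w) by rewrite ez; apply/(graded_pieceP _ cI).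
exists (\row_i coord X i w); split=> [|c']; first by rewrite -valS ew.
rewrite -valS => Jc'; have Jd := JB _ _ Jz _ Jc'.
have dU : S c' - w \in U.
  by apply/(graded_pieceP _ cI); rewrite raddfB.
have S0 : \sum_i (c' 0 i - coord X i w) *: X`_i = 0.
  have -> : \sum_i (c' 0 i - coord X i w) *: X`_i = S c' - w.
    rewrite -{2}ew /S -sumrB; apply: eq_bigr => i _.
    by rewrite mxE scalerBl.
  apply/eqP; rewrite -memv0 -capU memv_cap dU /=; apply: rpredB => //.
  apply: rpred_sum => i _; apply: rpredZ; apply: (basis_mem bX).
  by rewrite mem_nth // size_tuple.
apply/rowP => i; rewrite mxE; have /freeP/(_ _ S0 i)/eqP := basis_free bX.
by rewrite subr_eq0 => /eqP ->.
Qed.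

End Hilbert.

Section HilbertPlane.
Variable k : fieldType.

Lemma bin_plane m : ('C(m + 2, m) * 2 = (m + 2) * (m + 1))%N.
Proof.
rewrite -(bin_sub (leq_addr 2 m)) addKn.
have := bin_ffact (m + 2) 2; rewrite ffactnS ffactn1 addn2 /= => ->.
by rewrite addn1.
Qed.

(** Bezout's number [e * e] is the second difference, with step [e], of the quadratic polynomial (m
    + 2)(m + 1)/2. *)
Lemma coprime_hf_le (I : {mpoly k[3]} -> Prop) a b e d : linear_closed I ->
    (forall p, I (p * a)) -> (forall p, I (p * b)) ->
    a \is e.-homog -> b \is e.-homog -> b != 0 ->
    (forall p, principal b (p * a) -> principal b p) ->
  (e + e <= d)%N -> (hf I d <= e * e)%N.
Proof.
move=> cI Ia Ib ha hb b0 cop led; set m := (d - (e + e))%N.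
have ed : d = (m + e + e)%N by rewrite /m; lia.
have := coprime_hf_bound m cI Ia Ib ha hb b0 cop; rewrite -ed.
have := bin_plane d; have := bin_plane (m + e); have := bin_plane m.
move: ('C(d + 2, d)) ('C(m + e + 2, m + e)) ('C(m + 2, m)) (hf I d) => x y z h.
rewrite ed; nia.
Qed.

End HilbertPlane.

(** * Nodes *)

Section PowerSeriesFacts.
Variables (k : fieldType) (n : nat).
Local Notation A := (powser n k).
Local Notation ps := (@ps_of_mpoly n k).
Implicit Types (a b t : A) (m : 'X_{1..n}) (p : {mpoly k[n]}).

Lemma mcoeff_Xmul p i m :
  ('X_i * p)@_m = if m i == 0%N then 0 else p@_(m - U_(i))%MM.
Proof.
elim/mpolyind: p => [|c a p _ _ IH]; first by rewrite mulr0 !mcoeff0 if_same.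
rewrite mulrDr -scalerAr !mcoeffD !mcoeffZ {}IH -mpolyXD !mcoeffX.
have [m0|m0] := eqVneq (m i) 0%N.
  rewrite addr0; case: eqP => [e|]; last by rewrite mulr0.
  by move: m0; rewrite -e mnmDE mnm1E eqxx.
congr (_ * _%:R + _); congr nat_of_bool.
apply/eqP/eqP => [<-|->]; first by rewrite addmC addmK.
by rewrite addmC submK // lep1mP.
Qed.

Lemma pscoefD a b m : pscoef (a + b) m = pscoef a m + pscoef b m.
Proof. by []. Qed.

Lemma pscoefN a m : pscoef (- a) m = - pscoef a m.
Proof. by []. Qed.

Lemma pscoef0 m : pscoef (0 : A) m = 0.
Proof. by []. Qed.

Lemma pscoefZ c a m : pscoef (c *: a) m = c * pscoef a m.
Proof. by []. Qed.

Lemma pscoef1 m : pscoef (1 : A) m = (m == 0%MM)%:R.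
Proof. by rewrite -[LHS]/((1 : {mpoly k[n]})@_m) mcoeff1. Qed.

Lemma pscoef_sum I (r : seq I) (F : I -> A) m :
  pscoef (\sum_(i <- r) F i) m = \sum_(i <- r) pscoef (F i) m.
Proof.
by elim/big_rec2: _ => [|i x y _ <-]; rewrite ?pscoef0 ?pscoefD.
Qed.

Lemma pscoefM a b m : pscoef (a * b) m =
  \sum_(l : 'X_{1..n < (mdeg m).+1, (mdeg m).+1} | m == (l.1 + l.2)%MM)
     pscoef a l.1 * pscoef b l.2.
Proof. by []. Qed.

Lemma pscoef_Xmul i a m : pscoef (ps 'X_i * a) m =
  if m i == 0%N then 0 else pscoef a (m - U_(i))%MM.
Proof.
rewrite -[LHS]/(pscoef (ps_mul _ _) m) (ps_mulE _ _ (ltnSn (mdeg m))).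
rewrite (@mcoeffM_eq _ _ _ _ 'X_i (ps_trunc (mdeg m).+1 a)) //; last first.
  by move=> l hl; rewrite ps_truncE.
rewrite mcoeff_Xmul; case: eqP => // /eqP m0; rewrite ps_truncE // ltnS.
have /(congr1 mdeg) <- : (m - U_(i) + U_(i))%MM = m by rewrite submK // lep1mP.
by rewrite mdegD leq_addr.
Qed.

Lemma pscoef_expr_lt t i m : pscoef t 0%MM = 0 -> (mdeg m < i)%N ->
  pscoef (t ^+ i) m = 0.
Proof.
move=> t0; elim: i m => // i IH m hm; rewrite exprS pscoefM big1 // => l /eqP em.
have [->|l0] := eqVneq (val l.1) 0%MM; first by rewrite t0 mul0r.
have ar x y z : x = (y + z)%N -> (x < i.+1)%N -> (0 < y)%N -> (z < i)%N by lia.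
rewrite IH ?mulr0 //; apply: (ar _ _ _ _ hm); first by rewrite [in LHS]em mdegD.
by rewrite lt0n mdeg_eq0.
Qed.

(* The inverse of [1 - t] is the sum of the powers of [t], of which only the
   first [mdeg m + 1] contribute to the coefficient of [m]. *)
Lemma powser_inv a : pscoef a 0%MM != 0 -> exists b, a * b = 1.
Proof.
set c := pscoef a 0%MM => c0; pose t := 1 - c^-1 *: a.
have t0 : pscoef t 0%MM = 0.
  by rewrite pscoefD pscoef1 eqxx pscoefN pscoefZ mulVf // subrr.
pose S N := \sum_(i < N) t ^+ i.
pose b : A := PowSer (fun m => pscoef (S (mdeg m).+1) m).
have hb N m : (mdeg m < N)%N -> pscoef b m = pscoef (S N) m.
  rewrite /b /S /= => hm; rewrite !pscoef_sum.
  rewrite -!(big_mkord predT (fun i => pscoef (t ^+ i) m)).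
  rewrite [in RHS](big_cat_nat (leq0n _) hm) /=.
  rewrite [X in _ = _ + X](_ : _ = 0) ?addr0 //; rewrite big_nat big1 // => i.
  by case/andP=> h _; exact: pscoef_expr_lt.
have eat : a = c *: (1 - t) by rewrite opprB addrCA subrr addr0 scalerA mulfV ?scale1r.
exists (c^-1 *: b); rewrite -scalerAr {1}eat -scalerAl scalerA mulVf // scale1r.
apply: powserP => m; pose N := (mdeg m).+1.
have -> : pscoef ((1 - t) * b) m = pscoef ((1 - t) * S N) m.
  rewrite !pscoefM; apply: eq_bigr => l _; congr (_ * _); apply: hb.
  exact: bmdeg.
rewrite /S -[X in pscoef X _]opprK -mulNr opprB -subrX1 opprB pscoefD pscoefN.
by rewrite (@pscoef_expr_lt t N) // subr0.
Qed.

End PowerSeriesFacts.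

(** * The Hessian of an affine node *)

Section Node.
Variable (k : fieldType).
Local Notation A := (powser 2 k).
Local Notation ps := (@ps_of_mpoly 2 k).
Implicit Types (a b : A) (p q : {mpoly k[2]}) (h : 'I_2).

Local Notation i0 := (0%R : 'I_2).
Local Notation i1 := (1%R : 'I_2).

Lemma ord2P h : h = i0 \/ h = i1.
Proof. by case: h => -[|[|//]] lt; [left|right]; apply: val_inj. Qed.

Lemma ps_divX a : pscoef a 0%MM = 0 ->
  exists b c : A, a = b * ps 'X_0 + c * ps 'X_1.
Proof.
move=> a0.
exists (PowSer (fun m => pscoef a (m + U_(i0))%MM)).
exists (PowSer (fun m => if m i0 == 0%N then pscoef a (m + U_(i1))%MM else 0)).
apply: powserP => m; rewrite pscoefD ![_ * ps _]mulrC !pscoef_Xmul /=.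
rewrite mnmBE mnm1E /= subn0.
have [m0|m0] := eqVneq (m i0) 0%N; last first.
  by rewrite submK ?lep1mP // if_same addr0.
rewrite add0r; have [m1|m1] := eqVneq (m i1) 0%N; last by rewrite submK // lep1mP.
rewrite -a0; congr pscoef; apply/mnmP => i; rewrite mnm0E.
by case: (ord2P i) => ->.
Qed.

(** Value at the origin and, below, first and second partial derivatives there. They are computed on
    the truncation below degree 3, which keeps all coefficients involved and is a polynomial, so
    that [mderiv] applies. *)
Definition jet0 a : k := (ps_trunc 3 a)@_0.
Definition jet1 h a : k := ((ps_trunc 3 a)^`M(h))@_0.
Definition jet2 h h' a : k := ((ps_trunc 3 a)^`M(h)^`M(h'))@_0.

Lemma jet0E a : jet0 a = pscoef a 0%MM.
Proof. by rewrite /jet0 ps_truncE // mdeg0. Qed.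

Lemma mderiv_eq_low (p q : {mpoly k[2]}) d h :
  (forall m, (mdeg m < d.+1)%N -> p@_m = q@_m) ->
  forall m, (mdeg m < d)%N -> (p^`M(h))@_m = (q^`M(h))@_m.
Proof. by move=> e m hm; rewrite !mcoeff_mderiv e // mdegD mdeg1 addn1. Qed.

Lemma ps_truncM_low a b m : (mdeg m < 3)%N ->
  (ps_trunc 3 (a * b))@_m = (ps_trunc 3 a * ps_trunc 3 b)@_m.
Proof. exact: ps_truncM. Qed.

Lemma jet0M a b : jet0 (a * b) = jet0 a * jet0 b.
Proof. by rewrite /jet0 ps_truncM_low ?mdeg0 // rmorphM. Qed.

Lemma jet1M h a b : jet1 h (a * b) = jet1 h a * jet0 b + jet0 a * jet1 h b.
Proof.
rewrite /jet1 (@mderiv_eq_low _ (ps_trunc 3 a * ps_trunc 3 b) 2) ?mdeg0 //.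
  by rewrite mderivM mcoeffD !rmorphM.
exact: ps_truncM_low.
Qed.

Lemma jet2M h h' a b : jet2 h h' (a * b) =
  jet2 h h' a * jet0 b + jet1 h a * jet1 h' b + jet1 h' a * jet1 h b
  + jet0 a * jet2 h h' b.
Proof.
rewrite /jet2 (@mderiv_eq_low _ ((ps_trunc 3 a * ps_trunc 3 b)^`M(h)) 1) ?mdeg0 //.
  by rewrite mderivM mderivD !mderivM !mcoeffD !rmorphM /jet1 /jet0; ring.
apply: mderiv_eq_low; exact: ps_truncM_low.
Qed.

Lemma ps_truncD N a b : ps_trunc N (a + b) = ps_trunc N a + ps_trunc N b.
Proof.
by rewrite /ps_trunc -big_split; apply: eq_bigr => m _; rewrite pscoefD scalerDl.
Qed.

Lemma jet1D h a b : jet1 h (a + b) = jet1 h a + jet1 h b.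
Proof. by rewrite /jet1 ps_truncD mderivD mcoeffD. Qed.

Lemma ps_trunc_low p m : (mdeg m < 3)%N -> (ps_trunc 3 (ps p))@_m = p@_m.
Proof. exact: ps_truncE. Qed.

Lemma jet0_poly p : jet0 (ps p) = p@_0.
Proof. by rewrite jet0E. Qed.

Lemma jet1_poly h p : jet1 h (ps p) = (p^`M(h))@_0.
Proof. by apply: (@mderiv_eq_low _ _ 2); [exact: ps_trunc_low|rewrite mdeg0]. Qed.

Lemma jet2_poly h h' p : jet2 h h' (ps p) = (p^`M(h)^`M(h'))@_0.
Proof.
apply: (@mderiv_eq_low _ _ 1); last by rewrite mdeg0.
apply: mderiv_eq_low; exact: ps_trunc_low.
Qed.

(* Lift the two branches [x, y] of [xy = 0] to [U, W]. Then [U W] is a multiple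
   of [g], and the linear parts of [U, W] are independent because [U, W]
   generate the maximal ideal modulo [g], which has no linear part. *)
Lemma node_hessian (g : {mpoly k[2]}) : g@_0 = 0 -> (forall h, (g^`M(h))@_0 = 0) ->
  quot_iso (principal (ps g)) (principal (ps ('X_0 * 'X_1))) ->
  (g^`M(0)^`M(0))@_0 * (g^`M(1)^`M(1))@_0 - (g^`M(0)^`M(1))@_0 ^+ 2 != 0.
Proof.
move=> g0 g1 [C [p [q [psurj qsurj kp kq]]]].
have jg0 : jet0 (ps g) = 0 by rewrite jet0_poly.
have jg1 h : jet1 h (ps g) = 0 by rewrite jet1_poly.
have jx h h' : jet1 h (ps 'X_h') = (h' == h)%:R.
  by rewrite jet1_poly mderivXU mcoeffC eqxx mulr1.
have jx0 h : jet0 (ps 'X_h) = 0.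
  by rewrite jet0_poly mcoeffX; case: eqP => // /(congr1 mdeg); rewrite mdeg1 mdeg0.
have j1 : jet0 1 = 1 by rewrite jet0E pscoef1 eqxx.
have D0 a b : jet0 (a - b) = jet0 a - jet0 b.
  by rewrite !jet0E pscoefD pscoefN.
have [U eU] := psurj (q (ps 'X_0)); have [W eW] := psurj (q (ps 'X_1)).
have jXY : jet0 (ps ('X_0 * 'X_1)) = 0.
  by rewrite jet0_poly rmorphM /= -[_@_0]jet0_poly jx0 mul0r.
(* If [V] were invertible, the variable would be invertible modulo ['X_0 * 'X_1], although both have
   zero constant term. The same argument works in the other direction with [g]. *)
have lift0 V h : p V = q (ps 'X_h) -> jet0 V = 0.
  move=> eV; apply: contrapT => /eqP V0.
  have [|V' eV'] := @powser_inv _ _ V; first by rewrite -jet0E.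
  have [Z eZ] := qsurj (p V').
  have /kq[b eb] : q (1 - ps 'X_h * Z) = 0.
    by rewrite rmorphB rmorph1 rmorphM /= -eV eZ -rmorphM eV' rmorph1 subrr.
  have := congr1 jet0 eb; rewrite D0 !jet0M jx0 jXY mulr0 mul0r j1 subr0.
  by move/eqP; rewrite oner_eq0.
have lift0' V h : q V = p (ps 'X_h) -> jet0 V = 0.
  move=> eV; apply: contrapT => /eqP V0.
  have [|V' eV'] := @powser_inv _ _ V; first by rewrite -jet0E.
  have [Z eZ] := psurj (q V').
  have /kp[b eb] : p (1 - ps 'X_h * Z) = 0.
    by rewrite rmorphB rmorph1 rmorphM /= -eV eZ -rmorphM eV' rmorph1 subrr.
  have := congr1 jet0 eb; rewrite D0 !jet0M jx0 jg0 mulr0 mul0r j1 subr0.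
  by move/eqP; rewrite oner_eq0.
have U0 := lift0 _ _ eU; have W0 := lift0 _ _ eW.
have [a ea] : exists a, U * W = a * ps g.
  apply/kp; rewrite rmorphM /= eU eW -rmorphM; apply/kq.
  by exists 1; rewrite mul1r; apply: powserP => l; rewrite pscoef_Xmul /= mcoeff_Xmul.
(* The series [F] corresponding to the variable has no constant term, hence is a combination of
   ['X_0] and ['X_1]. Carried back, the variable is a combination of [U] and [W] modulo [g], and [g]
   does not affect linear parts. *)
have span h' : exists c1 c2, forall h, (h' == h)%:R = c1 * jet1 h U + c2 * jet1 h W.
  have [F eF] := qsurj (p (ps 'X_h')).
  have [|b [c eb]] := @ps_divX F; first by rewrite -jet0E; exact: lift0' eF.
  have [b' eb'] := psurj (q b); have [c' ec'] := psurj (q c).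
  have /kp[r er] : p (ps 'X_h' - (b' * U + c' * W)) = 0.
    by rewrite rmorphB /= -eF eb !rmorphD !rmorphM /= eU eW eb' ec' subrr.
  exists (jet0 b'), (jet0 c'); move=> h; rewrite -jx.
  have -> : ps 'X_h' = b' * U + c' * W + r * ps g by rewrite -er addrC subrK.
  by rewrite !jet1D !jet1M U0 W0 jg0 jg1; ring.
have detL : jet1 0 U * jet1 1 W - jet1 1 U * jet1 0 W != 0.
  have [c1 [c2 e1]] := span 0; have [d1 [d2 e2]] := span 1.
  apply/eqP => h; have := e1 0; have := e1 1; have := e2 0; have := e2 1.
  rewrite !eqxx /= => x11 x10 x01 x00.
  have : (c1 * d2 - c2 * d1) * (jet1 0 U * jet1 1 W - jet1 1 U * jet1 0 W) = 1 :> k.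
    transitivity ((c1 * jet1 0 U + c2 * jet1 0 W) * (d1 * jet1 1 U + d2 * jet1 1 W)
     - (c1 * jet1 1 U + c2 * jet1 1 W) * (d1 * jet1 0 U + d2 * jet1 0 W)); first by ring.
    by rewrite -x11 -x10 -x01 -x00; ring.
  by rewrite h mulr0 => /eqP; rewrite eq_sym oner_eq0.
have J h h' : jet1 h U * jet1 h' W + jet1 h' U * jet1 h W
    = jet0 a * (g^`M(h)^`M(h'))@_0.
  have := congr1 (jet2 h h') ea; rewrite !jet2M U0 W0 jg0 !jg1 -jet2_poly.
  by rewrite !mulr0 !mul0r !add0r !addr0.
apply: contra_neq detL => H.
apply/eqP; rewrite -sqrf_eq0; apply/eqP.
(* Up to sign, the Hessian determinant of a product of two linear forms is the square of the
   determinant of these forms. *)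
transitivity (- ((jet1 0 U * jet1 0 W + jet1 0 U * jet1 0 W)
   * (jet1 1 U * jet1 1 W + jet1 1 U * jet1 1 W)
   - (jet1 0 U * jet1 1 W + jet1 1 U * jet1 0 W) ^+ 2)); first by ring.
rewrite !J.
transitivity (- (jet0 a ^+ 2 * ((g^`M(0)^`M(0))@_0 * (g^`M(1)^`M(1))@_0
   - (g^`M(0)^`M(1))@_0 ^+ 2))); first by ring.
by rewrite H mulr0 oppr0.
Qed.

End Node.

Lemma mpoly_ring_ind (k : fieldType) (n : nat) (P : {mpoly k[n]} -> Prop) :
  (forall c, P c%:MP) -> (forall i, P 'X_i) ->
  (forall p q, P p -> P q -> P (p + q)) -> (forall p q, P p -> P q -> P (p * q)) ->
  forall p, P p.
Proof.
move=> PC PX PD PM; elim/mpolyind => [|c m p _ _ IH].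
  by rewrite -[0]/(0%:MP); exact: (PC).
apply: (PD) => //; rewrite -mul_mpolyC; apply: (PM) => //.
rewrite mpolyXE_id; elim/big_ind: _ => [|x y hx hy|i _].
- by rewrite -mpolyC1; exact: (PC).
- exact: (PM).
by elim: (m i) => [|j IHj]; rewrite ?expr0 -?mpolyC1 // exprS; exact: (PM).
Qed.

(** * From the affine chart back to the form [f] *)

Section LocalEquation.
Variables (k : fieldType) (v : 'I_3 -> k) (i : 'I_3).
Implicit Types (f : {mpoly k[3]}) (h : 'I_2).
Local Notation loc := (fun f => local_eq f v i).

Lemma local_eqX j : local_eq 'X_j v i =
  (v j)%:MP + oapp (fun h => 'X_h) 0 (unlift i j).
Proof. by rewrite /local_eq comp_mpolyXU -tnth_nth tnth_mktuple. Qed.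

Lemma local_eqD : {morph loc : f g / f + g}.
Proof. by move=> f g; exact: rmorphD. Qed.

Lemma local_eqM : {morph loc : f g / f * g}.
Proof. by move=> f g; exact: rmorphM. Qed.

Lemma local_eqC c : local_eq c%:MP v i = c%:MP.
Proof. exact: comp_mpolyC. Qed.

Lemma local_eq_coef0 f : (local_eq f v i)@_0 = f.@[v].
Proof.
elim/mpoly_ring_ind: f => [c|j|p q IHp IHq|p q IHp IHq].
- by rewrite local_eqC mcoeffC eqxx mulr1 mevalC.
- rewrite local_eqX mcoeffD mcoeffC eqxx mulr1 mevalXU.
  case: (unliftP i j) => [h _|_] /=; last by rewrite mcoeff0 addr0.
  rewrite mcoeffX; case: eqP => [/(congr1 mdeg)|]; last by rewrite addr0.
  by rewrite mdeg1 mdeg0.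
- by rewrite local_eqD mcoeffD mevalD IHp IHq.
by rewrite local_eqM rmorphM mevalM /= IHp IHq.
Qed.

Lemma mderiv_local_eq f h : (local_eq f v i)^`M(h) = local_eq (f^`M(lift i h)) v i.
Proof.
elim/mpoly_ring_ind: f => [c|j|p q IHp IHq|p q IHp IHq].
- by rewrite local_eqC !mderivC; rewrite -[0 in RHS]/(0%:MP) local_eqC.
- rewrite local_eqX mderivD mderivC add0r mderivXU local_eqC.
  case: unliftP => [h' ->|->] /=; first by rewrite mderivXU (inj_eq lift_inj).
  by rewrite mderiv0 (negPf (neq_lift _ _)) mpolyC0.
- by rewrite local_eqD !mderivD local_eqD IHp IHq.
by rewrite local_eqM !mderivM local_eqD !local_eqM IHp IHq.
Qed.

Lemma node_minor f : f.@[v] = 0 -> (forall j, (f^`M(j)).@[v] = 0) ->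
  simple_node f v i ->
  let a := lift i 0%R in let b := lift i 1%R in
  (f^`M(a)^`M(a)).@[v] * (f^`M(b)^`M(b)).@[v] - (f^`M(a)^`M(b)).@[v] ^+ 2 != 0.
Proof.
move=> f0 f1 hn; cbv zeta; have := @node_hessian _ (local_eq f v i) _ _ hn.
rewrite !mderiv_local_eq !local_eq_coef0; apply=> // l.
by rewrite mderiv_local_eq local_eq_coef0.
Qed.

End LocalEquation.

(** * The projective Nullstellensatz *)

Definition ideal_closed (A : comNzRingType) (I : A -> Prop) : Prop :=
  I 0 /\ forall a p q, I p -> I q -> I (a * p + q).

Section Ideals.
Variables (A : comNzRingType) (I : A -> Prop).
Hypothesis cI : ideal_closed I.

Lemma ideal0 : I 0. Proof. by case: cI. Qed.

Lemma idealMl a p : I p -> I (a * p).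
Proof. by case: cI => I0 IM Ip; rewrite -[a * p]addr0; exact: IM. Qed.

Lemma idealMr a p : I p -> I (p * a).
Proof. by rewrite mulrC; exact: idealMl. Qed.

Lemma idealD p q : I p -> I q -> I (p + q).
Proof. by case: cI => _ IM Ip; rewrite -[p]mul1r; exact: IM. Qed.

Lemma idealB p q : I p -> I q -> I (p - q).
Proof. by move=> Ip Iq; apply: idealD => //; rewrite -mulN1r; exact: idealMl. Qed.

Lemma ideal_sum (J : Type) (r : seq J) (P : pred J) (F : J -> A) :
  (forall i, P i -> I (F i)) -> I (\sum_(i <- r | P i) F i).
Proof. by move=> h; elim/big_ind: _ => //; [exact: ideal0 | exact: idealD]. Qed.

Definition ideal_adjoin (l : A) : A -> Prop := fun h => exists c, I (h - c * l).

Lemma ideal_adjoin_closed l : ideal_closed (ideal_adjoin l).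
Proof.
split=> [|a p q [c hc] [c' hc']]; first by exists 0; rewrite mul0r subr0; exact: ideal0.
exists (a * c + c').
have -> : a * p + q - (a * c + c') * l = a * (p - c * l) + (q - c' * l) by ring.
by case: cI => _; exact.
Qed.

Lemma ideal_adjoin_sub l p : I p -> ideal_adjoin l p.
Proof. by exists 0; rewrite mul0r subr0. Qed.

Lemma ideal_adjoin_gen l : ideal_adjoin l l.
Proof. by exists 1; rewrite mul1r subrr; exact: ideal0. Qed.

(** Otherwise each factor [l a] could in turn be exchanged for a power of [x], until a power of [x]
    alone is left in [I]. *)
Lemma adjoin_root (K : eqType) (x : A) (l : K -> A) (rs : seq K) s :
    I (x ^+ s * \prod_(a <- rs) l a) -> (forall N, ~ I (x ^+ N)) ->
  exists2 a, a \in rs & forall N, ~ ideal_adjoin (l a) (x ^+ N).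
Proof.
move=> + hx; elim: rs s => [|a rs IH] s; first by rewrite big_nil mulr1 => /hx.
rewrite big_cons => h.
have [ha|] := pselect (forall N, ~ ideal_adjoin (l a) (x ^+ N)).
  by exists a; rewrite ?mem_head.
move/existsNP => [N /contrapT[c hc]].
have [|b brs hb] := IH (N + s)%N; last by exists b => //; rewrite inE brs orbT.
have -> : x ^+ (N + s) * \prod_(b <- rs) l b = (x ^+ N - c * l a) *
    (x ^+ s * \prod_(b <- rs) l b) + c * (x ^+ s * (l a * \prod_(b <- rs) l b)).
  by rewrite exprD; ring.
by apply: idealD; [exact: idealMr | exact: idealMl].
Qed.

End Ideals.

(** * Factorization of binary forms *)

Section BinaryForms.
Variables (k : closedFieldType) (A : comAlgType k) (x y : A).
Implicit Types (U : {poly k}) (n m : nat).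

Definition homogenize n U : A := \sum_(i < n.+1) U`_i *: (x ^+ (n - i) * y ^+ i).

Lemma homogenizeXsubC n U a : (size U <= n.+1)%N ->
  homogenize n.+1 (U * ('X - a%:P)) = homogenize n U * (y - a *: x).
Proof.
move=> sU; rewrite /homogenize !mulrBr.
under eq_bigr do rewrite coefB coefMC scalerBl.
rewrite sumrB; congr (_ - _).
  rewrite big_ord_recl coefMX eqxx scale0r add0r mulr_suml.
  apply: eq_bigr => i _; rewrite coefMX /= /bump /= add1n subSS -scalerAl.
  by rewrite exprSr mulrA.
rewrite big_ord_recr /= (nth_default 0) // mul0r scale0r addr0 mulr_suml.
apply: eq_bigr => i _; rewrite -scalerAr -scalerAl scalerA mulrC.
rewrite subSn; last by rewrite -ltnS ltn_ord.
by congr (_ *: _); rewrite exprSr mulrAC.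
Qed.

Lemma homogenize_shift n m U : (size U <= m.+1)%N -> (m <= n)%N ->
  homogenize n U = x ^+ (n - m) * homogenize m U.
Proof.
move=> sU mn; rewrite /homogenize mulr_sumr.
rewrite -(big_mkord predT (fun i => U`_i *: (x ^+ (n - i) * y ^+ i))).
rewrite (big_cat_nat (leq0n m.+1)) ?ltnS //= [X in _ + X](_ : _ = 0); last first.
  rewrite big_nat big1 // => i /andP[lt _].
  by rewrite nth_default ?scale0r //; apply: leq_trans lt.
rewrite addr0 big_mkord; apply: eq_bigr => i _.
rewrite -scalerAr mulrA -exprD; congr (_ *: (_ ^+ _ * _)).
by move: (ltn_ord i); lia.
Qed.

Lemma homogenize_prod (rs : seq k) :
  homogenize (size rs) (\prod_(a <- rs) ('X - a%:P)) = \prod_(a <- rs) (y - a *: x).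
Proof.
elim: rs => [|a rs IH].
  rewrite !big_nil /homogenize big_ord_recl big_ord0 addr0 subnn !expr0 mulr1.
  by rewrite coef1 scale1r.
rewrite !big_cons mulrC [in RHS]mulrC -IH; apply: homogenizeXsubC.
by rewrite size_prod_XsubC.
Qed.

(** The dehomogenized form splits over [k]; the exponent [s] is the amount by which its degree falls
    short of [n], the multiplicity of the root at infinity. *)
Lemma binary_form_split n (c : 'rV[k]_n.+1) : c != 0 ->
  exists s rs (b : k), b != 0 /\
    \sum_(i < n.+1) c 0 i *: (x ^+ (n - i) * y ^+ i) =
    b *: (x ^+ s * \prod_(a <- rs) (y - a *: x)).
Proof.
move=> c0; pose U := \poly_(i < n.+1) c 0 (inord i).
have UE i : U`_(i : 'I_n.+1) = c 0 i by rewrite coef_poly ltn_ord inord_val.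
have U0 : U != 0.
  apply: contraNneq c0 => h; apply/eqP/rowP => i.
  by rewrite -UE h coef0 mxE.
have [rs ers] := closed_field_poly_normal U.
have l0 : lead_coef U != 0 by rewrite lead_coef_eq0.
have sU : size U = (size rs).+1.
  by rewrite ers size_scale // size_prod_XsubC.
have srs : (size rs <= n)%N by rewrite -ltnS -sU size_poly.
exists (n - size rs)%N, rs, (lead_coef U); split=> //.
transitivity (homogenize n U); first by apply: eq_bigr => i _; rewrite UE.
rewrite (@homogenize_shift n (size rs)) ?sU // -homogenize_prod scalerAr.
congr (_ * _); rewrite /homogenize {1}ers scaler_sumr; apply: eq_bigr => i _.
by rewrite coefZ scalerA.
Qed.

End BinaryForms.

Section Nullstellensatz.
Variable k : closedFieldType.
Local Notation R := {mpoly k[3]}.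
Implicit Types (p q h : R) (I J : R -> Prop).

Lemma ideal_linear_closed I : ideal_closed I -> linear_closed I.
Proof. by case=> I0 IM; split=> // c p q; rewrite -mul_mpolyC; exact: IM. Qed.

(** There are n + 1 monomials of degree [n] in two variables, so they are dependent modulo [I]. *)
Lemma binary_form_in I n (i j : 'I_3) : ideal_closed I -> (hf I n <= n)%N ->
  exists s rs, I ('X_i ^+ s * \prod_(a <- rs) ('X_j - a *: 'X_i)).
Proof.
move=> cI hn.
pose F (c : 'rV[k]_n.+1) : R := \sum_(l < n.+1) c 0 l *: ('X_i ^+ (n - l) * 'X_j ^+ l).
have hF c : F c \is n.-homog.
  apply: rpred_sum => l _; apply: rpredZ.
  have := dhomogM (dhomogMn (n - l) (dhomogXU k i)) (dhomogMn l (dhomogXU k j)).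
  by rewrite !mul1n subnK // -ltnS.
have [c [c0 Ic]] : exists c, c != 0 /\ I (F c).
  apply: contrapT => /forallNP hc.
  have [|f ef] := @linear_lfun _ _ (dhomog 3 k n) (fun c => proj_homog n (F c)).
    move=> c u w; rewrite -proj_homog_linear; congr proj_homog.
    rewrite /F scaler_sumr -big_split /=; apply: eq_bigr => l _.
    by rewrite !mxE scalerDl scalerA.
  have /codim_le : forall u, f u \in graded_piece I n -> u \in 0%VS.
    move=> u; rewrite ef => /(graded_pieceP _ (ideal_linear_closed cI)).
    rewrite val_proj_homog // memv0 => Iu; apply/eqP; apply: contrapT => /eqP u0.
    by apply: (hc u).
  rewrite dimv0 subn0 dimvf /dim /= mul1n -/(hf I n).
  by rewrite leqNgt ltnS hn.
have [s [rs [b [b0 e]]]] := binary_form_split 'X_i 'X_j c0.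
exists s, rs; have := Ic; rewrite /F e => /(idealMl cI b^-1%:MP).
by rewrite mul_mpolyC scalerA mulVf // scale1r.
Qed.

Lemma comp_mpoly_sub (t : 3.-tuple R) p :
  exists a : 'I_3 -> R, p - (p \mPo t) = \sum_j a j * ('X_j - tnth t j).
Proof.
elim/mpoly_ring_ind: p => [c|l|p q [a ea] [b eb]|p q [a ea] [b eb]].
- by exists (fun=> 0); rewrite comp_mpolyC subrr big1 // => j _; rewrite mul0r.
- exists (fun j => (j == l)%:R); rewrite comp_mpolyXU -tnth_nth (bigD1 l) //= eqxx mul1r.
  by rewrite big1 ?addr0 // => j /negPf ->; rewrite mul0r.
- exists (fun j => a j + b j); rewrite comp_mpolyD opprD addrACA ea eb -big_split /=.
  by apply: eq_bigr => j _; rewrite mulrDl.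
exists (fun j => q * a j + (p \mPo t) * b j).
have -> : (p * q) \mPo t = (p \mPo t) * (q \mPo t) by exact: rmorphM.
rewrite (_ : _ - _ = q * (p - (p \mPo t)) + (p \mPo t) * (q - (q \mPo t))); last by ring.
rewrite ea eb !mulr_sumr -big_split; apply: eq_bigr => j _ /=; ring.
Qed.

Lemma comp_line (v : 'I_3 -> k) i d h : h \is d.-homog ->
  h \mPo [tuple v j *: 'X_i | j < 3] = h.@[v] *: ('X_i ^+ d : R).
Proof.
move=> hh; rewrite mevalE comp_mpolyE scaler_suml; apply: eq_big_seq => m.
move=> /(dhomog_mf hh) /= em.
under eq_bigr do rewrite tnth_mktuple exprZn.
by rewrite scaler_prod prodrXr -mdegE em scalerA.
Qed.

Lemma sub_line (v : 'I_3 -> k) i d h : h \is d.-homog ->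
  exists a : 'I_3 -> R, h - h.@[v] *: 'X_i ^+ d = \sum_j a j * ('X_j - v j *: 'X_i).
Proof.
move=> hh; have [a ea] := comp_mpoly_sub [tuple v j *: 'X_i | j < 3] h.
exists a; rewrite -(comp_line _ _ hh) ea.
by apply: eq_bigr => j _; rewrite tnth_mktuple.
Qed.

(* An ideal without a power of ['X_i] stays so after adjoining suitable
   ['X_j - a 'X_i] and ['X_l - b 'X_i], where [a] and [b] are roots of binary
   forms of the ideal; the point with coordinates 1, a, b is then a zero. *)
Lemma projective_nullstellensatz I : ideal_closed I -> (exists n, hf I n <= n)%N ->
  exists L : seq {ffun 'I_3 -> k}, (forall v, v \in L -> exists i, v i = 1) /\
  forall J, ideal_closed J -> (forall p, I p -> J p) ->
    (exists N, forall d p, (N <= d)%N -> p \is d.-homog -> J p) \/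
    (exists2 v, v \in L & forall d h, h \is d.-homog -> J h -> h.@[v] = 0).
Proof.
move=> cI [n hn].
have /choice[rs hrs] : forall ij : 'I_3 * 'I_3, exists rs : seq k, exists s,
    I ('X_ij.1 ^+ s * \prod_(a <- rs) ('X_ij.2 - a *: 'X_ij.1)).
  by move=> [i j]; have [s [rs h]] := binary_form_in i j cI hn; exists rs, s.
pose pt (i : 'I_3) (a b : k) : {ffun 'I_3 -> k} :=
  [ffun j => if unlift i j is Some h then (if h == 0 then a else b) else 1].
(* The candidates come from binary forms in [I] alone; thus one finite list serves all ideals [J]
   containing [I]. *)
pose L := flatten [seq [seq pt i a b | a <- rs (i, lift i 0), b <- rs (i, lift i 1)]
                  | i <- enum 'I_3].
have pti i a b : pt i a b i = 1 by rewrite ffunE unlift_none.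
exists L; split.
  by move=> v /flattenP[_ /mapP[i _ ->] /allpairsP[[a b] [_ _ ->]]]; exists i.
move=> J cJ IJ.
have [hi|] := pselect (forall i, exists N, J ('X_i ^+ N)).
  left; have [N hN] := choice hi; exists (\sum_i N i)%N => d p Nd hp.
  rewrite [p]mpolyE; apply: ideal_sum => // m _; rewrite -mul_mpolyC.
  have [mp|mp] := boolP (m \in msupp p); last first.
    by rewrite memN_msupp_eq0 // mpolyC0 mul0r; exact: ideal0.
  apply: idealMl => //.
  have [i lei] : exists i, (N i <= m i)%N.
    apply: contrapT => /forallNP hlt; move: Nd; rewrite -(dhomog_mf hp mp) /= mdegE.
    rewrite leqNgt => /negP; apply.
    rewrite !big_ord_recl !big_ord0 /= !addn0.
    by have := hlt ord0; have := hlt (lift ord0 ord0);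
       have := hlt (lift ord0 (lift ord0 ord0)); lia.
  have -> : m = (U_(i) *+ N i + (m - U_(i) *+ N i))%MM.
    apply/mnmP => j; rewrite mnmDE mnmBE mulmnE mnm1E; case: eqP => [<-|_] /=.
      by rewrite mul1n subnKC.
    by rewrite mul0n subn0.
  by rewrite mpolyXD -mpolyXn; apply: idealMr.
move/existsNP => [i hi]; right.
have hi' N : ~ J ('X_i ^+ N) by move=> h; apply: hi; exists N.
have [s hs] := hrs (i, lift i 0); have [t ht] := hrs (i, lift i 1).
have [a ars ha] := adjoin_root cJ (IJ _ hs) hi'.
set J1 := ideal_adjoin J _ in ha.
have cJ1 : ideal_closed J1 := ideal_adjoin_closed cJ _.
have [b brs hb] := adjoin_root cJ1 (ideal_adjoin_sub _ (IJ _ ht)) ha.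
set J2 := ideal_adjoin J1 _ in hb.
have cJ2 : ideal_closed J2 := ideal_adjoin_closed cJ1 _.
exists (pt i a b).
  apply/flattenP; exists [seq pt i a b | a <- rs (i, lift i 0), b <- rs (i, lift i 1)].
    by apply/mapP; exists i; rewrite ?mem_enum.
  by apply/allpairsP; exists (a, b).
move=> d h hh Jh; apply: contrapT => /eqP hv; apply: (hb d).
have [c ec] := sub_line (pt i a b) i hh.
have : J2 (h - \sum_j c j * ('X_j - pt i a b j *: 'X_i)).
  apply: idealB => //; first by apply: ideal_adjoin_sub => //; exact: ideal_adjoin_sub.
  apply: ideal_sum => // j _; apply: idealMl => //.
  case: (unliftP i j) => [l ->|->]; last first.
    by rewrite pti scale1r subrr; exact: ideal0.
  rewrite ffunE liftK; case: (ord2P l) => -> /=.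
    by apply: ideal_adjoin_sub => //; exact: ideal_adjoin_gen.
  exact: ideal_adjoin_gen.
rewrite -ec subKr => /(idealMl cJ2 (h.@[pt i a b])^-1%:MP).
by rewrite mul_mpolyC scalerA mulVf // scale1r.
Qed.

End Nullstellensatz.

(** * The Jacobian ideal *)

Section Vectors.
Variable A : comNzRingType.
Implicit Types (s t u w : 'I_3 -> A).

Notation o0 := (@ord0 2).
Notation o1 := (lift ord0 (@ord0 1)).
Notation o2 := (lift ord0 (lift ord0 (@ord0 0))).

Lemma ord3P (i : 'I_3) : [\/ i = o0, i = o1 | i = o2].
Proof.
case: i => -[|[|[|//]]] lt; [constructor 1|constructor 2|constructor 3]; exact: val_inj.
Qed.

Lemma sum3 (F : 'I_3 -> A) : \sum_i F i = F o0 + F o1 + F o2.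
Proof. by rewrite !big_ord_recl big_ord0 addr0 addrA. Qed.

Definition dot s t : A := \sum_i s i * t i.

Definition cross s t (i : 'I_3) : A :=
  match val i with
  | 0 => s o1 * t o2 - s o2 * t o1
  | 1 => s o2 * t o0 - s o0 * t o2
  | _ => s o0 * t o1 - s o1 * t o0
  end.

Lemma dot_crossl s t : dot s (cross s t) = 0.
Proof. by rewrite /dot sum3 /cross /=; ring. Qed.

(** These minors are, up to sign, the entries of (s x t) x u = (s.u) t - (t.u) s. For [s] and [t]
    orthogonal to [u] they vanish. *)
Lemma cross_parallel s t u i j : exists c1 c2 : A,
  cross s t i * u j - cross s t j * u i = c1 * dot s u + c2 * dot t u.
Proof.
rewrite /dot !sum3; case: (ord3P i) => ->; case: (ord3P j) => ->; rewrite /cross /=.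
- by exists 0, 0; ring.
- by exists (t o2), (- s o2); ring.
- by exists (- t o1), (s o1); ring.
- by exists (- t o2), (s o2); ring.
- by exists 0, 0; ring.
- by exists (t o0), (- s o0); ring.
- by exists (t o1), (- s o1); ring.
- by exists (- t o0), (s o0); ring.
by exists 0, 0; ring.
Qed.

Lemma cross_cross s t u i :
  cross (cross s t) u i = dot s u * t i - dot t u * s i.
Proof. by rewrite /dot !sum3; case: (ord3P i) => ->; rewrite /cross /=; ring. Qed.

Lemma cross_anti s t i : cross s t i = - cross t s i.
Proof. by case: (ord3P i) => ->; rewrite /cross /=; ring. Qed.

Lemma cross_eq0 s t : (forall i, cross s t i = 0) -> forall i j, s i * t j = s j * t i.
Proof.
move=> h i j; have := h o0; have := h o1; have := h o2; rewrite /cross /=.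
move=> /subr0_eq h2 /subr0_eq h1 /subr0_eq h0.
by case: (ord3P i) => ->; case: (ord3P j) => ->.
Qed.

(* Cramer's rule: [dot s (cross t u)] is the determinant of [s, t, u]. *)
Lemma cross_relation s t u i l :
  cross t u l * s i + cross u s l * t i + cross s t l * u i =
  dot s (cross t u) * (l == i)%:R.
Proof.
rewrite /dot sum3.
by case: (ord3P i) => ->; case: (ord3P l) => ->; rewrite /cross /=; ring.
Qed.

Lemma eq_cross s s' t t' : s =1 s' -> t =1 t' -> cross s t =1 cross s' t'.
Proof. by move=> es et i; rewrite /cross !es !et. Qed.

Lemma dotC s t : dot s t = dot t s.
Proof. by apply: eq_bigr => i _; rewrite mulrC. Qed.

End Vectors.

Section Linear.
Variables (k : fieldType).
Local Notation R := {mpoly k[3]}.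

Lemma linear_form_coef (p : R) : p \is 1.-homog -> p = \sum_i p@_U_(i) *: 'X_i.
Proof.
move=> hp; apply/mpolyP => m; rewrite raddf_sum /=.
under eq_bigr do rewrite mcoeffZ mcoeffX.
have [/mdeg1P[i /eqP ->]|m1] := boolP (mdeg m == 1%N).
  rewrite (bigD1 i) //= eqxx mulr1 big1 ?addr0 // => j /negPf ji.
  by rewrite eq_mnm1 ji mulr0.
rewrite (dhomog_nemf_coeff hp) // big1 // => i _.
by case: eqP => [em|_]; rewrite ?mulr0 //; rewrite -em mdeg1 eqxx in m1.
Qed.

Lemma prime_linear_forms (p l1 l2 : R) : prime_elt p ->
  l1 \is 1.-homog -> l2 \is 1.-homog -> principal p l1 -> principal p l2 ->
  exists a b : k, (a != 0) || (b != 0) /\ a *: l1 + b *: l2 = 0.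
Proof.
move=> [p0 pu _] h1 h2 pl1 pl2; have [l10|l10] := eqVneq l1 0.
  by exists 1, 0; rewrite oner_eq0 l10 scaler0 scale0r addr0.
have [d hp led] := dhomog_principal l10 h1 pl1.
have d1 : d = 1%N by apply/eqP; rewrite eqn_leq led (nonunit_dhomog_gt0 p0 hp pu).
rewrite d1 in hp.
have [c1 hc1 e1] := @dhomog_quotient _ _ 1 0 _ _ p0 hp h1 pl1.
have [c2 hc2 e2] := @dhomog_quotient _ _ 1 0 _ _ p0 hp h2 pl2.
rewrite (dhomog0_const hc1) in e1; rewrite (dhomog0_const hc2) in e2.
exists c2@_0, (- c1@_0); split.
  apply/orP; right; rewrite oppr_eq0; apply: contraNneq l10 => h.
  by rewrite e1 h mpolyC0 mul0r.
by rewrite e1 e2 -!mul_mpolyC mpolyCN; ring.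
Qed.

Lemma XU_independent (i j : 'I_3) (a b : k) : i != j ->
  a *: 'X_i + b *: 'X_j = 0 :> R -> a = 0 /\ b = 0.
Proof.
move=> ij e; have e1 := congr1 (mcoeff U_(i)) e; have e2 := congr1 (mcoeff U_(j)) e.
move: e1 e2; rewrite !mcoeffD !mcoeffZ !mcoeffXU !mcoeff0 !eqxx.
by rewrite (negPf ij) eq_sym (negPf ij) !mulr0 !mulr1 addr0 add0r.
Qed.

Lemma variables_coprime (p : R) : prime_elt p -> ~ forall i : 'I_3, principal p 'X_i.
Proof.
move=> pp h; have [a [b [ab e]]] :=
  prime_linear_forms pp (dhomogXU _ 0) (dhomogXU _ 1) (h 0) (h 1).
by have [//|a0 b0] := XU_independent _ e; rewrite a0 b0 eqxx in ab.
Qed.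

End Linear.

Section Jacobian.
Variables (k : fieldType).
Local Notation R := {mpoly k[3]}.
Hypothesis k0 : [pchar k] =i pred0.
Variables (d : nat) (f : R).
Hypotheses (f0 : f != 0) (fh : f \is d.+1.-homog).
Local Notation df := (fun i : 'I_3 => f^`M(i)).
Local Notation X := (fun i : 'I_3 => 'X_i : R).

Lemma natS_neq0 n : n.+1%:R != 0 :> k.
Proof. by have /pcharf0P -> := k0. Qed.

Lemma dot_X_df : dot X df = d.+1%:R *: f.
Proof. exact: euler. Qed.

Lemma df_homog i : df i \is d.-homog.
Proof. exact: dhomog_mderiv. Qed.

Lemma prime_divides_euler p : (forall i, principal p (df i)) -> principal p f.
Proof.
move=> h; have : principal p (d.+1%:R *: f).
  by rewrite -dot_X_df; apply: principal_sum => i _; apply: principal_mull; exact: h.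
case=> c ec; exists (d.+1%:R^-1 *: c); rewrite -scalerAl -ec scalerA mulVf ?scale1r //.
exact: natS_neq0.
Qed.

Lemma euler_eq0 p n : p \is n.+1.-homog -> (forall i : 'I_3, p^`M(i) = 0) -> p = 0 :> R.
Proof.
move=> hp h; have := euler hp; rewrite big1 => [|i _]; last by rewrite h mulr0.
move/esym; rewrite -mul_mpolyC => /eqP; rewrite mulf_eq0 mpolyC_eq0.
by rewrite (negPf (natS_neq0 n)) => /eqP.
Qed.

Hypothesis fr : reduced f.

(** By Euler's formula [p] divides [f = g p], and then it divides [g] times each derivative of [p].
    In characteristic zero some derivative of [p] is nonzero, of smaller degree than [p], so [p]
    divides [g] and [f] has a square factor. *)
Lemma partials_coprime p : prime_elt p -> ~ forall i, principal p (df i).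
Proof.
move=> pp hdf; have [p0 pu pm] := pp.
have [g eg] := prime_divides_euler hdf.
have [n hp _] := dhomog_principal f0 fh (ex_intro _ g eg).
have n0 := nonunit_dhomog_gt0 p0 hp pu.
have [i hi] : exists i : 'I_3, ~ principal p (p^`M(i)).
  apply: contrapT => /forallNP h; case/negP: p0; apply/eqP.
  case: n n0 hp => // n _ hp; apply: (euler_eq0 hp) => i.
  apply: (principal_lt hp (dhomog_mderiv _ hp)) => //.
  by apply: contrapT; exact: h.
have [h eh] : principal p g.
  have : principal p (g * p^`M(i)).
    have -> : g * p^`M(i) = df i - g^`M(i) * p by rewrite /= eg mderivM; ring.
    by apply: principalB => //; apply: principal_mull; exact: principal_refl.
  by case/pm.
have ef : f = h * p ^+ 2 by rewrite eg eh; ring.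
have hp0 : h * p != 0.
  by apply: contraNneq f0 => e0; rewrite ef expr2 mulrA e0 mul0r.
have : principal f (h * p).
  by apply: (fr (m := 2)); exists h; rewrite ef; ring.
case=> w ew; case/negP: pu; apply/unitrPr; exists (w * 1).
by apply: (mulfI hp0); rewrite mulr1 {2}ew ef; ring.
Qed.

End Jacobian.

(** * Two coprime linear combinations *)

Section CoprimePair.
Variable (k : closedFieldType).

Lemma exists_notin (s : seq k) : exists t, t \notin s.
Proof.
have [->|s0] := eqVneq s [::]; first by exists 0.
have [|t /rootP ht] := closed_rootP (\prod_(a <- s) ('X - a%:P) - 1) _.
  rewrite size_polyDl ?size_prod_XsubC; first by case: s s0.
  by rewrite size_polyN size_poly1; case: s s0.
exists t; apply/negP => ts; move: ht; rewrite hornerD hornerN hornerC.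
have /rootP -> : root (\prod_(a <- s) ('X - a%:P)) t by rewrite root_prod_XsubC.
by move/eqP; rewrite sub0r oppr_eq0 oner_eq0.
Qed.

Lemma coprime_principal (D : idomainType) (a b p : D) : factorial_ring D -> b != 0 ->
  (forall q, prime_elt q -> principal q b -> ~ principal q a) ->
  principal b (p * a) -> principal b p.
Proof.
move=> HD b0; elim/(factorial_ind HD): b / b0 p => [u uu|q b qp b0 IH] p hq.
  by move=> _; exact: unit_principal.
case=> c ec; have [q0 _ qm] := qp.
have qa := hq q qp (principal_mulr _ (principal_refl q)).
have [p' ep] : principal q p.
  have h : principal q (p * a).
    by rewrite ec; exact/principal_mull/principal_mulr/principal_refl.
  by case: (qm p a h) => // /qa.
have hb : principal b (p' * a).
  exists c; apply: (mulfI q0).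
  by transitivity (p * a); [rewrite ep; ring | rewrite ec; ring].
have [c' ec'] := IH p' (fun r rp rb => hq r rp (principal_mull _ rb)) hb.
by exists c'; rewrite ep ec'; ring.
Qed.

Local Notation R := {mpoly k[3]}.

(** Take [b = g i] and [a = g j + t *: g l]. A prime factor of [g i] excludes at most one value of
    [t], since with two excluded values it would divide all three entries. *)
Lemma coprime_pair (g : 'I_3 -> R) :
  (forall p, prime_elt p -> ~ forall i, principal p (g i)) ->
  exists (c c' : 'I_3 -> k), let a := \sum_i c i *: g i in let b := \sum_i c' i *: g i in
    b != 0 /\ (forall p, principal b (p * a) -> principal b p).
Proof.
move=> hg; have HR := @factorial_mpoly k 3.
have [i gi] : exists i, g i != 0.
  apply: contrapT => /forallNP h.
  have [p pp _] : exists2 p : R, prime_elt p & principal p 'X_0.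
    apply: (prime_divisor HR); first by rewrite -msize_poly_eq0 msizeX mdeg1.
    exact: dhomogS_nonunit (dhomogXU _ _).
  apply: (hg p pp) => j; move/negP/negPn/eqP: (h j) => ->; exact: principal0.
have [u [s [uu hs es]]] := HR (g i) gi.
pose j := lift i (0 : 'I_2); pose l := lift i (1 : 'I_2).
have /choice[bad hbad] : forall p : R, exists b : k, p \in s ->
    forall t, t != b -> ~ principal p (g j + t *: g l).
  move=> p; have [[t0 ht0]|] := pselect (exists t, principal p (g j + t *: g l)).
    exists t0 => ps t tt0 ht; have pp := hs p ps; have [_ pu pm] := pp.
    have pl : principal p (g l).
      have [c ec] := principalB ht ht0; exists ((t - t0)^-1 *: c).
      rewrite -scalerAl -ec opprD addrACA subrr add0r -scalerBl scalerA mulVf ?scale1r //.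
      by rewrite subr_eq0.
    have pj : principal p (g j).
      rewrite -[g j](addrK (t *: g l)) -mul_mpolyC; apply: principalB.
        by rewrite mul_mpolyC.
      exact: principal_mull.
    apply: (hg p pp) => m; case: (unliftP i m) => [h ->|->].
      by case: (ord2P h) => ->.
    rewrite es; apply: principal_mull; rewrite (big_rem p) //=.
    exact/principal_mulr/principal_refl.
  by move/forallNP => h; exists 0 => _ t _; exact: h.
have [t ht] := exists_notin [seq bad p | p <- s].
exists (fun m => if m == j then 1 else if m == l then t else 0), (fun m => (m == i)%:R).
have ij : (i == j) = false by apply/negP/negP; exact: neq_lift.
have il : (i == l) = false by apply/negP/negP; exact: neq_lift.
have jl : (l == j) = false by rewrite (inj_eq lift_inj).
move=> a b.
have eb : b = g i.
  rewrite /b (bigD1 i) //= eqxx scale1r big1 ?addr0 // => m /negPf ->.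
  by rewrite scale0r.
have ea : a = g j + t *: g l.
  rewrite /a (bigD1_ord i) //= ij il scale0r add0r big_ord_recl big_ord_recl big_ord0 addr0.
  have -> : lift i ord0 = j by [].
  have -> : lift i (lift ord0 ord0) = l by congr (lift i _); apply: val_inj.
  by rewrite !eqxx jl scale1r.
rewrite eb ea; split=> // p; apply: (coprime_principal HR gi) => q qp.
have [_ qu qm] := qp; rewrite es => /qm.
case=> [/(principal_unit uu) h|]; first by rewrite h in qu.
case/(prime_elt_prod qp) => p' p's [c ec].
have hb : t != bad p'.
  by apply: contraNneq ht => ->; apply: map_f.
move=> hq; apply: (hbad p' p's t hb); apply: principal_trans hq.
have [p'0 p'u p'm] := hs p' p's.
have [|[x ex]|//] := p'm c q; first by rewrite -ec; exact: principal_refl.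
case/negP: qu; apply/unitrPr; exists x; apply: (mulfI p'0).
by rewrite mulr1 {2}ec ex; ring.
Qed.

End CoprimePair.

(** * The Jacobian ideal at the nodes *)

Section Singularities.
Variable (k : closedFieldType).
Local Notation R := {mpoly k[3]}.
Hypothesis k0 : [pchar k] =i pred0.
Variables (d : nat) (f : R).
Hypotheses (d1 : (0 < d)%N) (f0 : f != 0) (fh : f \is d.+1.-homog) (fn : nodal f).
Local Notation df := (fun i : 'I_3 => f^`M(i)).
Local Notation X := (fun i : 'I_3 => 'X_i : R).

Lemma meval_euler v : (forall j, (df j).@[v] = 0) -> f.@[v] = 0.
Proof.
move=> h; have := congr1 (meval v) (dot_X_df fh).
rewrite /dot raddf_sum /= big1 => [|i _]; last by rewrite mevalM h mulr0.
rewrite mevalZ => /esym/eqP; rewrite mulf_eq0 (negPf (natS_neq0 k0 d)) => /eqP//.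
Qed.

Lemma singular_minor v i : v i != 0 -> (forall j, (df j).@[v] = 0) ->
  let a := lift i 0 in let b := lift i 1 in
  (f^`M(a)^`M(a)).@[v] * (f^`M(b)^`M(b)).@[v] - (f^`M(a)^`M(b)).@[v] ^+ 2 != 0.
Proof.
move=> vi dv; have fv := meval_euler dv; apply: node_minor => //.
by case: fn => _; exact.
Qed.

Lemma sum_lift (A : nmodType) (F : 'I_3 -> A) i :
  \sum_j F j = F i + (F (lift i 0) + F (lift i 1)).
Proof.
rewrite (bigD1_ord i) //= big_ord_recl big_ord_recl big_ord0 addr0.
by congr (_ + (F _ + F _)); congr (lift i _); apply: val_inj.
Qed.

(** At [v] the derivative of the syzygy relation says that the Hessian kills the value of [s], and
    Euler's formula that it kills [v]. Their combination [w] has zero entry at [i], and the Hessian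
    minor avoiding [i] is nonzero. *)
Lemma syz_at_node s v i : syz f s -> v i = 1 -> (forall j, (df j).@[v] = 0) ->
  forall j, (s 0 j).@[v] = (s 0 i).@[v] * v j.
Proof.
move=> hs vi dv; pose H a b := (f^`M(a)^`M(b)).@[v].
pose w j := (s 0 j).@[v] - (s 0 i).@[v] * v j.
have Hs a : \sum_b (s 0 b).@[v] * H b a = 0.
  have e0 : ((\sum_i s 0 i * f^`M(i))^`M(a)).@[v] = 0 by rewrite hs mderiv0 meval0.
  rewrite -[RHS]e0 (raddf_sum (mderiv a)) (raddf_sum (meval v)).
  apply: eq_bigr => b _ /=.
  by rewrite mderivM mevalD !mevalM dv mulr0 add0r.
have Hv a : \sum_b v b * H b a = 0.
  have hd : df a \is d.-1.+1.-homog by rewrite prednK //; exact: df_homog.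
  have e0 : (\sum_b 'X_b * (df a)^`M(b)).@[v] = 0.
    by rewrite (euler hd) mevalZ dv mulr0.
  rewrite -[RHS]e0 (raddf_sum (meval v)); apply: eq_bigr => b _ /=.
  by rewrite mevalM mevalXU /H mderiv_comm.
have Hw a : w (lift i 0) * H (lift i 0) a + w (lift i 1) * H (lift i 1) a = 0.
  have wi : w i = 0 by rewrite /w vi mulr1 subrr.
  have : \sum_b w b * H b a = 0.
    rewrite /w; under eq_bigr do rewrite mulrBl -mulrA.
    by rewrite sumrB Hs -mulr_sumr Hv mulr0 subr0.
  by rewrite (sum_lift _ i) wi mul0r add0r.
have vi0 : v i != 0 by rewrite vi oner_eq0.
have := singular_minor vi0 dv; cbv zeta; set a := lift i 0; set b := lift i 1.
rewrite -/(H a a) -/(H b b) -/(H a b) => det.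
have Hab : H b a = H a b by rewrite /H mderiv_comm.
have wa : w a = 0.
  apply/eqP; rewrite -(mulIr_eq0 _ (mulIf det)).
  have -> : w a * (H a a * H b b - H a b ^+ 2) =
    (w a * H a a + w b * H b a) * H b b - (w a * H a b + w b * H b b) * H a b.
    by rewrite Hab; ring.
  by rewrite !Hw !mul0r subr0.
have wb : w b = 0.
  apply/eqP; rewrite -(mulIr_eq0 _ (mulIf det)).
  have -> : w b * (H a a * H b b - H a b ^+ 2) =
    (w a * H a b + w b * H b b) * H a a - (w a * H a a + w b * H b a) * H a b.
    by rewrite Hab; ring.
  by rewrite !Hw !mul0r subr0.
move=> j; apply/eqP; rewrite -subr_eq0 -/(w j).
case: (unliftP i j) => [h ->|->]; last by rewrite /w vi mulr1 subrr.
by case: (ord2P h) => ->; [rewrite wa|rewrite wb].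
Qed.

Lemma taylor_at (v : 'I_3 -> k) (i : 'I_3) n (q : R) : v i = 1 -> q \is n.+1.-homog -> q.@[v] = 0 ->
  exists a : 'I_2 -> R, [/\ forall h, a h \is n.-homog,
    q = \sum_h a h * ('X_(lift i h) - v (lift i h) *: 'X_i)
    & forall h, (a h).@[v] = (q^`M(lift i h)).@[v]].
Proof.
move=> vi hq qv; have [c ec] := sub_line v i hq.
pose l j : R := 'X_j - v j *: 'X_i; pose a h := hcomp n (c (lift i h)).
have hl j : l j \is 1.-homog.
  by apply: rpredB; [exact: dhomogXU | apply: rpredZ; exact: dhomogXU].
have eq : q = \sum_h a h * l (lift i h).
  rewrite -{1}(pihomog_dE hq); have -> : q = \sum_j c j * l j.
    by rewrite -ec qv scale0r subr0.
  rewrite raddf_sum /= (bigD1_ord i) //= {1}/l vi scale1r subrr mulr0 raddf0 add0r.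
  by apply: eq_bigr => h _; rewrite -[n.+1]addn1 (hcompMr _ _ (hl _)).
have lv j : (l j).@[v] = 0 by rewrite /l mevalB mevalZ !mevalXU vi mulr1 subrr.
have dl h h' : ((l (lift i h))^`M(lift i h')).@[v] = (h == h')%:R.
  rewrite /l mderivB mderivZ mevalB mevalZ !mderivXU !mevalC (inj_eq lift_inj).
  by rewrite (negPf (neq_lift _ _)) mulr0 subr0.
exists a; split=> // h; first exact: pihomogP.
have -> : (q^`M(lift i h)).@[v] =
    \sum_m ((a m * l (lift i m))^`M(lift i h)).@[v].
  by rewrite [in LHS]eq (raddf_sum (mderiv _)) (raddf_sum (meval v)).
rewrite (bigD1 h) //= [X in _ = _ + X]big1 => [|m mh].
  by rewrite mderivM mevalD !mevalM lv mulr0 add0r dl eqxx mulr1 addr0.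
by rewrite mderivM mevalD !mevalM lv mulr0 add0r dl (negPf mh) mulr0.
Qed.

Definition jac (p : R) : Prop := exists c : 'I_3 -> R, p = \sum_i c i * df i.

Lemma jac_ideal : ideal_closed jac.
Proof.
split=> [|a p q [c ->] [c' ->]].
  by exists (fun=> 0); rewrite big1 // => i _; rewrite mul0r.
exists (fun i => a * c i + c' i); rewrite mulr_sumr -big_split.
by apply: eq_bigr => i _ /=; rewrite mulrDl mulrA.
Qed.

Lemma jac_df i : jac (df i).
Proof.
exists (fun j => (j == i)%:R); rewrite (bigD1 i) //= eqxx mul1r big1 ?addr0 //.
by move=> j /negPf ->; rewrite mul0r.
Qed.

(* At a node two partial derivatives generate the maximal ideal of the local
   ring, by Cramer's rule. *)
Lemma local_multiplier (v : 'I_3 -> k) i n (p : R) : v i = 1 -> (forall j, (df j).@[v] = 0) ->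
  p \is n.-homog -> p.@[v] = 0 ->
  exists e h, [/\ h \is e.-homog, h.@[v] != 0 & jac (h * p)].
Proof.
move=> vi dv hp pv; have jI := jac_ideal.
case: n hp => [|n] hp.
  exists 0%N, 1; rewrite dhomog1 meval1 oner_eq0; split=> //.
  move: pv; rewrite (dhomog0_const hp) mevalC => ->.
  by rewrite mpolyC0 mulr0; exact: ideal0.
have hd a : df a \is d.-1.+1.-homog by rewrite prednK //; exact: df_homog.
set a := lift i 0; set b := lift i 1; pose l h : R := 'X_(lift i h) - v (lift i h) *: 'X_i.
have [A [hA eA vA]] := taylor_at vi (hd a) (dv a).
have [B [hB eB vB]] := taylor_at vi (hd b) (dv b).
have [C [hC eC vC]] := taylor_at vi hp pv.
have sum2 (F : 'I_2 -> R) : \sum_h F h = F 0 + F 1.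
  by rewrite big_ord_recl big_ord_recl big_ord0 addr0; congr (_ + F _); apply: val_inj.
rewrite !sum2 -!/(l _) in eA eB eC.
pose D := A 0 * B 1 - A 1 * B 0.
exists (d.-1 + d.-1)%N, D; split.
- by apply: rpredB; apply: dhomogM.
- have vi0 : v i != 0 by rewrite vi oner_eq0.
  have := singular_minor vi0 dv; cbv zeta.
  by rewrite /D mevalB !mevalM !vA !vB -/a -/b (mderiv_comm b a) expr2.
have -> : D * p = (C 0 * B 1 - C 1 * B 0) * df a + (C 1 * A 0 - C 0 * A 1) * df b.
  by rewrite eC eA eB /D; ring.
by apply: idealD => //; apply: idealMl => //; exact: jac_df.
Qed.

Lemma jac_bounded : exists n, (hf jac n <= n)%N.
Proof.
have [c [c' []]] := coprime_pair (partials_coprime k0 f0 fh (proj1 fn)).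
set a := \sum_i _; set b := \sum_i _ => b0 cop; have jI := jac_ideal.
have ha (x : 'I_3 -> k) : \sum_i x i *: df i \is d.-homog.
  by apply: rpred_sum => i _; apply: rpredZ; exact: df_homog.
have ja (x : 'I_3 -> k) : jac (\sum_i x i *: df i).
  by exists (fun i => (x i)%:MP); apply: eq_bigr => i _; rewrite mul_mpolyC.
(* Degree at least [d + d] makes the bound [d * d] valid, and degree at least [d * d] makes it small
   enough for the Nullstellensatz. *)
exists (maxn (d * d) (d + d))%N; apply: leq_trans (leq_maxl _ _).
apply: (coprime_hf_le (ideal_linear_closed jI) _ _ (ha c) (ha c') b0 cop).
- by move=> p; apply: idealMl => //; exact: ja.
- by move=> p; apply: idealMl => //; exact: ja.
exact: leq_maxr.
Qed.

(** The Nullstellensatz is applied to the ideal quotient of [jac] by [p]. Its zeros would be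
    singular points, and there [local_multiplier] provides an element of it that does not vanish. *)
Lemma jac_saturation n (p : R) : p \is n.-homog ->
  (forall v i, v i = 1 -> (forall j, (df j).@[v] = 0) -> p.@[v] = 0) ->
  exists N, forall m q, (N <= m)%N -> q \is m.-homog -> jac (q * p).
Proof.
move=> hp pv; have jI := jac_ideal.
have [L [L1 hL]] := projective_nullstellensatz jI jac_bounded.
have [||//|[v vL hv]] := hL (fun q => jac (q * p)).
- split=> [|a x y hx hy]; first by rewrite mul0r; exact: ideal0.
  by rewrite mulrDl -mulrA; case: jI => _; exact.
- by move=> q jq; apply: idealMr.
have [i vi] := L1 v vL.
have dv j : (df j).@[v] = 0.
  by apply: (hv d); [exact: df_homog | apply: idealMr => //; exact: jac_df].
have [e [h [hh hv0 jh]]] := local_multiplier vi dv hp (pv v i vi dv).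
by rewrite (hv e h hh jh) eqxx in hv0.
Qed.

End Singularities.

(** * Degrees of syzygies *)

Section Eigenvalue.
Variable (k : closedFieldType).
Local Notation R := {mpoly k[3]}.

(** Modulo [F] the fraction [x / y] acts on the span of the [u i] through [M]. By Cayley-Hamilton
    the product of the [M - a] over the roots of the characteristic polynomial is zero, so some
    factor sends a combination not divisible by [F] to a divisible one; its product with
    [x - a *: y] is then divisible by [F]. *)
Lemma prime_eigenvalue (F x y : R) N (u : 'I_N -> R) (M : 'M[k]_N) : prime_elt F ->
  (forall i, principal F (x * u i - y * \sum_l M i l *: u l)) ->
  (exists i, ~ principal F (u i)) -> exists a : k, principal F (x - a *: y).
Proof.
move=> pF hM [i0 ui0]; case: N u M hM i0 ui0 => [|N] u M hM i0 ui0; first by case: i0 ui0.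
pose ev (r : 'rV[k]_N.+1) : R := \sum_i r 0 i *: u i.
have evM r : principal F (x * ev r - y * ev (r *m M)).
  have -> : x * ev r - y * ev (r *m M) =
      \sum_i (r 0 i)%:MP * (x * u i - y * \sum_l M i l *: u l).
    have -> : ev (r *m M) = \sum_i r 0 i *: \sum_l M i l *: u l.
      rewrite /ev; under eq_bigr do rewrite mxE scaler_suml.
      rewrite exchange_big; apply: eq_bigr => i _ /=; rewrite scaler_sumr.
      by apply: eq_bigr => l _; rewrite scalerA.
    rewrite /ev !mulr_sumr -sumrB; apply: eq_bigr => i _.
    by rewrite -!mul_mpolyC; ring.
  by apply: principal_sum => i _; exact: principal_mull.
have evB r a : ev (r *m (M - a%:M)) = ev (r *m M) - a *: ev r.
  rewrite mulmxBr mul_mx_scalar /ev scaler_sumr -sumrB; apply: eq_bigr => i _.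
  by rewrite !mxE scalerBl scalerA.
have step (rs : seq k) r : ~ principal F (ev r) ->
    principal F (ev (r *m \prod_(a <- rs) (M - a%:M))) ->
    exists a r', ~ principal F (ev r') /\ principal F (ev (r' *m (M - a%:M))).
  elim: rs r => [|a rs IH] r hr; first by rewrite big_nil mulmx1.
  rewrite big_cons mulmxA => hp.
  have [h|h] := pselect (principal F (ev (r *m (M - a%:M)))); first by exists a, r.
  exact: IH h hp.
have [rs ers] := closed_field_poly_normal (char_poly M).
rewrite (monicP (char_poly_monic M)) scale1r in ers.
have CH : \prod_(a <- rs) (M - a%:M) = 0.
  have := Cayley_Hamilton M; rewrite ers rmorph_prod => <-; apply: eq_bigr => a _.
  by rewrite rmorphB /= horner_mx_X horner_mx_C.
have [||a [r [hr ha]]] := step rs (delta_mx 0 i0).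
- rewrite /ev (bigD1 i0) //= mxE !eqxx scale1r big1 ?addr0 // => i /negPf ni.
  by rewrite mxE ni andbF scale0r.
- rewrite CH mulmx0 /ev big1; first exact: principal0.
  by move=> i _; rewrite mxE scale0r.
exists a; have [_ _ pm] := pF.
have : principal F ((x - a *: y) * ev r).
  have -> : (x - a *: y) * ev r = (x * ev r - y * ev (r *m M))
     + y * ev (r *m (M - a%:M)).
    by rewrite evB -!mul_mpolyC; ring.
  by apply: principalD; [exact: evM | exact: principal_mull].
by case/pm.
Qed.

End Eigenvalue.

(** * The lower bound for the degree of a syzygy *)

Section SyzygyDegree.
Variable (k : closedFieldType).
Local Notation R := {mpoly k[3]}.
Hypothesis k0 : [pchar k] =i pred0.
Variables (d : nat) (f : R).
Hypotheses (d1 : (0 < d)%N) (f0 : f != 0) (fh : f \is d.+1.-homog) (fn : nodal f).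
Local Notation df := (fun i : 'I_3 => f^`M(i)).
Local Notation X := (fun i : 'I_3 => 'X_i : R).
Local Notation crossX s := (cross X (s 0)).
Implicit Types (s : 'rV[R]_3).

Lemma crossX_homog e s j : homog_row e s -> crossX s j \is e.+1.-homog.
Proof.
move=> hs; have h i l : 'X_i * s 0 l \is e.+1.-homog.
  by rewrite -[e.+1]add1n; apply: dhomogM; [exact: dhomogXU | exact: hs].
by case: (ord3P j) => ->; rewrite /cross /=; apply: rpredB; exact: h.
Qed.

Lemma crossX_df s i j : syz f s -> principal f (crossX s i * df j - crossX s j * df i).
Proof.
move=> hs; have [c1 [c2 ->]] := cross_parallel X (s 0) df i j.
rewrite (dot_X_df fh); have -> : dot (s 0) df = 0 by [].
rewrite mulr0 addr0 -mul_mpolyC.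
exact/principal_mull/principal_mull/principal_refl.
Qed.

Lemma crossX_node s : syz f s -> forall v i, v i = 1 ->
  (forall j, (df j).@[v] = 0) -> forall j, (crossX s j).@[v] = 0.
Proof.
move=> hs v i vi dv j.
have [c h] : exists c, forall j, (s 0 j).@[v] = c * v j.
  by exists (s 0 i).@[v]; exact: (syz_at_node k0 d1 fh fn hs vi dv).
by case: (ord3P j) => ->; rewrite /cross /= mevalB !mevalM !mevalXU !h; ring.
Qed.

(** Such an [s] is a multiple of the vector of variables, and by Euler's formula only the zero
    multiple is a syzygy. *)
Lemma crossX_eq0 s : syz f s -> (forall j, crossX s j = 0) -> s = 0.
Proof.
move=> hs h; have hp := cross_eq0 h.
have [a ha] : exists a, forall i, s 0 i = a * X i.
  have X0 : 'X_0 != 0 :> R by rewrite -msize_poly_eq0 msizeX mdeg1.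
  have HR := @factorial_mpoly k 3.
  apply: (@primitive_proportional _ HR 'I_3 (s 0) X 'X_0 (s 0 0) X0).
    by move=> p pp; exact: variables_coprime.
  by move=> i; rewrite (hp 0 i) mulrC.
have : a * (d.+1%:R *: f) = 0.
  rewrite -(dot_X_df fh) /dot mulr_sumr -[RHS]hs; apply: eq_bigr => i _.
  by rewrite ha mulrA.
move/eqP; rewrite mulf_eq0 -mul_mpolyC mulf_eq0 mpolyC_eq0 (negPf (natS_neq0 k0 d)).
rewrite (negPf f0) /= orbF => /eqP a0.
by apply/rowP => i; rewrite mxE ha a0 mul0r.
Qed.

(* The multiplier [crossX s j / df j], of degree [e + 1 - d], acts on the
   Jacobian ideal in high degree; multiplied by [L] it has degree zero, hence
   an eigenvalue modulo each component [F] of the curve. *)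
Lemma component_eigenvalue e c s (F L : R) : syz f s -> homog_row e s ->
  prime_elt F -> principal F f -> L \is c.-homog -> (c + e.+1 = d)%N ->
  exists a : k, forall j, principal F (L * crossX s j - a *: df j).
Proof.
move=> hs hh pF Ff hL ed; have [F0 Fu Fm] := pF.
have /choice[N hN] : forall j, exists N, forall m q, (N <= m)%N -> q \is m.-homog ->
    jac f (q * crossX s j).
  move=> j; apply: (jac_saturation k0 d1 f0 fh fn (crossX_homog j hh)).
  by move=> v i vi dv; exact: crossX_node vi dv j.
have [m hm] : exists m, forall j, (N j <= m)%N.
  by exists (\sum_j N j)%N => j; rewrite (bigD1 j) //= leq_addr.
(* [ev] maps [V] onto the combinations of the partial derivatives with coefficients of degree [m],
   and [gv] is [ev] followed by the multiplier. The choice [t] of preimages need not be linear: the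
   matrix uses it on a basis only. *)
pose V := {ffun 'I_3 -> dhomog 3 k m}.
pose ev (w : V) : R := \sum_j val (w j) * df j.
pose gv (w : V) : R := L * \sum_j val (w j) * crossX s j.
have /choice[t ht] : forall w : V, exists t : V, gv w = ev t.
  move=> w.
  have [b eb] : jac f (gv w).
    have jI := jac_ideal f; apply: idealMl => //; apply: ideal_sum => // j _.
    by apply: (hN j m) => //; exact: dhomog_is_dhomog.
  exists [ffun j => proj_homog m (b j)].
  have hg : gv w \is (m + d).-homog.
    rewrite -ed addnCA; apply: dhomogM => //; apply: rpred_sum => j _.
    by apply: dhomogM; [exact: dhomog_is_dhomog | exact: crossX_homog].
  rewrite -(pihomog_dE hg) eb raddf_sum; apply: eq_bigr => j _ /=.
  by rewrite (hcompMr _ _ (df_homog fh j)) ffunE.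
have [j0 hj0] : exists j0, ~ principal F (df j0).
  exact/existsNP/(partials_coprime k0 f0 fh (proj1 fn) pF).
pose b := vbasis {:V}.
have eb w : w = \sum_i coord b i w *: b`_i :> V.
  exact: coord_basis (vbasisP _) (memvf w).
have evD w : ev w = \sum_i coord b i w *: ev b`_i.
  rewrite {1}[w]eb /ev; under [in RHS]eq_bigr do rewrite scaler_sumr.
  rewrite [in RHS]exchange_big; apply: eq_bigr => j _ /=.
  rewrite sum_ffunE raddf_sum mulr_suml; apply: eq_bigr => i _.
  by rewrite ffunE scalerAl.
have [||a ha] := @prime_eigenvalue _ F (L * crossX s j0) (df j0) _ (fun i => ev b`_i)
   (\matrix_(i, l) coord b l (t b`_i)) pF.
- move=> i; have -> : \sum_l (\matrix_(i, l) coord b l (t b`_i)) i l *: ev b`_l = gv b`_i.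
    by rewrite ht evD; apply: eq_bigr => l _; rewrite mxE.
  have -> : L * crossX s j0 * ev b`_i - df j0 * gv b`_i =
      \sum_j L * val (b`_i j) * (crossX s j0 * df j - crossX s j * df j0).
    rewrite /ev /gv !mulr_sumr -sumrB; apply: eq_bigr => j _; ring.
  apply: principal_sum => j _; apply: principal_mull.
  exact: principal_trans Ff (crossX_df _ _ hs).
- apply: contrapT => /forallNP hall.
  have hev w : principal F (ev w).
    rewrite evD; apply: principal_sum => i _; rewrite -mul_mpolyC.
    by apply: principal_mull; apply: contrapT; exact: hall.
  have [i hi] : exists i, ~ principal F ('X_i : R).
    exact/existsNP/variables_coprime.
  have hXm : ('X_i ^+ m : R) \is m.-homog.
    by have := dhomogMn m (dhomogXU k i); rewrite mul1n.
  have := hev [ffun j => if j == j0 then proj_homog m ('X_i ^+ m) else 0].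
  have -> : ev [ffun j => if j == j0 then proj_homog m ('X_i ^+ m) else 0] =
      'X_i ^+ m * df j0.
    rewrite /ev (bigD1 j0) // ffunE eqxx val_proj_homog //= big1 ?addr0 // => j /negPf nj.
    by rewrite ffunE nj mul0r.
  by case/Fm => // /(prime_eltX pF).
exists a => j.
have : principal F (df j0 * (L * crossX s j - a *: df j)).
  have -> : df j0 * (L * crossX s j - a *: df j) =
    df j * (L * crossX s j0 - a *: df j0)
    + L * (crossX s j * df j0 - crossX s j0 * df j).
    by rewrite -!mul_mpolyC; ring.
  apply: principalD; first exact: principal_mull.
  exact/principal_mull/(principal_trans Ff (crossX_df _ _ hs)).
by case/Fm.
Qed.

Lemma component_vanishing e s F : syz f s -> homog_row e s -> prime_elt F ->
  principal F f -> (e.+2 <= d)%N -> forall j, principal F (crossX s j).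
Proof.
move=> hs hh pF Ff; have [F0 Fu Fm] := pF.
have [i hi] : exists i, ~ principal F ('X_i : R) by exact/existsNP/variables_coprime.
move hc : (d - e.+2)%N => c; elim: c e s hs hh hc => [|c IH] e s hs hh hc led j; last first.
  have : principal F (crossX ('X_i *: s) j).
    apply: (IH e.+1); last by lia.
    - rewrite /syz; under eq_bigr do rewrite mxE -mulrA.
      by rewrite -mulr_sumr hs mulr0.
    - by move=> l; rewrite mxE -[e.+1]add1n; apply: dhomogM; [exact: dhomogXU | exact: hh].
    by lia.
  have -> : crossX ('X_i *: s) j = 'X_i * crossX s j.
    by case: (ord3P j) => ->; rewrite /cross /= !mxE; ring.
  by case/Fm.
have ed : (1 + e.+1 = d)%N by lia.
have /choice[a ha] : forall i : 'I_3, exists a : k, forall j,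
    principal F ('X_i * crossX s j - a *: df j).
  by move=> l; exact: component_eigenvalue hs hh pF Ff (dhomogXU k l) ed.
have [a0|/existsNP[l /eqP al]] := pselect (forall l, a l = 0).
  have := ha i j; rewrite a0 scale0r subr0.
  by case/Fm.
have hl b : principal F ((a l *: 'X_b - a b *: 'X_l) * crossX s j).
  have -> : (a l *: 'X_b - a b *: 'X_l) * crossX s j =
     a l *: ('X_b * crossX s j - a b *: df j) - a b *: ('X_l * crossX s j - a l *: df j).
    by rewrite -!mul_mpolyC; ring.
  by apply: principalB; rewrite -mul_mpolyC; apply: principal_mull.
apply: contrapT => npj.
(* For the two indices [b] other than [l] these linear forms are independent, as [a l] is nonzero; a
   prime cannot divide both. *)
have hF b : principal F (a l *: 'X_b - a b *: 'X_l) by case: (Fm _ _ (hl b)).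
have h1 b : (a l *: 'X_b - a b *: 'X_l : R) \is 1.-homog.
  by apply: rpredB; apply: rpredZ; exact: dhomogXU.
have [x [y [xy e0]]] := prime_linear_forms pF (h1 (lift l 0)) (h1 (lift l 1))
  (hF _) (hF _).
have c1 := congr1 (mcoeff U_(lift l 0%R)) e0; have c2 := congr1 (mcoeff U_(lift l 1%R)) e0.
move: c1 c2; rewrite !(mcoeffD, mcoeffZ, mcoeffN, mcoeffXU, mcoeff0) !eqxx.
rewrite !(negPf (neq_lift _ _)) !(inj_eq lift_inj) /= !mulr0 !subr0 !mulr1 !mulr0 addr0 add0r.
move=> /eqP; rewrite mulf_eq0 (negPf al) orbF => /eqP x0.
move=> /eqP; rewrite mulf_eq0 (negPf al) orbF => /eqP y0.
by rewrite x0 y0 eqxx in xy.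
Qed.

(** All prime factors of [f] divide [p], so [f] divides the power of [p] whose exponent is their
    number; it remains to use that [f] is reduced. *)
Lemma reduced_principal (p : R) :
  (forall F, prime_elt F -> principal F f -> principal F p) -> principal f p.
Proof.
move=> h; have [u [s [uu hs es]]] := factorial_mpoly f0.
apply: (proj1 fn _ (size s)).
have hs' F : F \in s -> principal F p.
  move=> Fs; apply: h; first exact: hs.
  rewrite es; apply: principal_mull; rewrite (big_rem F) //=.
  exact/principal_mulr/principal_refl.
rewrite es; have : principal (\prod_(F <- s) F) (p ^+ size s).
  elim: s hs' {hs es} => [|F s IH] hs'; first by rewrite big_nil expr0; exact: principal_refl.
  rewrite big_cons exprS; have [c ec] := hs' F (mem_head _ _).
  have [|c' ec'] := IH; first by move=> G Gs; apply: hs'; rewrite inE Gs orbT.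
  by exists (c * c'); rewrite ec' {1}ec; ring.
case=> c ->; exists (c / u); rewrite mulrA; congr (_ * _); by rewrite divrK.
Qed.

Lemma syz_degree_bound e s : syz f s -> s != 0 -> homog_row e s -> (d <= e.+1)%N.
Proof.
move=> hs s0 hh; rewrite leqNgt; apply/negP => led; case/negP: s0; apply/eqP.
apply: crossX_eq0 => // j.
apply: (principal_lt fh (crossX_homog j hh)); first by lia.
apply: reduced_principal => F pF Ff; exact: component_vanishing hh pF Ff led j.
Qed.

Lemma irreducible_prime_elt : irreducible f -> prime_elt f.
Proof. by case=> fu irr; apply: irreducible_prime => //; exact: factorial_mpoly. Qed.

Lemma syz_degree_irreducible e s : irreducible f -> syz f s -> s != 0 ->
  homog_row e s -> (d <= e)%N.
Proof.
move=> /irreducible_prime_elt pf hs s0 hh.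
have := syz_degree_bound hs s0 hh; rewrite leq_eqVlt => /orP[/eqP ed|//].
case/negP: s0; apply/eqP; apply: crossX_eq0 => //.
have [a ha] := component_eigenvalue hs hh pf (principal_refl f) (dhomog1 _ _) (esym ed).
have {}ha j : crossX s j = a *: df j.
  apply/eqP; rewrite -subr_eq0 -[crossX s j]mul1r; apply/eqP.
  apply: (principal_lt fh _ (ltnSn d)); last exact: ha.
  rewrite mul1r; apply: rpredB; last by apply: rpredZ; exact: df_homog.
  by rewrite ed; exact: crossX_homog.
have : a%:MP * (d.+1%:R *: f) = 0.
  rewrite -(dot_X_df fh) -[RHS](dot_crossl X (s 0)) /dot mulr_sumr.
  by apply: eq_bigr => i _; rewrite ha -mul_mpolyC; ring.
move/eqP; rewrite mulf_eq0 -mul_mpolyC mulf_eq0 !mpolyC_eq0 (negPf (natS_neq0 k0 d)).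
rewrite (negPf f0) /= orbF => /eqP a0 j.
by rewrite ha a0 scale0r.
Qed.

End SyzygyDegree.

(** * Free divisors *)

Section FreeDivisors.
Variable (k : closedFieldType).
Local Notation R := {mpoly k[3]}.
Hypothesis k0 : [pchar k] =i pred0.
Variables (d : nat) (f : R).
Hypotheses (d1 : (0 < d)%N) (f0 : f != 0) (fh : f \is d.+1.-homog) (fn : nodal f).
Local Notation df := (fun i : 'I_3 => f^`M(i)).
Local Notation X := (fun i : 'I_3 => 'X_i : R).
Local Notation crossX s := (cross X (s 0)).
Implicit Types (s t : 'rV[R]_3).

Lemma df_neq0 : exists i, df i != 0.
Proof.
apply: contrapT => /forallNP h; case/negP: f0; apply/eqP/(euler_eq0 k0 fh) => i.
by apply/eqP/negPn/negP; exact: h.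
Qed.

Lemma syz_linear a s t : syz f s -> syz f t -> syz f (a *: s + t).
Proof.
rewrite /syz => hs ht.
transitivity (a * (\sum_i s 0 i * df i) + \sum_i t 0 i * df i).
  rewrite mulr_sumr -big_split; apply: eq_bigr => i _ /=.
  by rewrite !mxE mulrDl mulrA.
by rewrite hs ht mulr0 addr0.
Qed.

Lemma syz0 : syz f 0.
Proof. by rewrite /syz big1 // => i _; rewrite mxE mul0r. Qed.

Lemma syzZ a s : syz f s -> syz f (a *: s).
Proof. by move=> hs; rewrite -[a *: s]addr0; apply: syz_linear => //; exact: syz0. Qed.

Lemma syzB s t : syz f s -> syz f t -> syz f (s - t).
Proof. by move=> hs ht; rewrite addrC -scaleN1r; exact: syz_linear. Qed.

Definition koszul (l : 'I_3) : 'rV[R]_3 := \row_j cross df (fun i => (i == l)%:R) j.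

Lemma syz_koszul l : syz f (koszul l).
Proof.
rewrite /syz -[RHS](dot_crossl df (fun i => (i == l)%:R)); apply: eq_bigr => i _.
by rewrite mxE mulrC.
Qed.

Lemma koszul_homog l : homog_row d (koszul l).
Proof.
move=> i; rewrite mxE; have h (a b : 'I_3) : df a * (b == l)%:R \is d.-homog.
  by case: (b == l); rewrite ?mulr1 ?mulr0 ?dhomog0 //; exact: df_homog.
by case: (ord3P i) => ->; rewrite /cross /=; apply: rpredB; exact: h.
Qed.

Lemma koszul_entries (P : R -> Prop) : (forall p, P p -> P (- p)) ->
  (forall l j, P (koszul l 0 j)) -> forall i, P (df i).
Proof.
move=> PN h i.
have h01 := h (lift ord0 ord0) ord0; have h12 := h (lift ord0 (lift ord0 ord0)) (lift ord0 ord0).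
have h20 := h ord0 (lift ord0 (lift ord0 ord0)).
move: h01 h12 h20; rewrite !mxE /cross /= !mulr0 !mulr1 !sub0r ?subr0 => /PN + /PN + /PN.
by rewrite !opprK => a b c; case: (ord3P i) => ->.
Qed.

(** Both rows are orthogonal to the gradient, so their cross product is proportional to it; the
    factor is a polynomial because the partial derivatives have no common prime factor. *)
Lemma syz_cross s t : syz f s -> syz f t ->
  exists h, forall i, cross (s 0) (t 0) i = h * df i.
Proof.
move=> hs ht; have [j dfj] := df_neq0.
apply: (@primitive_proportional _ (@factorial_mpoly k 3) 'I_3 (cross (s 0) (t 0)) df
  (df j) (cross (s 0) (t 0) j) dfj).
  by move=> p; exact: (partials_coprime k0 f0 fh (proj1 fn)).
move=> i; apply/eqP; rewrite -subr_eq0 mulrC.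
have [c1 [c2 ->]] := cross_parallel (s 0) (t 0) df i j.
have -> : dot (s 0) df = 0 by []; have -> : dot (t 0) df = 0 by [].
by rewrite !mulr0 addr0.
Qed.

Lemma cross_koszul s l : syz f s -> forall i,
  cross (s 0) (koszul l 0) i = s 0 l * df i.
Proof.
move=> hs i.
rewrite cross_anti (@eq_cross _ _ (cross df (fun i => (i == l)%:R)) _ (s 0)) //; last first.
  by move=> j; rewrite mxE.
rewrite cross_cross dotC; have -> : dot (s 0) df = 0 by [].
rewrite mul0r sub0r opprK; congr (_ * _).
by rewrite /dot (bigD1 l) //= eqxx mul1r big1 ?addr0 // => j /negPf ->; rewrite mul0r.
Qed.

Definition hrow n s : 'rV[R]_3 := \row_j hcomp n (s 0 j).

Lemma syz_hrow n s : syz f s -> syz f (hrow n s).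
Proof.
move=> hs; have := congr1 (hcomp (n + d)) hs; rewrite raddf0 raddf_sum => h.
rewrite /syz -[RHS]h; apply: eq_bigr => i _ /=.
by rewrite mxE (hcompMr _ _ (df_homog fh i)).
Qed.

Lemma hrow_homog n s : homog_row n (hrow n s).
Proof. by move=> i; rewrite mxE; exact: pihomogP. Qed.

Local Notation e := (indeg (syz f)).

(** The Koszul syzygies are homogeneous and not all zero, which excludes the default value of
    [indeg]. *)
Lemma indegP : (exists s, [/\ syz f s, s != 0 & homog_row e s]) /\
  forall n s, syz f s -> s != 0 -> homog_row n s -> (e <= n)%N.
Proof.
rewrite /indeg; case: pselect => [ex|nex].
  case: ex_minnP => n /asboolP hn nmin; split=> // m s hs s0 hh.
  by apply: nmin; apply/asboolP; exists s.
exfalso; apply: nex; exists d; apply/asboolP; apply: contrapT => /forallNP h.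
have [i dfi] := df_neq0; case/negP: dfi.
have hk l : koszul l = 0.
  apply/eqP/negPn/negP => /negP kl; apply: (h (koszul l)); split.
  - exact: syz_koszul.
  - exact/negP.
  - exact: koszul_homog.
have hz : forall i, df i = 0.
  by apply: (@koszul_entries (fun p => p = 0)) => [p ->|l j]; rewrite ?oppr0 // hk mxE.
by apply/eqP; exact: hz.
Qed.

Lemma indeg_min n s : syz f s -> homog_row n s -> (n < e)%N -> s = 0.
Proof.
move=> hs hh lt; apply/eqP; apply: contraTT lt => s0.
by rewrite -leqNgt; exact: (proj2 indegP) hh.
Qed.

Lemma indeg_bound : (d <= e.+1)%N.
Proof.
have [[s [hs s0 hh]] _] := indegP.
exact: (syz_degree_bound k0 d1 f0 fh fn hs s0 hh).
Qed.

Lemma indeg_irreducible : irreducible f -> (d <= e)%N.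
Proof.
move=> fi; have [[s [hs s0 hh]] _] := indegP.
exact: (syz_degree_irreducible k0 d1 f0 fh fn fi hs s0 hh).
Qed.

Lemma syz_low s n i : syz f s -> (n < e)%N -> hcomp n (s 0 i) = 0.
Proof.
move=> hs lt; have /rowP/(_ i) := indeg_min (syz_hrow n hs) (@hrow_homog n s) lt.
by rewrite !mxE.
Qed.

(** Saito's criterion for a basis whose size [r] is not known in advance. The cross products of
    basis rows are [u a b] times the gradient, with [u] alternating, and the entries of the Koszul
    syzygies are combinations of the [u a b]. So [u] is not zero, which excludes [r < 2]. *)
Lemma free_cross : free_divisor f -> exists s t (u : k), [/\ syz f s, syz f t, u != 0
  & forall i, cross (s 0) (t 0) i = u *: df i].
Proof.
case=> r [B [hB exB]].
have /choice[u' hu'] : forall ab : 'I_r * 'I_r, exists h, forall i,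
    cross (row ab.1 B 0) (row ab.2 B 0) i = h * df i.
  by move=> [a b]; apply: syz_cross; exact: hB.
pose u a b := u' (a, b).
have hu a b i : cross (row a B 0) (row b B 0) i = u a b * df i by exact: hu' (a, b) i.
have [j0 dfj0] := df_neq0.
have indep (c : 'rV[R]_r) : c *m B = 0 -> c = 0.
  move=> cB; have [c0 [_ uc]] := exB 0 syz0.
  by rewrite -(uc c) ?cB // -(uc 0) // mul0mx.
have uaa a : u a a = 0.
  apply: (mulIf dfj0); rewrite -hu mul0r.
  by case: (ord3P j0) => ->; rewrite /cross /=; ring.
have uab a b : u b a = - u a b.
  by apply: (mulIf dfj0); rewrite mulNr -!hu cross_anti.
have /choice[c hc] : forall l, exists c : 'rV[R]_r, koszul l = c *m B.
  by move=> l; have [c [h _]] := exB _ (syz_koszul l); exists c.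
have sum_u l l' : \sum_a \sum_b c l 0 a * c l' 0 b * u a b = koszul l 0 l'.
  apply: (mulIf dfj0); rewrite -(cross_koszul _ (syz_koszul l)) !hc.
  have -> : cross ((c l *m B) 0) ((c l' *m B) 0) j0 =
      \sum_a \sum_b c l 0 a * c l' 0 b * cross (row a B 0) (row b B 0) j0.
    have E i x : (c i *m B) 0 x = \sum_a c i 0 a * row a B 0 x.
      by rewrite mxE; apply: eq_bigr => a _; rewrite mxE.
    have P x y : (c l *m B) 0 x * (c l' *m B) 0 y =
       \sum_a \sum_b c l 0 a * c l' 0 b * (row a B 0 x * row b B 0 y).
      rewrite !E mulr_suml; apply: eq_bigr => a _; rewrite mulr_sumr.
      by apply: eq_bigr => b _; ring.
    have Q x y x' y' : (c l *m B) 0 x * (c l' *m B) 0 y -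
        (c l *m B) 0 x' * (c l' *m B) 0 y' =
       \sum_a \sum_b c l 0 a * c l' 0 b *
         (row a B 0 x * row b B 0 y - row a B 0 x' * row b B 0 y').
      rewrite !P -sumrB; apply: eq_bigr => a _; rewrite -sumrB.
      by apply: eq_bigr => b _; ring.
    by case: (ord3P j0) => ->; rewrite /cross /= Q.
  rewrite mulr_suml; apply: eq_bigr => a _; rewrite mulr_suml.
  by apply: eq_bigr => b _; rewrite hu mulrA.
have unz : ~ forall a b, u a b = 0.
  move=> uz; have hz : forall i, df i = 0.
    apply: (@koszul_entries (fun p => p = 0)) => [p ->|l j]; rewrite ?oppr0 //.
    by rewrite -sum_u big1 // => a _; rewrite big1 // => b _; rewrite uz mulr0.
  by move: dfj0; rewrite hz eqxx.
case: r B hB {exB hu'} u' u hu indep uaa uab c hc sum_u unz => [|[|[|r]]] B hB u' u hu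
  indep uaa uab c hc sum_u unz.
- by case: unz => -[].
- by case: unz => a b; rewrite !ord1 uaa.
(* For two basis rows [w] divides all Koszul entries, hence all partial derivatives, and so is a
   unit. *)
- pose w := u 0 1.
  have hw i : principal w (df i).
    apply: (@koszul_entries (principal w)) => [p|l j]; first exact: principalN.
    rewrite -sum_u; apply: principal_sum => a _; apply: principal_sum => b _.
    apply: principal_mull; case: (ord2P a) => ->; case: (ord2P b) => ->.
    - by rewrite uaa; exact: principal0.
    - exact: principal_refl.
    - by rewrite uab; apply: principalN; exact: principal_refl.
    - by rewrite uaa; exact: principal0.
  have w0 : w != 0.
    by apply: contraNneq dfj0 => wz; case: (hw j0) => x ->; rewrite wz mulr0.
  have wu : w \is a GRing.unit.
    apply: contrapT => /negP wu.
    have [q qp qw] := prime_divisor (@factorial_mpoly k 3) w0 wu.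
    apply: (partials_coprime k0 f0 fh (proj1 fn) qp) => i.
    exact: principal_trans qw (hw i).
  have [x x0 ew] := mpoly_unit_const wu.
  exists (row 0 B), (row 1 B), x; split; [exact: hB | exact: hB | exact: x0 |].
  by move=> i; rewrite hu -/w ew mul_mpolyC.
(* With three basis rows Cramer's rule is a linear relation whose coefficient at [c'] is [u a b];
   independence makes all [u a b] vanish. *)
case: unz => a b; have [->|ab] := eqVneq a b; first exact: uaa.
have [c' ca cb] : exists2 c' : 'I_r.+3, c' != a & c' != b.
  have : (#|[set a; b]| < #|'I_r.+3|)%N by rewrite cards2 ab card_ord.
  move=> h; have : ~~ ([set: 'I_r.+3] \subset [set a; b]).
    by apply: contraL h => /subset_leq_card; rewrite cardsT -leqNgt.
  by case/subsetPn => x _; rewrite !inE negb_or => /andP[]; exists x.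
pose rho : 'rV[R]_r.+3 := u b c' *: delta_mx 0 a + u c' a *: delta_mx 0 b
  + u a b *: delta_mx 0 c'.
have : rho *m B = 0.
  apply/rowP => i; rewrite !mulmxDl -!scalemxAl -!rowE !mxE.
  apply: (mulIf dfj0); rewrite mul0r.
  have := cross_relation (row a B 0) (row b B 0) (row c' B 0) i j0.
  have -> : dot (row a B 0) (cross (row b B 0) (row c' B 0)) = 0.
    transitivity (u b c' * dot (row a B 0) df).
      by rewrite /dot mulr_sumr; apply: eq_bigr => l _; rewrite hu; ring.
    by rewrite (_ : dot _ df = 0) ?mulr0 //; exact: hB.
  by rewrite mul0r !hu !mxE => <-; ring.
move/indep/rowP/(_ c'); rewrite !mxE !eqxx (negPf ca) (negPf cb) /=.
by rewrite !mulr0 !add0r mulr1.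
Qed.

(** The basis need not be homogeneous, but its entries have no component below degree [e], so their
    products have none below e + e, whereas the gradient has degree [d]. *)
Lemma free_indeg : free_divisor f -> (e + e <= d)%N.
Proof.
case/free_cross => s [t [u [hs ht u0 st]]]; rewrite leqNgt; apply/negP => lt.
have [i dfi] := df_neq0.
have hz : hcomp d (cross (s 0) (t 0) i) = 0.
  have h a b : hcomp d (s 0 a * t 0 b) = 0.
    rewrite (@hcompM_low _ _ e e); [|by move=> n ?; exact: syz_low..|exact: ltnW].
    by rewrite ltn_eqF.
  by case: (ord3P i) => ->; rewrite /cross /= pihomogB !h subr0.
move: hz; rewrite st hcompZ pihomog_dE; last exact: df_homog.
move/eqP; rewrite -mul_mpolyC mulf_eq0 mpolyC_eq0 (negPf u0) /=.
by rewrite (negPf dfi).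
Qed.

Lemma free_linear : free_divisor f -> (e + e = d)%N -> exists s t (u : k),
  [/\ [/\ syz f s, syz f t, homog_row e s & homog_row e t], u != 0
  & forall i, cross (s 0) (t 0) i = u *: df i].
Proof.
case/free_cross => s [t [u [hs ht u0 st]]] ed.
exists (hrow e s), (hrow e t), u; split=> //.
  by split; [exact: syz_hrow | exact: syz_hrow | exact: hrow_homog | exact: hrow_homog].
move=> i; rewrite -[in RHS](pihomog_dE (df_homog fh i)) -hcompZ -st.
have h a b : hcomp d (s 0 a * t 0 b) = hrow e s 0 a * hrow e t 0 b.
  rewrite !mxE (@hcompM_low _ _ e e); [|by move=> n ?; exact: syz_low..|by rewrite ed].
  by rewrite ed eqxx.
by case: (ord3P i) => ->; rewrite /cross /= pihomogB !h.
Qed.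

End FreeDivisors.

Section LinearChange.
Variable k : fieldType.
Local Notation R := {mpoly k[3]}.

Definition lform (m : 'I_3 -> k) : R := \sum_j m j *: 'X_j.

Lemma lform_coef (p : R) : p \is 1.-homog -> p = lform (fun j => p@_U_(j)).
Proof. exact: linear_form_coef. Qed.

Lemma meval_lform m v : (lform m).@[v] = \sum_j m j * v j.
Proof. by rewrite raddf_sum; apply: eq_bigr => j _ /=; rewrite mevalZ mevalXU. Qed.

Lemma linear_changeM (A : 'M[k]_3) : {morph linear_change A : p q / p * q}.
Proof. by move=> p q; exact: rmorphM. Qed.

Lemma linear_change_lform (A M : 'M[k]_3) i :
  linear_change A (lform (M i)) = lform ((M *m A) i).
Proof.
rewrite /linear_change /lform raddf_sum /=.
transitivity (\sum_j \sum_l (M i j * A j l) *: 'X_l : R).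
  apply: eq_bigr => j _; rewrite comp_mpolyZ comp_mpolyXU -tnth_nth tnth_mktuple.
  by rewrite scaler_sumr; apply: eq_bigr => l _; rewrite scalerA.
rewrite exchange_big; apply: eq_bigr => l _ /=.
by rewrite mxE scaler_suml.
Qed.

Lemma linear_change_inv (M : 'M[k]_3) i : M \in unitmx ->
  linear_change (invmx M) (lform (M i)) = 'X_i.
Proof.
move=> Mu; rewrite linear_change_lform mulmxV // /lform (bigD1 i) //= mxE eqxx scale1r.
by rewrite big1 ?addr0 // => j ji; rewrite mxE eq_sym (negPf ji) scale0r.
Qed.

Lemma unitmx_inj n (M : 'M[k]_n) :
  (forall v : 'rV[k]_n, v *m M = 0 -> v = 0) -> M \in unitmx.
Proof.
move=> h; rewrite -row_free_unit -kermx_eq0; apply/eqP/row_matrixP => i.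
rewrite row0; apply: h; apply/sub_kermxP; exact: row_sub.
Qed.

End LinearChange.

(** * Free divisors of degree two and three *)

Section Classification.
Variable (k : closedFieldType).
Local Notation R := {mpoly k[3]}.
Hypothesis k0 : [pchar k] =i pred0.
Variables (d : nat) (f : R).
Hypotheses (d1 : (0 < d)%N) (f0 : f != 0) (fh : f \is d.+1.-homog) (fn : nodal f).
Local Notation df := (fun i : 'I_3 => f^`M(i)).
Local Notation X := (fun i : 'I_3 => 'X_i : R).
Local Notation crossX s := (cross X (s 0)).
Local Notation e := (indeg (syz f)).

Lemma free_degree : free_divisor f -> d = (e + e)%N /\ d = e.+1 \/ d = 1%N /\ e = 0%N.
Proof.
move=> fd; have := free_indeg k0 f0 fh fn fd; have := indeg_bound k0 d1 f0 fh fn.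
lia.
Qed.

Lemma irreducible_not_free : irreducible f -> ~ free_divisor f.
Proof.
move=> fi /(free_indeg k0 f0 fh fn); have := indeg_irreducible k0 d1 f0 fh fn fi.
lia.
Qed.

Lemma homog_reducible (p : R) n : p != 0 -> p \is n.-homog -> p \isn't a GRing.unit ->
  ~ irreducible p -> exists q r n1 n2, [/\ q \is n1.+1.-homog, r \is n2.+1.-homog,
    (n1 + n2).+2 = n & p = q * r].
Proof.
move=> p0 hp pu nirr.
have [q [r [ep qu ru]]] : exists q r, [/\ p = q * r, q \isn't a GRing.unit
    & r \isn't a GRing.unit].
  apply: contrapT => /forallNP h; apply: nirr; split=> // q r ep.
  apply: contrapT => /not_orP[/negP qu /negP ru].
  by case/forallNP/(_ r): (h q); split.
rewrite ep in p0 hp; have [n1 [n2 [hq hr en]]] := dhomog_factors p0 hp.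
have /norP[q0 r0] : ~~ ((q == 0) || (r == 0)) by rewrite -mulf_eq0.
have n10 := nonunit_dhomog_gt0 q0 hq qu; have n20 := nonunit_dhomog_gt0 r0 hr ru.
exists q, r, n1.-1, n2.-1; rewrite !prednK //; split=> //; lia.
Qed.

Lemma free_two_lines : d = 1%N -> free_divisor f ->
  exists A : 'M[k]_3, A \in unitmx /\ linear_change A f = 'X_0 * 'X_1.
Proof.
move=> ed fd; have fi : ~ irreducible f by move/irreducible_not_free.
have [p [q [a [b [hp hq eab ef]]]]] := homog_reducible f0 fh (dhomogS_nonunit fh) fi.
have [ea eb] : a = 0%N /\ b = 0%N by lia.
rewrite ea in hp; rewrite eb in hq.
have p0 : p != 0 by apply: contraNneq f0 => h; rewrite ef h mul0r.
have q0 : q != 0 by apply: contraNneq f0 => h; rewrite ef h mulr0.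
have indep x y : x *: p + y *: q = 0 -> x = 0 /\ y = 0.
  move=> h.
  have notsq c r : r \is 1.-homog -> f = c *: (r * r) -> False.
    move=> hr er; have c0 : c != 0.
      by apply: contraNneq f0 => cz; rewrite er cz scale0r.
    have : principal f r.
      apply: (proj1 fn _ 2); exists (c^-1%:MP).
      by rewrite er mul_mpolyC scalerA mulVf // scale1r expr2.
    move/(principal_lt fh hr)=> r0; case/negP: f0.
    by rewrite er r0 ?mulr0 ?scaler0 // ed.
  have [x0|x0] := eqVneq x 0.
    move: h; rewrite x0 scale0r add0r => /eqP.
    rewrite -mul_mpolyC mulf_eq0 mpolyC_eq0 (negPf q0) orbF => /eqP y0.
    by [].
  exfalso; apply: (notsq (- (x^-1 * y)) q hq).
  have -> : f = x^-1 *: ((x *: p) * q) by rewrite -scalerAl scalerA mulVf // scale1r.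
  rewrite (_ : x *: p = - (y *: q)); last by apply/eqP; rewrite -addr_eq0 h.
  by rewrite -!mul_mpolyC mpolyCN mpolyCM; ring.
pose m1 j := p@_U_(j); pose m2 j := q@_U_(j).
have ep : p = lform m1 by exact: lform_coef.
have eq : q = lform m2 by exact: lform_coef.
have [l hl] : exists l, cross m1 m2 l != 0.
  apply: contrapT => /forallNP h.
  have hz : forall i, cross m1 m2 i = 0 by move=> i; apply/eqP/negPn/negP; exact: h.
  have hp' := cross_eq0 hz.
  have [j mj] : exists j, m2 j != 0.
    apply: contrapT => /forallNP h2; case/negP: q0; rewrite eq /lform big1 // => j _.
    by move/negP/negPn/eqP: (h2 j) => ->; rewrite scale0r.
  have [|mz _] := indep (m2 j) (- m1 j); last by rewrite mz eqxx in mj.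
  rewrite ep eq /lform !scaler_sumr -big_split big1 // => i _ /=.
  by rewrite !scalerA -scalerDl mulNr [m2 j * _]mulrC (hp' i j) subrr scale0r.
(* The third row is the coordinate vector of an index [l] whose minor of the two linear forms is
   nonzero. *)
pose M : 'M[k]_3 := \matrix_(i, j) match val i with
  0 => m1 j | 1 => m2 j | _ => (j == l)%:R end.
have Mu : M \in unitmx.
  apply: unitmx_inj => v vM.
  have hv j : v 0 ord0 * m1 j + v 0 (lift ord0 ord0) * m2 j +
      v 0 (lift ord0 (lift ord0 ord0)) * (j == l)%:R = 0.
    by have /rowP/(_ j) := vM; rewrite !mxE sum3 !mxE.
  have v2 : v 0 (lift ord0 (lift ord0 ord0)) = 0.
    apply: (mulIf hl); rewrite mul0r.
    transitivity (\sum_j cross m1 m2 j * (v 0 ord0 * m1 j +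
        v 0 (lift ord0 ord0) * m2 j + v 0 (lift ord0 (lift ord0 ord0)) * (j == l)%:R)).
      under eq_bigr do rewrite mulrDr mulrCA.
      rewrite big_split /= [X in _ = X + _](_ : _ = 0); last first.
        by rewrite sum3 /cross /=; ring.
      rewrite add0r (bigD1 l) //= eqxx mulr1 big1 ?addr0 // => j /negPf ->.
      by rewrite !mulr0.
    by rewrite big1 // => j _; rewrite hv mulr0.
  have hv' j : v 0 ord0 * m1 j + v 0 (lift ord0 ord0) * m2 j = 0.
    by have := hv j; rewrite v2 mul0r addr0.
  have [|v0 v1] := indep (v 0 ord0) (v 0 (lift ord0 ord0)).
    rewrite ep eq /lform !scaler_sumr -big_split big1 // => j _ /=.
    by rewrite !scalerA -scalerDl hv' scale0r.
  by apply/rowP => i; rewrite mxE; case: (ord3P i) => ->.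
exists (invmx M); rewrite unitmx_inv; split=> //.
rewrite ef linear_changeM.
rewrite -(linear_change_inv 0 Mu) -(linear_change_inv 1 Mu); congr (_ * _).
  by rewrite ep; congr linear_change; apply: eq_bigr => j _; rewrite mxE.
by rewrite eq; congr linear_change; apply: eq_bigr => j _; rewrite mxE.
Qed.

(** By degrees the cross product is [q] times a constant vector [c]. Its orthogonality to the vector
    of variables says that the linear form with coefficients [c] times [q] is zero. *)
Lemma crossX_conic s (q : R) : e = 1%N -> q != 0 -> q \is 2.-homog -> syz f s ->
  homog_row 1 s -> (forall j, principal q (crossX s j)) -> s = 0.
Proof.
move=> e1 q0 hq hs hh hd.
have /choice[c hc] : forall j, exists c : k, crossX s j = c *: q.
  move=> j; have [c hc ec] := @dhomog_quotient _ _ 2 0 _ _ q0 hq (crossX_homog j hh) (hd j).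
  by exists c@_0; rewrite ec (dhomog0_const hc) mul_mpolyC mcoeffC eqxx mulr1.
apply: (crossX_eq0 k0 f0 fh hs) => j.
have : lform c * q = 0.
  rewrite -(dot_crossl X (s 0)) /dot /lform mulr_suml; apply: eq_bigr => i _.
  by rewrite hc -!mul_mpolyC; ring.
move/eqP; rewrite mulf_eq0 (negPf q0) orbF => /eqP cz.
rewrite hc (_ : c j = 0) ?scale0r //.
have := congr1 (mcoeff U_(j)) cz; rewrite mcoeff0 raddf_sum (bigD1 j) //= => <-.
rewrite mcoeffZ mcoeffXU eqxx mulr1 big1 ?addr0 // => i /negPf ij.
by rewrite mcoeffZ mcoeffXU ij mulr0.
Qed.

(** For an irreducible conic the two basis syzygies have eigenvalues [x] and [y] modulo [q]. The
    combination with coefficients [y] and [-x] has eigenvalue zero, so it vanishes by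
    [crossX_conic]; independence gives [x = y = 0], and then [s] itself would vanish. *)
Lemma conic_factor_reducible (q : R) : d = 2 -> free_divisor f -> q != 0 ->
  q \is 2.-homog -> principal q f -> ~ irreducible q.
Proof.
move=> ed fd q0 hq qf [qu qirr].
have e1 : e = 1%N by have := free_degree fd; lia.
have pq : prime_elt q by apply: irreducible_prime => //; exact: factorial_mpoly.
have eed : (e + e)%N = d by rewrite e1 ed.
have [s [t [u [[hs ht hhs hht] u0 st]]]] := free_linear k0 f0 fh fn fd eed.
have ed' : (0 + e.+1 = d)%N by rewrite e1 ed.
have [x hx] := component_eigenvalue k0 d1 f0 fh fn hs hhs pq qf (dhomog1 _ _) ed'.
have [y hy] := component_eigenvalue k0 d1 f0 fh fn ht hht pq qf (dhomog1 _ _) ed'.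
have crossZD (a b : k) j : crossX (a%:MP *: s + b%:MP *: t) j =
    a%:MP * crossX s j + b%:MP * crossX t j.
  by case: (ord3P j) => ->; rewrite /cross /= !mxE; ring.
have comb0 (a b : k) : (forall j, principal q (a%:MP * crossX s j + b%:MP * crossX t j)) ->
    a = 0 /\ b = 0.
  move=> h; have z : a%:MP *: s + b%:MP *: t = 0.
    apply: (crossX_conic e1 q0 hq).
    - by apply: syz_linear => //; exact: syzZ.
    - move=> i; rewrite !mxE !mul_mpolyC; apply: rpredD; apply: rpredZ.
        by have := hhs i; rewrite e1.
      by have := hht i; rewrite e1.
    by move=> j; rewrite crossZD.
  have zj j : a%:MP * s 0 j + b%:MP * t 0 j = 0.
    by have /rowP/(_ j) := z; rewrite !mxE.
  have [i dfi] := df_neq0 k0 f0 fh.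
  have ch : cross (s 0) (t 0) i != 0.
    by rewrite st -mul_mpolyC mulf_neq0 // mpolyC_eq0.
  have ca : a%:MP * cross (s 0) (t 0) i = 0.
    transitivity (cross (fun j => a%:MP * s 0 j + b%:MP * t 0 j) (t 0) i).
      by case: (ord3P i) => ->; rewrite /cross /=; ring.
    by case: (ord3P i) => ->; rewrite /cross /= !zj; ring.
  have cb : b%:MP * cross (s 0) (t 0) i = 0.
    transitivity (cross (s 0) (fun j => a%:MP * s 0 j + b%:MP * t 0 j) i).
      by case: (ord3P i) => ->; rewrite /cross /=; ring.
    by case: (ord3P i) => ->; rewrite /cross /= !zj; ring.
  move/eqP: ca; move/eqP: cb; rewrite !mulf_eq0 !mpolyC_eq0 (negPf ch) !orbF.
  by move=> /eqP -> /eqP ->.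
have [y0 x0] : y = 0 /\ - x = 0.
  apply: comb0 => j.
  have -> : y%:MP * crossX s j + (- x)%:MP * crossX t j =
      y%:MP * (1 * crossX s j - x *: df j) - x%:MP * (1 * crossX t j - y *: df j).
    by rewrite -!mul_mpolyC mpolyCN; ring.
  by apply: principalB; apply: principal_mull.
have [|/eqP + _] := comb0 1 0; last by rewrite oner_eq0.
move=> j; rewrite mpolyC0 mul0r addr0 mpolyC1.
have := hx j; have -> : x = 0 by apply/eqP; rewrite -oppr_eq0 x0.
by rewrite scale0r subr0.
Qed.

(** The cubic is a product of three linear forms. They are independent, because at a common zero all
    second derivatives would vanish, contrary to the Hessian condition at a node. *)
Lemma free_three_lines : d = 2 -> free_divisor f ->
  exists A : 'M[k]_3, A \in unitmx /\ linear_change A f = 'X_0 * 'X_1 * 'X_2.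
Proof.
move=> ed fd; have fi : ~ irreducible f by move/irreducible_not_free.
have : exists l q : R, [/\ l \is 1.-homog, q \is 2.-homog & f = l * q].
  have [p [q [n1 [n2 [hp hq en ef]]]]] := homog_reducible f0 fh (dhomogS_nonunit fh) fi.
  have [[e1 e2]|[e1 e2]] : (n1 = 0 /\ n2 = 1)%N \/ (n1 = 1 /\ n2 = 0)%N by lia.
    by exists p, q; rewrite e1 in hp; rewrite e2 in hq.
  by exists q, p; rewrite mulrC; rewrite e1 in hp; rewrite e2 in hq.
case=> l1 [q [hl1 hq ef]].
have q0 : q != 0 by apply: contraNneq f0 => h; rewrite ef h mulr0.
have qirr := conic_factor_reducible ed fd q0 hq (ex_intro _ l1 ef).
have [l2 [l3 [n1 [n2 [hl2 hl3 en eq]]]]] := homog_reducible q0 hq (dhomogS_nonunit hq) qirr.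
have [e1 e2] : n1 = 0%N /\ n2 = 0%N by lia.
rewrite e1 in hl2; rewrite e2 in hl3.
pose l (i : 'I_3) : R := match val i with 0 => l1 | 1 => l2 | _ => l3 end.
have hl i : l i \is 1.-homog by case: (ord3P i) => ->.
pose M : 'M[k]_3 := \matrix_(i, j) (l i)@_U_(j).
have el i : l i = lform (M i).
  by rewrite {1}(lform_coef (hl i)); apply: eq_bigr => j _; rewrite mxE.
have ef3 : f = l1 * l2 * l3 by rewrite ef eq mulrA.
have Mu : M \in unitmx.
  rewrite -unitmx_tr; apply: unitmx_inj => v vM; apply: contrapT => /eqP v0.
  have [i vi] : exists i, v 0 i != 0.
    apply: contrapT => /forallNP h; case/negP: v0; apply/eqP/rowP => i.
    by rewrite mxE; apply/eqP/negPn/negP; exact: h.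
  have lv j : (l j).@[v 0] = 0.
    rewrite el meval_lform; have /rowP/(_ j) := vM; rewrite !mxE => {2}<-.
    by apply: eq_bigr => m _; rewrite !mxE mulrC.
  have lv1 : l1.@[v 0] = 0 := lv ord0.
  have lv2 : l2.@[v 0] = 0 := lv (lift ord0 ord0).
  have lv3 : l3.@[v 0] = 0 := lv (lift ord0 (lift ord0 ord0)).
  have dv j : (df j).@[v 0] = 0.
    by rewrite ef3 !mderivM !mevalD !mevalM mevalD !mevalM lv1 lv2 lv3; ring.
  have ddv a b : (f^`M(a)^`M(b)).@[v 0] = 0.
    by rewrite ef3 !(mderivM, mderivD, mevalD, mevalM) lv1 lv2 lv3; ring.
  have := singular_minor k0 fh fn vi dv; cbv zeta.
  by rewrite !ddv mul0r expr0n subr0 eqxx.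
exists (invmx M); rewrite unitmx_inv; split=> //.
rewrite ef3 !linear_changeM.
by congr (_ * _ * _); [rewrite -(linear_change_inv 0 Mu) -(el 0)
  | rewrite -(linear_change_inv 1 Mu) -(el 1) | rewrite -(linear_change_inv 2 Mu) -(el 2)].
Qed.

End Classification.

(** * Krull dimension *)

Lemma leq_expn x y l : (x <= y)%N -> (x ^ l <= y ^ l)%N.
Proof. by move=> xy; elim: l => // l IH; rewrite !expnS leq_mul. Qed.

Section AlgebraicDependence.
Variables (k : fieldType) (n : nat).
Implicit Types (p q : {mpoly k[n]}).

Lemma msizeM_bound p q i j :
  (msize p <= i.+1)%N -> (msize q <= j.+1)%N -> (msize (p * q) <= (i + j).+1)%N.
Proof.
have [->|p0] := eqVneq p 0; first by rewrite mul0r msize0.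
have [->|q0] := eqVneq q 0; first by rewrite mulr0 msize0.
rewrite msizeM //; move: (msize p) (msize q) => x y; lia.
Qed.

Lemma msize_prod_bound (I : finType) (g : I -> {mpoly k[n]}) (D N : nat) (m : I -> nat) :
  (forall i, (msize (g i) <= D.+1)%N) -> (forall i, (m i <= N)%N) ->
  (msize (\prod_i g i ^+ m i) <= (#|I| * (N * D)).+1)%N.
Proof.
move=> hg hm; have hX i : (msize (g i ^+ m i) <= (N * D).+1)%N.
  have : (msize (g i ^+ m i) <= (m i * D).+1)%N.
    elim: (m i) => [|j IH]; first by rewrite expr0 msize1.
    by rewrite exprS mulSn; exact: msizeM_bound.
  by move/leq_trans; apply; rewrite ltnS leq_mul2r hm orbT.
rewrite cardE; rewrite -big_enum; elim: (enum I) => [|i s IH].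
  by rewrite big_nil msize1.
by rewrite big_cons /= mulSn; exact: msizeM_bound.
Qed.

(* There are more monomials of degree at most [N] in each of [n + 1] elements
   than monomials in [n] variables of the resulting degree. *)
Lemma algebraic_dependence (g : 'I_n.+1 -> {mpoly k[n]}) :
  exists q : {mpoly k[n.+1]}, q != 0 /\ q \mPo [tuple g i | i < n.+1] = 0.
Proof.
pose D := (\sum_i msize (g i)).+1.
have hD i : (msize (g i) <= D.+1)%N.
  by rewrite /D (bigD1 i) //=; apply: leqW; apply: leqW; exact: leq_addr.
(* As [B] is at most (n + 1) D (N + 1), its [n]-th power is at most N (N + 1)^n, less than the
   number (N + 1)^(n + 1) of products. *)
pose N := ((n.+1 * D) ^ n)%N; pose B := (n.+1 * (N * D)).+1.
pose I1 := {ffun 'I_n.+1 -> 'I_N.+1}; pose I2 := {ffun 'I_n -> 'I_B}.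
pose mon1 (h : I1) : 'X_{1..n.+1} := [multinom (h i : nat) | i < n.+1].
pose mon2 (h : I2) : 'X_{1..n} := [multinom (h i : nat) | i < n].
pose G (h : I1) := \prod_i g i ^+ (h i).
have hG h : (msize (G h) <= B)%N.
  have := @msize_prod_bound _ g D N (fun i => h i) hD; rewrite card_ord; apply.
  by move=> i; rewrite -ltnS.
pose A := \matrix_(i < #|I1|, j < #|I2|) (G (enum_val i))@_(mon2 (enum_val j)).
have card : (#|I2| < #|I1|)%N.
  rewrite !card_ffun !card_ord.
  have leB : (B <= n.+1 * D * N.+1)%N.
    rewrite /B mulnS [(n.+1 * D * N)%N]mulnAC mulnA addnC -addn1 leq_add2l.
    by rewrite muln_gt0.
  apply: (@leq_ltn_trans ((n.+1 * D * N.+1) ^ n)%N).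
    exact: leq_expn.
  by rewrite expnMn [X in (_ < X)%N]expnS ltn_pmul2r ?expn_gt0.
have [v vA v0] : exists2 v : 'rV_#|I1|, v *m A = 0 & v != 0.
  have : kermx A != 0.
    rewrite kermx_eq0 -row_leq_rank -ltnNge; apply: leq_ltn_trans card.
    exact: rank_leq_col.
  by case/rowV0Pn => v /sub_kermxP vA v0; exists v.
exists (\sum_i v 0 i *: 'X_[mon1 (enum_val i)]); split.
  have [i0 vi0] : exists i0, v 0 i0 != 0.
    apply: contrapT => /forallNP h; case/negP: v0; apply/eqP/rowP => i.
    by rewrite mxE; apply/eqP/negPn/negP; exact: h.
  apply: contraNneq vi0 => /(congr1 (mcoeff (mon1 (enum_val i0)))).
  rewrite mcoeff0 raddf_sum (bigD1 i0) //= mcoeffZ mcoeffX eqxx mulr1 => <-.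
  rewrite big1 ?addr0 // => i ii0; rewrite mcoeffZ mcoeffX.
  case: eqP => [em|_]; last by rewrite mulr0.
  case/eqP: ii0; apply: enum_val_inj; apply/ffunP => j; apply: val_inj.
  by have /mnmP/(_ j) := em; rewrite !mnmE.
rewrite raddf_sum; apply/mpolyP => m; rewrite mcoeff0 raddf_sum /=.
have eG i : (v 0 i *: 'X_[mon1 (enum_val i)] \mPo [tuple g i | i < n.+1]) =
    v 0 i *: G (enum_val i).
  rewrite comp_mpolyZ comp_mpolyX; congr (_ *: _); apply: eq_bigr => j _.
  by rewrite tnth_mktuple mnmE.
under eq_bigr do rewrite eG mcoeffZ.
have [hm|] := pselect (forall i, m i < B)%N.
  pose h : I2 := [ffun i => Ordinal (hm i)].
  have -> : m = mon2 h by apply/mnmP => i; rewrite mnmE ffunE.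
  have /rowP/(_ (enum_rank h)) := vA; rewrite !mxE => vAh; rewrite -[RHS]vAh.
  by apply: eq_bigr => i _; rewrite mxE enum_rankK.
move/existsNP => [j /negP]; rewrite -leqNgt => hj.
rewrite big1 // => i _; rewrite [X in _ * X](_ : _ = 0) ?mulr0 //.
apply/memN_msupp_eq0/msize_mdeg_ge; apply: leq_trans (hG _) _.
by rewrite mdegE (bigD1 j) //=; apply: leq_trans hj _; exact: leq_addr.
Qed.

End AlgebraicDependence.

Section KrullDimension.
Variable k : fieldType.
Local Notation R := {mpoly k[3]}.
Implicit Types (P Q : {pred R}).

(** The classes of the [g i] in the quotient ring by [P] are algebraically independent over [k]. *)
Definition independent_mod (P : {pred R}) m (g : 'I_m -> R) : Prop :=
  forall q : {mpoly k[m]}, q \mPo [tuple g i | i < m] \in P -> q = 0.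

Lemma comp_of_muni m (g : 'I_m.+1 -> R) (F : {poly {mpoly k[m]}}) :
  of_muni F \mPo [tuple g i | i < m.+1] =
  (map_poly (comp_mpoly [tuple g (widen_ord (leqnSn m) i) | i < m]) F).[g ord_max].
Proof.
have comp_mpolyM l (t : l.-tuple R) (p q : {mpoly k[l]}) :
    (p * q) \mPo t = (p \mPo t) * (q \mPo t) by exact: rmorphM.
have hw (c : {mpoly k[m]}) : mwiden c \mPo [tuple g i | i < m.+1] =
    c \mPo [tuple g (widen_ord (leqnSn m) i) | i < m].
  elim/mpoly_ring_ind: c => [c|i|p q IHp IHq|p q IHp IHq].
  - by rewrite mwidenC !comp_mpolyC.
  - by rewrite mwidenX mnmwiden1 !comp_mpolyXU -!tnth_nth !tnth_mktuple.
  - by rewrite mwidenD !comp_mpolyD IHp IHq.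
  by rewrite mwidenM !comp_mpolyM IHp IHq.
elim/poly_ind: F => [|F c IH]; first by rewrite !raddf0 horner0.
rewrite of_muniD of_muniM of_muniX of_muniC comp_mpolyD comp_mpolyM hw IH.
rewrite [in RHS]rmorphD rmorphM /= map_polyX map_polyC hornerMXaddC.
by rewrite comp_mpolyXU -tnth_nth tnth_mktuple.
Qed.

(* The constant term in the new variable vanishes modulo [P]; the rest can be
   divided by [h], which is not in the prime [Q]. *)
Lemma independent_mod_step P Q m (g : 'I_m -> R) h : prime_ideal P -> prime_ideal Q ->
    {subset Q <= P} -> h \in P -> h \notin Q -> independent_mod P g ->
  independent_mod Q (fun i : 'I_m.+1 => if unlift ord_max i is Some j then g j else h).
Proof.
move=> pP pQ QP hP hQ ind q; rewrite -(muniK q) comp_of_muni unlift_none.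
set T := [tuple _ | i < m]; move: (muni q) => F.
have eT : T = [tuple g i | i < m].
  apply: eq_from_tnth => i; rewrite !tnth_mktuple.
  have -> : widen_ord (leqnSn m) i = lift ord_max i.
    by apply: val_inj; rewrite /= /bump leqNgt ltn_ord.
  by rewrite liftK.
have [[P0 P1 PD] Pp] := pP; have [[Q0 Q1 QD] Qp] := pQ.
suff : forall N (F : {poly {mpoly k[m]}}), (size F <= N)%N ->
    (map_poly (comp_mpoly T) F).[h] \in Q -> F = 0.
  by move=> H /(H _ _ (leqnn _)) ->; rewrite raddf0.
elim=> {F} [F|N IH F sF]; first by rewrite leqn0 size_poly_eq0 => /eqP.
have [F1 [c eF]] : exists F1 c, F = F1 * 'X + c%:P.
  elim/poly_ind: (F) => [|F1 c _]; last by exists F1, c.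
  by exists 0, 0; rewrite mul0r add0r.
have eH : (map_poly (comp_mpoly T) F).[h] =
    (map_poly (comp_mpoly T) F1).[h] * h + (c \mPo T).
  by rewrite eF rmorphD rmorphM /= map_polyX map_polyC hornerMXaddC.
rewrite eH => hF.
have c0 : c = 0.
  apply: ind; rewrite -eT.
  have := PD (- (map_poly (comp_mpoly T) F1).[h]) h
    ((map_poly (comp_mpoly T) F1).[h] * h + (c \mPo T)) hP (QP _ hF).
  by rewrite mulNr addKr.
rewrite eF c0 addr0 in sF *.
have F10 : F1 = 0.
  have [//|F1n] := eqVneq F1 0; apply: IH.
    by rewrite size_mulX // ltnS in sF.
  move: hF; rewrite c0 comp_mpoly0 addr0 => /Qp /orP[//|hh].
  by rewrite hh in hQ.
by rewrite F10 mul0r.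
Qed.

Lemma height_independent N m P (g : 'I_m -> R) : prime_ideal P -> height_ge N P ->
  independent_mod P g -> exists Q (g' : 'I_(N + m) -> R), prime_ideal Q /\ independent_mod Q g'.
Proof.
elim: N m P g => [|N IH] m P g pP hN hg; first by exists P, g.
have [Q [pQ QP nPQ hQ]] := hN.
have [h [hP hnQ]] : exists h, h \in P /\ h \notin Q.
  apply: contrapT => /forallNP hn; apply: nPQ => x xP; apply/negPn/negP => xQ.
  by apply: (hn x).
have := IH _ _ _ pQ hQ (independent_mod_step pP pQ QP hP hnQ hg).
by rewrite addSnnS.
Qed.

(** Each strict inclusion in a chain of primes adds one algebraically independent element, and four
    elements of a polynomial ring in three variables are dependent. *)
Lemma krull_dimension P : prime_ideal P -> ~ height_ge 4 P.
Proof.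
move=> pP hP; have [[P0 P1 PD] Pp] := pP.
have hg : independent_mod P (fun i : 'I_0 => 0).
  move=> q; have -> : q = (q@_0)%:MP.
    apply/mpolyP => m; rewrite mcoeffC.
    by have -> : m = 0%MM; [apply/mnmP => -[] | rewrite eqxx mulr1].
  rewrite comp_mpolyC; have [->|c0] := eqVneq q@_0 0; first by rewrite mpolyC0.
  move=> hc; case/negP: P1; have := PD ((q@_0)^-1%:MP) _ 0 hc P0.
  by rewrite addr0 -mpolyCM mulVf // mpolyC1.
have [Q [g [pQ hQ]]] := height_independent pP hP hg.
move: g hQ; rewrite addn0 => g hQ.
have [q [q0 hq]] := algebraic_dependence g.
case/negP: q0; apply/eqP/hQ; rewrite hq.
by case: pQ => -[].
Qed.

End KrullDimension.

(** * The Bourbaki ideal *)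

Lemma prime_linear (k : fieldType) n (l : {mpoly k[n]}) : l != 0 -> l \is 1.-homog ->
  prime_elt l.
Proof.
move=> l0 hl; apply: (irreducible_prime (@factorial_mpoly k n) l0).
  exact: dhomogS_nonunit hl.
move=> p q el; have pq0 : p * q != 0 by rewrite -el.
have [|n1 [n2 [h1 h2 en]]] := @dhomog_factors _ _ 1 _ _ pq0; first by rewrite -el.
have unit0 (r : {mpoly k[n]}) : r != 0 -> r \is 0.-homog -> r \is a GRing.unit.
  move=> r0 hr; rewrite (dhomog0_const hr) mpolyC_unit.
  by apply: contraNneq r0 => z; rewrite (dhomog0_const hr) z.
have /norP[p0 q0] : ~~ ((p == 0) || (q == 0)) by rewrite -mulf_eq0.
case: n1 h1 en => [|n1] h1 en; first by left; exact: unit0.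
have n20 : n2 = 0%N by lia.
by right; apply: unit0 => //; rewrite n20 in h2.
Qed.

Section Bourbaki.
Variable (k : closedFieldType).
Local Notation R := {mpoly k[3]}.
Hypothesis k0 : [pchar k] =i pred0.
Variables (d : nat) (f : R).
Hypotheses (f0 : f != 0) (fh : f \is d.+1.-homog) (fn : nodal f).
Local Notation df := (fun i : 'I_3 => f^`M(i)).
Local Notation e := (indeg (syz f)).
Implicit Types (s t : 'rV[R]_3) (h : R).

Lemma indeg_le : (e <= d)%N.
Proof.
rewrite leqNgt; apply/negP => lt; have [i /negP[]] := df_neq0 k0 f0 fh.
have hk l := indeg_min k0 f0 fh (syz_koszul f l) (koszul_homog fh l) lt.
have hz : forall i, df i = 0; last by apply/eqP; exact: hz.
by apply: (@koszul_entries _ f (fun p => p = 0)) => [p ->|l j]; rewrite ?oppr0 // hk mxE.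
Qed.

Variable eps : 'rV[R]_3.
Hypotheses (eps_syz : syz f eps) (eps_homog : homog_row e eps) (eps0 : eps != 0).

Lemma eps_entry : exists i, eps 0 i != 0.
Proof.
apply: contrapT => /forallNP h; case/negP: eps0; apply/eqP/rowP => i.
by rewrite mxE; apply/eqP/negPn/negP; exact: h.
Qed.

(** Dividing [eps] by a common factor of its entries would give a nonzero syzygy of degree less than
    [e]. *)
Lemma eps_coprime p : prime_elt p -> ~ forall i, principal p (eps 0 i).
Proof.
move=> [p0 pu _] hp; have [i ei] := eps_entry.
have [m hm lem] := dhomog_principal ei (eps_homog i) (hp i).
have m0 := nonunit_dhomog_gt0 p0 hm pu.
have /choice[c hc] : forall j, exists c, c \is (e - m).-homog /\ eps 0 j = c * p.
  move=> j; have [|c hc ec] := @dhomog_quotient _ _ m (e - m) p (eps 0 j) p0 hm _ (hp j).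
    by rewrite subnKC.
  by exists c.
have c0 : (\row_j c j : 'rV[R]_3) = 0.
  apply: (indeg_min k0 f0 fh (n := (e - m)%N)); last by lia.
    apply: (mulIf p0); rewrite mul0r -[RHS]eps_syz mulr_suml; apply: eq_bigr => j _.
    by rewrite mxE (proj2 (hc j)); ring.
  by move=> j; rewrite mxE; case: (hc j).
case/negP: ei; rewrite (proj2 (hc i)).
by have /rowP/(_ i) := c0; rewrite !mxE => ->; rewrite mul0r.
Qed.

Lemma cross_eps_kernel s : (forall i, cross (s 0) (eps 0) i = 0) -> exists a, s = a *: eps.
Proof.
move=> h; have [i ei] := eps_entry; have hp := cross_eq0 h.
have [a ha] : exists a, forall j, s 0 j = a * eps 0 j.
  apply: (@primitive_proportional _ (@factorial_mpoly k 3) 'I_3 (s 0) (eps 0)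
    (eps 0 i) (s 0 i) ei).
    by move=> p; exact: eps_coprime.
  by move=> j; rewrite mulrC (hp j i).
by exists a; apply/rowP => j; rewrite mxE ha.
Qed.

Definition bourbaki h : Prop :=
  exists s, syz f s /\ forall i, cross (s 0) (eps 0) i = h * df i.

Lemma cross_epsD a s t i : cross ((a *: s + t) 0) (eps 0) i =
  a * cross (s 0) (eps 0) i + cross (t 0) (eps 0) i.
Proof. by case: (ord3P i) => ->; rewrite /cross /= !mxE; ring. Qed.

Lemma cross_epsZ a i : cross ((a *: eps) 0) (eps 0) i = 0.
Proof. by case: (ord3P i) => ->; rewrite /cross /= !mxE; ring. Qed.

Lemma bourbaki_ideal_closed : ideal_closed bourbaki.
Proof.
split=> [|a p q [s [hs sp]] [t [ht tq]]].
  exists 0; split=> [|i]; first exact: syz0.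
  by rewrite mul0r; case: (ord3P i) => ->; rewrite /cross /= !mxE; ring.
exists (a *: s + t); split=> [|i]; first exact: syz_linear.
by rewrite cross_epsD sp tq; ring.
Qed.

(** Koszul syzygies provide these explicit elements of the ideal; having no common factor, they
    later control its Hilbert function and its height. *)
Lemma bourbaki_eps l : bourbaki (eps 0 l).
Proof.
exists (- koszul f l); split=> [|i]; first by rewrite -scaleN1r; apply/syzZ/syz_koszul.
rewrite -(cross_koszul l eps_syz) [RHS]cross_anti.
by case: (ord3P i) => ->; rewrite /cross /= !mxE; ring.
Qed.

Lemma cross_hrow n s i : hcomp (n + e) (cross (s 0) (eps 0) i) =
  cross (hrow n s 0) (eps 0) i.
Proof.
have h a b : hcomp (n + e) (s 0 a * eps 0 b) = hrow n s 0 a * eps 0 b.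
  by rewrite (hcompMr _ _ (eps_homog b)) mxE.
by case: (ord3P i) => ->; rewrite /cross /= pihomogB !h.
Qed.

Lemma bourbaki_hrow m s h : (forall i, cross (s 0) (eps 0) i = h * df i) ->
  forall i, cross (hrow (m + d - e) s 0) (eps 0) i = hcomp m h * df i.
Proof.
move=> hh i; have led : (e <= m + d)%N := leq_trans indeg_le (leq_addl _ _).
by rewrite -cross_hrow subnK // hh (hcompMr _ _ (df_homog fh i)).
Qed.

Lemma bourbaki_homog m h : bourbaki h -> bourbaki (hcomp m h).
Proof.
case=> s [hs sh]; exists (hrow (m + d - e) s).
by split; [exact: (syz_hrow fh) | exact: bourbaki_hrow].
Qed.

(** The syzygy belonging to [h] can be taken of degree m + d - e, which is less than [e]. *)
Lemma bourbaki_low m h : (m + d < e + e)%N -> h \is m.-homog -> bourbaki h -> h = 0.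
Proof.
move=> lt hh [s [hs sh]]; have led : (e <= m + d)%N := leq_trans indeg_le (leq_addl _ _).
have s0 : hrow (m + d - e) s = 0.
  by apply: (indeg_min k0 f0 fh (syz_hrow fh _ hs) (@hrow_homog _ _ _)); lia.
have [i di] := df_neq0 k0 f0 fh; apply: (mulIf di).
rewrite mul0r -(pihomog_dE hh) -(bourbaki_hrow m sh) s0.
by case: (ord3P i) => ->; rewrite /cross /= !mxE; ring.
Qed.

(* Depth: the syzygies of two multiples of [h] differ by a multiple of [eps]
   which lies in [('X_0, 'X_1) eps], so that one can divide by ['X_0]. *)
Lemma bourbaki_saturated h : (forall i, bourbaki ('X_i * h)) -> bourbaki h.
Proof.
move=> hX; have /choice[s hs] := hX.
have rel i j : exists a, forall l,
    'X_j * s i 0 l - 'X_i * s j 0 l = a * eps 0 l.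
  suff [a ea] : exists a, 'X_j *: s i - 'X_i *: s j = a *: eps.
    by exists a => l; have /rowP/(_ l) := ea; rewrite !mxE.
  apply: cross_eps_kernel => l; rewrite addrC -scaleNr cross_epsD.
  have := proj2 (hs i) l; have := proj2 (hs j) l => ej ei.
  have -> : cross (('X_j *: s i) 0) (eps 0) l = 'X_j * cross (s i 0) (eps 0) l.
    by case: (ord3P l) => ->; rewrite /cross /= !mxE; ring.
  by rewrite ei ej; ring.
pose i0 : 'I_3 := 0; pose i1 : 'I_3 := 1; pose i2 : 'I_3 := 2%:R.
have [a ea] := rel i0 i1; have [b eb] := rel i0 i2; have [c ec] := rel i1 i2.
(* Compatibility of the three differences: their combination with the variables as coefficients
   cancels. *)
have eabc : 'X_i2 * a - 'X_i1 * b + 'X_i0 * c = 0.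
  have [l el] := eps_entry; apply: (mulIf el).
  transitivity ('X_i2 * (a * eps 0 l) - 'X_i1 * (b * eps 0 l) + 'X_i0 * (c * eps 0 l)).
    by ring.
  by rewrite -ea -eb -ec mul0r; ring.
have [x [y exy]] : exists x y, a = 'X_i1 * x - 'X_i0 * y.
  (* Setting the first two variables to zero in [eabc] shows that [a] lies in the ideal they
     generate. *)
  pose T : 3.-tuple R := [tuple if j == i2 then 'X_j else 0 | j < 3].
  have [w ew] := comp_mpoly_sub T a.
  have TX j : ('X_j : R) \mPo T = if j == i2 then 'X_j else 0.
    by rewrite comp_mpolyXU -tnth_nth tnth_mktuple.
  have aT : a \mPo T = 0.
    have := congr1 (comp_mpoly T) eabc.
    rewrite rmorph0 rmorphD rmorphB !rmorphM /= !TX /= !mul0r subr0 addr0.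
    move/eqP; rewrite mulf_eq0 => /orP[|/eqP//].
    by rewrite -msize_poly_eq0 msizeX mdeg1.
  exists (w i1), (- w i0); rewrite -[LHS]subr0 -{1}aT ew sum3 !tnth_mktuple.
  have -> : lift ord0 (lift ord0 ord0) = i2 by apply: val_inj.
  have -> : lift ord0 ord0 = i1 by apply: val_inj.
  by rewrite eqxx /= -/i0; ring.
(* By the choice of [x] and [y], ['X_i1] times [s i0 - x *: eps] equals ['X_i0] times
   [s i1 - y *: eps]; hence ['X_i0] divides the first syzygy, and the quotient is the one sought. *)
have /choice[z ht] : forall l, exists z, (s i0 - x *: eps) 0 l = z * 'X_i0.
  move=> l; have pX : prime_elt ('X_i0 : R).
    by apply: prime_linear; [rewrite -msize_poly_eq0 msizeX mdeg1 | exact: dhomogXU].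
  have [_ _ pm] := pX.
  have : principal 'X_i0 ('X_i1 * (s i0 - x *: eps) 0 l).
    exists ((s i1 - y *: eps) 0 l).
    have := ea l; rewrite exy => fa.
    rewrite !mxE; apply/eqP; rewrite -subr_eq0; apply/eqP.
    transitivity (('X_i1 * s i0 0 l - 'X_i0 * s i1 0 l) - ('X_i1 * x - 'X_i0 * y) * eps 0 l).
      by ring.
    by rewrite -fa; ring.
  case/pm => // hX1; exfalso.
  have [u [v [uv euv]]] := prime_linear_forms pX (dhomogXU k i0) (dhomogXU k i1)
    (principal_refl _) hX1.
  by have [//|u0 v0] := XU_independent _ euv; rewrite u0 v0 eqxx in uv.
have X0 : 'X_i0 != 0 :> R by rewrite -msize_poly_eq0 msizeX mdeg1.
exists (\row_l z l); split.
  apply: (mulIf X0); rewrite mul0r.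
  have h1 : syz f (s i0 - x *: eps) by apply: syzB; [case: (hs i0) | exact: syzZ].
  rewrite -[RHS]h1 mulr_suml; apply: eq_bigr => l _.
  by rewrite mxE ht; ring.
move=> l; apply: (mulIf X0).
transitivity (cross ((s i0 - x *: eps) 0) (eps 0) l).
  by case: (ord3P l) => ->; rewrite /cross /= !ht !mxE; ring.
transitivity (cross (s i0 0) (eps 0) l).
  by case: (ord3P l) => ->; rewrite /cross /= !mxE; ring.
by rewrite (proj2 (hs i0) l); ring.
Qed.

(** If [s x eps] is the gradient, then [s] and [eps] form a basis: [t - h *: s] is a multiple of
    [eps] when [t x eps] is [h] times the gradient. *)
Lemma bourbaki_proper : ~ free_divisor f -> ~ bourbaki 1.
Proof.
move=> nf [s [hs s1]]; apply: nf.
have s1' i : cross (s 0) (eps 0) i = df i by rewrite s1 mul1r.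
have [j dj] := df_neq0 k0 f0 fh.
exists 2, (col_mx s eps : 'M[R]_(1 + 1, 3)); split.
  move=> i; rewrite -[row i _]/(row i (col_mx s eps : 'M[R]_(1 + 1, 3))).
  by case: (split_ordP i) => l ->; rewrite ?rowKu ?rowKd row_id.
move=> t ht; have [h eh] := syz_cross k0 f0 fh fn ht eps_syz.
have [|a ea] := @cross_eps_kernel (t - h *: s).
  move=> i; rewrite addrC -scaleNr cross_epsD eh s1'; ring.
exists (row_mx h%:M a%:M : 'rV[R]_(1 + 1)); split.
  by rewrite (@mul_row_col _ 1 1 1 3) !mul_scalar_mx -ea addrC subrK.
move=> c ec; rewrite -(@hsubmxK _ 1 1 1 c).
have {}ec : t = lsubmx (c : 'rV[R]_(1 + 1)) 0 0 *: s + rsubmx (c : 'rV[R]_(1 + 1)) 0 0 *: eps.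
  rewrite {1}ec -{1}(@hsubmxK _ 1 1 1 c) (@mul_row_col _ 1 1 1 3).
  by rewrite {1}[lsubmx _]mx11_scalar {1}[rsubmx _]mx11_scalar !mul_scalar_mx.
set c1 := lsubmx _ 0 0 in ec; set c2 := rsubmx _ 0 0 in ec.
have e1 : h = c1.
  apply: (mulIf dj); rewrite -eh ec cross_epsD cross_epsZ addr0 s1' //.
have e2 : a = c2.
  have : (a - c2) *: eps = 0.
    by rewrite scalerBl -ea ec -e1 [_ + c2 *: eps]addrC addrK subrr.
  have [i ei] := eps_entry; move/rowP/(_ i); rewrite !mxE => /eqP.
  by rewrite mulf_eq0 (negPf ei) orbF subr_eq0 => /eqP.
by rewrite [lsubmx _]mx11_scalar [rsubmx _]mx11_scalar -/c1 -/c2 e1 e2.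
Qed.

End Bourbaki.

Section HilbertPolynomial.

Lemma bounded_nondecreasing_stationary (u : nat -> nat) B N :
  (forall n, (u n <= u n.+1)%N) -> (forall n, (N <= n)%N -> (u n <= B)%N) ->
  exists M b, (forall n, (M <= n)%N -> u n = b) /\ forall n, (u n <= b)%N.
Proof.
move=> mono bd; have le m n : (m <= n)%N -> (u m <= u n)%N.
  move=> /subnKC <-; elim: (n - m)%N => [|j IH]; rewrite ?addn0 // addnS.
  exact: leq_trans IH (mono _).
pose P b := `[< exists n, u n = b >].
have exP : exists b, P b by exists (u 0%N); apply/asboolP; exists 0%N.
have ubP b : P b -> (b <= B)%N.
  move=> /asboolP[n <-]; apply: leq_trans (bd (maxn n N) (leq_maxr _ _)).
  exact/le/leq_maxl.
case: (ex_maxnP exP ubP) => b /asboolP[M eM] bmax.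
have hb n : (u n <= b)%N by apply: bmax; apply/asboolP; exists n.
exists M, b; split=> // n Mn; apply/eqP; rewrite eqn_leq hb -eM; exact: le.
Qed.

Lemma horner_stationary (H : {poly rat}) N (b : rat) :
  (forall n, (N <= n)%N -> H.[n%:R] = b) -> H = b%:P.
Proof.
move=> hH; apply/eqP; rewrite -subr_eq0; apply/negPn/negP => h0.
pose s := [seq n%:R : rat | n <- iota N (size (H - b%:P))].
have us : uniq s.
  by rewrite map_inj_uniq ?iota_uniq // => m n /eqP; rewrite eqr_nat => /eqP.
have rs : all (root (H - b%:P)) s.
  apply/allP => _ /mapP[n hn ->]; rewrite mem_iota in hn.
  by rewrite /root hornerD hornerN hornerC hH ?subrr //; case/andP: hn.
by have := max_poly_roots h0 rs us; rewrite size_map size_iota ltnn.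
Qed.

End HilbertPolynomial.

(** * Hilbert function, codimension and multiplicity of the Bourbaki ideal *)

Section BourbakiDegree.
Variable (k : closedFieldType).
Local Notation R := {mpoly k[3]}.
Hypothesis k0 : [pchar k] =i pred0.
Variables (d : nat) (f : R).
Hypotheses (f0 : f != 0) (fh : f \is d.+1.-homog) (fn : nodal f).
Local Notation df := (fun i : 'I_3 => f^`M(i)).
Local Notation e := (indeg (syz f)).
Hypothesis nfree : ~ free_divisor f.
Variable eps : 'rV[R]_3.
Hypotheses (eps_syz : syz f eps) (eps_homog : homog_row e eps) (eps0 : eps != 0).
Local Notation I := (bourbaki f eps).

Let cI : ideal_closed I. Proof. exact: bourbaki_ideal_closed. Qed.
Let cIl : linear_closed I. Proof. exact: ideal_linear_closed. Qed.
Let I1 : ~ I 1. Proof. exact: (bourbaki_proper k0 f0 fh fn eps_syz eps_homog eps0 nfree). Qed.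
Let epsP : forall p, prime_elt p -> ~ forall i, principal p (eps 0 i).
Proof. move=> p; exact: (eps_coprime k0 f0 fh eps_syz eps_homog eps0). Qed.
Let Ieps l : I (eps 0 l). Proof. exact: bourbaki_eps. Qed.

Lemma bourbaki_hf_bound n : (e + e <= n)%N -> (hf I n <= e * e)%N.
Proof.
move=> hn; have [c [c' []]] := coprime_pair epsP.
set a := \sum_i _; set b := \sum_i _ => b0 cop.
have hom (x : 'I_3 -> k) : \sum_i x i *: eps 0 i \is e.-homog.
  by apply: rpred_sum => i _; apply: rpredZ; exact: eps_homog.
have hI (x : 'I_3 -> k) : I (\sum_i x i *: eps 0 i).
  apply: ideal_sum => // i _; rewrite -mul_mpolyC; apply: idealMl => //; exact: Ieps.
apply: (coprime_hf_le cIl _ _ (hom c) (hom c') b0 cop hn) => p; apply: idealMl => //; exact: hI.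
Qed.

Lemma bourbaki_iter_saturated N h :
  (forall m q, (N <= m)%N -> q \is m.-homog -> I (q * h)) -> I h.
Proof.
elim: N => [|N IH] hN; first by rewrite -[h]mul1r; apply: (hN 0%N) => //; exact: dhomog1.
apply: IH => m q Nm hq.
apply: (bourbaki_saturated k0 f0 fh eps_syz eps_homog eps0) => i; rewrite mulrA.
apply: (hN m.+1) => //; rewrite -[m.+1]add1n; apply: dhomogM => //; exact: dhomogXU.
Qed.

(** The Nullstellensatz is applied to the quotient of the ideal by [h]; saturation excludes its
    first alternative. Thus every form that is a zero divisor modulo the ideal vanishes somewhere on
    the finite list [L]. *)
Lemma bourbaki_points : exists L : seq {ffun 'I_3 -> k},
  [/\ forall v, v \in L -> exists i, v i = 1,
      exists2 v, v \in L & forall m h, h \is m.-homog -> I h -> h.@[v] = 0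
    & forall h, ~ I h -> exists2 v, v \in L &
        forall m q, q \is m.-homog -> I (q * h) -> q.@[v] = 0].
Proof.
have ex : exists n, (hf I n <= n)%N.
  exists (maxn (e * e) (e + e))%N; apply: leq_trans (leq_maxl _ _).
  by apply: bourbaki_hf_bound; exact: leq_maxr.
have [L [L1 hL]] := projective_nullstellensatz cI ex; exists L.
have nI h : ~ I h -> exists2 v, v \in L & forall m q, q \is m.-homog -> I (q * h) -> q.@[v] = 0.
  move=> nh; case: (hL (fun q => I (q * h))) => //.
  - split=> [|a x y hx hy]; first by rewrite mul0r; exact: ideal0.
    by rewrite mulrDl -mulrA; case: cI => _; exact.
  - by move=> q jq; apply: idealMr.
  by case=> N hN; case: nh; exact: bourbaki_iter_saturated hN.
split=> //; have [v vL hv] := nI 1 I1; exists v => // m h hh Ih.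
by apply: (hv m h hh); rewrite mulr1.
Qed.

(** The form is sought with coefficients 1, t, t^2: each point excludes only the roots of the
    nonzero polynomial [P v]. *)
Lemma avoiding_linear_form (L : seq {ffun 'I_3 -> k}) :
  (forall v, v \in L -> exists i, v i = 1) ->
  exists m : 'I_3 -> k, forall v, v \in L -> (lform m).@[v] != 0.
Proof.
move=> L1; pose P (v : {ffun 'I_3 -> k}) : {poly k} := \poly_(i < 3) v (inord i).
have [t ht] : exists t, forall v, v \in L -> (P v).[t] != 0.
  have P0 : \prod_(v <- L) P v != 0.
    rewrite prodf_seq_neq0; apply/allP => v vL /=; have [i vi] := L1 v vL.
    apply/eqP => /polyP/(_ (val i)); rewrite coef_poly ltn_ord inord_val vi coef0.
    by move/eqP; rewrite oner_eq0.
  have [rs ers] := closed_field_poly_normal (\prod_(v <- L) P v).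
  have [t ht] := exists_notin rs; exists t => v vL; apply: contraNneq ht => hv.
  rewrite -root_prod_XsubC -(rootZ _ _ (_ : lead_coef (\prod_(v <- L) P v) != 0)).
    by rewrite -ers /root horner_prod prodf_seq_eq0; apply/hasP; exists v; rewrite ?hv /=.
  by rewrite lead_coef_eq0.
exists (fun j => t ^+ j) => v vL; apply: contra (ht v vL); rewrite meval_lform => /eqP h.
rewrite horner_poly -[X in _ == X]h; apply/eqP; apply: eq_bigr => i _.
by rewrite inord_val mulrC.
Qed.

(** A linear form that vanishes at no point of the list is not a zero divisor modulo the ideal. *)
Lemma bourbaki_hf_nondecreasing n : (hf I n <= hf I n.+1)%N.
Proof.
have [L [L1 _ hL]] := bourbaki_points; have [m hm] := avoiding_linear_form L1.
have hl : lform m \is 1.-homog.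
  by apply: rpred_sum => i _; apply: rpredZ; exact: dhomogXU.
apply: (@hf_le _ _ _ _ _ _ (fun p => lform m * p)) => //.
- by move=> c p q; rewrite mulrDr scalerAr.
- by move=> p hp; rewrite -[n.+1]add1n; exact: dhomogM.
move=> p hp Ilp; apply: contrapT => /hL[v vL hv].
by have := hm v vL; rewrite (hv 1%N _ hl Ilp) eqxx.
Qed.

Lemma bourbaki_hf_limit : exists N b, [/\ forall n, (N <= n)%N -> hf I n = b,
  (0 < b)%N & forall m, (m + d < e + e)%N -> ('C(m + 2, m) <= b)%N].
Proof.
have [N [b [hN hb]]] :=
  bounded_nondecreasing_stationary bourbaki_hf_nondecreasing bourbaki_hf_bound.
exists N, b; split=> // [|m lt].
  by apply: leq_trans (hb 0%N); apply: (hf_gt0 cIl (dhomog1 _ _)).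
rewrite -(@hf_eq_full _ _ I m cIl) // => p hp Ip.
exact: (bourbaki_low k0 f0 fh eps_homog eps0 lt hp Ip).
Qed.

(** A prime [Q1] strictly inside the ideal of [p] does not contain [p], so with c p it contains [c];
    descent on the size makes [Q1] zero. *)
Lemma principal_prime_height (p : R) (Q : {pred R}) : prime_elt p -> prime_ideal Q ->
  (forall q, q \in Q <-> principal p q) -> ~ height_ge 2 Q.
Proof.
move=> pp pQ eQ [Q1 [pQ1 sub nsub [Q0 [pQ0 _ nsub0 _]]]].
have [[Q10 Q11 QD] Qm] := pQ1; have [p0 pu pm] := pp.
have pnQ1 : p \notin Q1.
  apply/negP => pQ1'; apply: nsub => x /eQ[c ->].
  by have := QD c p 0 pQ1' Q10; rewrite addr0.
have z x : x \in Q1 -> x = 0.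
  move: {2}(msize x) (leqnn (msize x)) => n; elim: n x => [|n IH] x.
    by rewrite leqn0 msize_poly_eq0 => /eqP.
  move=> sx xQ1; have /eQ[c ec] := sub _ xQ1.
  have [//|x0] := eqVneq x 0.
  have c0 : c != 0 by apply: contraNneq x0 => h; rewrite ec h mul0r.
  have cQ1 : c \in Q1.
    by have := xQ1; rewrite ec => /Qm/orP[//|h]; rewrite h in pnQ1.
  have sp : (1 < msize p)%N.
    rewrite ltnNge; apply: contra pu => /msize1_polyC ep.
    by rewrite ep mpolyC_unit; apply: contraNneq p0 => h; rewrite ep h.
  rewrite ec (IH c) ?mul0r //; move: sx; rewrite ec msizeM //.
  by move: (msize p) (msize c) sp => a b; clear; lia.
by case: nsub0 => x /z ->; case: pQ0 => -[].
Qed.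

Definition bourbaki_pred : {pred R} := fun p => `[< I p >].

Lemma bourbaki_predE p : p \in bourbaki_pred <-> I p.
Proof. by split=> [/asboolP|h]; last exact/asboolP. Qed.

Lemma principal_prime_ideal (p : R) : prime_elt p ->
  prime_ideal (fun q : R => `[< principal p q >]).
Proof.
move=> [p0 pu pm]; split=> [|x y].
  split; first exact/asboolP/principal0.
    by apply/asboolP => /(principal_unit (unitr1 _)) h; rewrite h in pu.
  move=> c x y /asboolP hx /asboolP hy; apply/asboolP.
  by apply: principalD => //; exact: principal_mull.
by move=> /asboolP/pm[h|h]; apply/orP; [left|right]; apply/asboolP.
Qed.

Lemma zero_prime_ideal : prime_ideal (fun q : R => q == 0).
Proof.
split=> [|x y]; last by rewrite !unfold_in mulf_eq0.
split; rewrite ?unfold_in ?eqxx ?oner_eq0 //.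
by move=> c x y; rewrite !unfold_in => /eqP -> /eqP ->; rewrite mulr0 addr0.
Qed.

(** The chain is zero, the ideal of a prime factor [p] of some entry of [eps], and [P]; the last
    inclusion is strict because [p] does not divide all entries. *)
Lemma bourbaki_height (P : {pred R}) : prime_ideal P ->
  (forall l, eps 0 l \in P) -> height_ge 2 P.
Proof.
move=> pP hP; have [[P0 P1 PD] Pm] := pP.
have [l el] := eps_entry eps0.
have [u [s [uu hs es]]] := factorial_mpoly el.
have Pu x : x \is a GRing.unit -> x \notin P.
  move=> xu; apply: contra P1 => xP; have := PD x^-1 x 0 xP P0.
  by rewrite addr0 mulVr.
have [p ps pP'] : exists2 p, p \in s & p \in P.
  have := hP l; rewrite es => /Pm/orP[h|]; first by have := Pu _ uu; rewrite h.
  elim: (s) => [|p s' IH]; first by rewrite big_nil => h; rewrite h in P1.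
  rewrite big_cons => /Pm/orP[h|/IH[q qs qP]]; first by exists p; rewrite ?mem_head.
  by exists q; rewrite ?inE ?qs ?orbT.
have pp := hs p ps; have [p0 pu pm] := pp.
exists (fun q : R => `[< principal p q >]); split; first exact: principal_prime_ideal.
- by move=> x /asboolP[c ->]; have := PD c p 0 pP' P0; rewrite addr0.
- by move=> h; apply: (epsP pp) => i; have /asboolP := h _ (hP i).
exists (fun q : R => q == 0); split=> //; first exact: zero_prime_ideal.
- by move=> x; rewrite unfold_in => /eqP ->; exact/asboolP/principal0.
move=> h; case/negP: p0; have := h p; rewrite unfold_in => /(_ _)/eqP -> //.
exact/asboolP/principal_refl.
Qed.

(** For the upper bound [P] is the prime of the line spanned by a common zero [v]. A chain of three
    inclusions ending at it would extend to four ending at the ideal [Z] of the origin. *)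
Lemma bourbaki_codim : codim bourbaki_pred 2.
Proof.
split=> [P pP sub|].
  by apply: bourbaki_height => // l; apply: sub; exact/bourbaki_predE.
have [L [L1 [v vL hv] _]] := bourbaki_points; have [i vi] := L1 v vL.
pose T : 3.-tuple R := [tuple v j *: 'X_i | j < 3].
pose P : {pred R} := fun p => p \mPo T == 0; exists P.
have TM (p q : R) : (p * q) \mPo T = (p \mPo T) * (q \mPo T) by exact: rmorphM.
have pP : prime_ideal P.
  split=> [|x y]; last by rewrite !unfold_in TM mulf_eq0.
  split; rewrite ?unfold_in ?comp_mpoly0 ?eqxx ?comp_mpoly1 ?oner_eq0 //.
  move=> c x y; rewrite !unfold_in comp_mpolyD TM => /eqP -> /eqP ->.
  by rewrite mulr0 addr0.
split=> //.
  move=> p /bourbaki_predE Ip; rewrite unfold_in (hcomp_sum (leqnn (msize p))).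
  rewrite raddf_sum big1 // => m _ /=; rewrite (comp_line _ _ (pihomogP _ _ _)).
  rewrite (hv m) ?scale0r //; first exact: pihomogP.
  exact: (bourbaki_homog k0 f0 fh eps_homog).
move=> h3; pose Z : {pred R} := fun p => p.@[fun=> 0] == 0.
have pZ : prime_ideal Z.
  split=> [|x y]; last by rewrite !unfold_in mevalM mulf_eq0.
  split; rewrite ?unfold_in ?meval0 ?eqxx ?meval1 ?oner_eq0 //.
  move=> c x y; rewrite !unfold_in mevalD mevalM => /eqP -> /eqP ->.
  by rewrite mulr0 addr0.
apply: (krull_dimension pZ); exists P; split=> //.
  move=> p; rewrite !unfold_in => /eqP /(congr1 (meval (fun=> 0))).
  rewrite comp_mpoly_meval meval0 => h; apply/eqP; rewrite -[RHS]h.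
  by apply: meval_eq => j; rewrite tnth_mktuple mevalZ mevalXU mulr0.
move=> /(_ 'X_i); rewrite !unfold_in mevalXU eqxx => /(_ isT).
rewrite comp_mpolyXU -tnth_nth tnth_mktuple vi scale1r -msize_poly_eq0 msizeX.
by rewrite mdeg1.
Qed.

Lemma bourbaki_hilbert : (fun p => p \in bourbaki_pred : Prop) = I.
Proof. by apply/funext => p; apply/propext; exact: bourbaki_predE. Qed.

Lemma bourbaki_multiplicity : exists b, [/\ multiplicity bourbaki_pred b,
  (forall mu, multiplicity bourbaki_pred mu -> mu = b)
  & forall m, (m + d < e + e)%N -> ('C(m + 2, m) <= b)%N].
Proof.
have [N [b [hN b0 hb]]] := bourbaki_hf_limit; exists b.
have hfun n h : hilbert_fun bourbaki_pred n h <-> h = hf I n.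
  by rewrite /hilbert_fun hilbert_funP bourbaki_hilbert.
have bQ : b%:R != 0 :> rat by rewrite pnatr_eq0 -lt0n.
split=> // [|mu].
  exists (b%:R)%:P; rewrite polyC_eq0 size_polyC bQ lead_coefC fact0 mul1r.
  split=> //; exists N => n Nn; exists b; rewrite hornerC; split=> //.
  by apply/hfun; rewrite hN.
case=> H [[M hM] H0 emu].
have eH : H = (b%:R)%:P.
  apply: (@horner_stationary _ (maxn N M)) => n; rewrite geq_max => /andP[Nn Mn].
  by have [h [/hfun -> ->]] := hM n Mn; rewrite hN.
apply/eqP; rewrite -(eqr_nat rat) emu eH size_polyC bQ lead_coefC fact0 mul1r.
by [].
Qed.

End BourbakiDegree.

Section BourbakiIdeal.
Variable (k : closedFieldType).
Local Notation R := {mpoly k[3]}.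
Hypothesis k0 : [pchar k] =i pred0.
Variables (d : nat) (f : R).
Hypotheses (f0 : f != 0) (fh : f \is d.+1.-homog) (fn : nodal f).
Local Notation df := (fun i : 'I_3 => f^`M(i)).
Local Notation e := (indeg (syz f)).
Implicit Types (s t : 'rV[R]_3).

Lemma minimal_generator_neq0 eps : minimal_generator (syz f) eps -> eps != 0.
Proof.
case=> _ h; apply: contra_notN h => /eqP ->; exists 0; split=> [i|].
  by rewrite row0; exact: syz0.
by rewrite big1 // => i _; rewrite row0 scaler0.
Qed.

(** In degree [e] an element of (x,y,z) Syz only involves components of syzygies of degree e - 1,
    which are zero. *)
Lemma indeg_minimal_generator eps : syz f eps -> homog_row e eps -> eps != 0 ->
  minimal_generator (syz f) eps.
Proof.
move=> he hh eps0; split=> // -[t [ht et]]; case/negP: eps0; apply/eqP/rowP => j.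
rewrite mxE -(pihomog_dE (hh j)) et summxE raddf_sum big1 // => i _ /=.
rewrite !mxE mulrC; case: (posnP e) => [->|e_gt0].
  exact: hcompMr_lt (dhomogXU _ _) _.
rewrite -(prednK e_gt0) -[_.-1.+1]addn1 (hcompMr _ _ (dhomogXU _ _)).
have lt : (e.-1 < e)%N by rewrite prednK.
by have := syz_low k0 f0 fh j (ht i) lt; rewrite mxE => ->; rewrite mul0r.
Qed.

Variable eps : 'rV[R]_3.
Hypotheses (eps_syz : syz f eps) (eps_homog : homog_row e eps) (eps0 : eps != 0).
Local Notation I := (bourbaki f eps).
Local Notation J := (bourbaki_pred f eps).

Lemma cross_eps_proportional s t x y :
  (forall i, cross (s 0) (eps 0) i = x * df i) ->
  (forall i, cross (t 0) (eps 0) i = y * df i) -> exists a, x *: t - y *: s = a *: eps.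
Proof.
move=> hs ht; apply: (cross_eps_kernel k0 f0 fh eps_syz eps_homog eps0) => i.
have -> : cross ((x *: t - y *: s) 0) (eps 0) i =
    x * cross (t 0) (eps 0) i - y * cross (s 0) (eps 0) i.
  by case: (ord3P i) => ->; rewrite /cross /= !mxE; ring.
by rewrite hs ht; ring.
Qed.

Lemma bourbaki_isomorphism : bourbaki_ideal d e f eps J.
Proof.
have [j dj] := df_neq0 k0 f0 fh.
have /choice[phi hphi] : forall s, exists h, syz f s ->
    forall i, cross (s 0) (eps 0) i = h * df i.
  move=> s; have [hs|ns] := pselect (syz f s); last by exists 0 => /ns.
  by have [h hh] := syz_cross k0 f0 fh fn hs eps_syz; exists h.
exists phi; split.
- move=> a s t hs ht; apply: (mulIf dj).
  rewrite -(hphi (a *: s + t)); last exact: syz_linear.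
  by rewrite cross_epsD !hphi //; ring.
- move=> s hs; split=> [h|[a ->]].
    apply: (cross_eps_kernel k0 f0 fh eps_syz eps_homog eps0) => i.
    by rewrite hphi // h mul0r.
  by apply: (mulIf dj); rewrite mul0r -hphi ?cross_epsZ //; exact: syzZ.
- move=> p; rewrite bourbaki_predE; split=> [[s [hs sp]]|[s [hs <-]]].
    exists s; split=> //; apply: (mulIf dj); by rewrite -hphi.
  by exists s; split=> //; exact: hphi.
move=> n s hs hh.
have hc i : cross (s 0) (eps 0) i \is (n + e).-homog.
  have h x y : s 0 x * eps 0 y \is (n + e).-homog by apply: dhomogM; [exact: hh | exact: eps_homog].
  by case: (ord3P i) => ->; rewrite /cross /=; apply: rpredB; exact: h.
have pd : principal (df j) (cross (s 0) (eps 0) j) by exists (phi s); rewrite hphi.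
have [lt|led] := ltnP (n + e) d.
  have hz : phi s = 0.
    apply: (mulIf dj); rewrite -hphi // mul0r.
    exact: (principal_lt (df_homog fh j) (hc j) lt pd).
  have [m ->] : exists m, (n%:Z + e%:Z - d%:Z)%R = Negz m.
    by exists (d - (n + e)).-1; rewrite NegzE; move: lt; clear; lia.
  by rewrite hz /= eqxx.
have -> : (n%:Z + e%:Z - d%:Z)%R = (n + e - d)%N :> int by move: led; clear; lia.
have hd : cross (s 0) (eps 0) j \is (d + (n + e - d)).-homog by rewrite subnKC.
have [c hcc ec] := dhomog_quotient dj (df_homog fh j) hd pd.
by rewrite /= (_ : phi s = c) //; apply: (mulIf dj); rewrite -hphi.
Qed.

(* Any isomorphism is a scalar multiple [u] of the one given by the cross
   product with [eps]; [u] is constant because the image has codimension 2. *)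
Lemma bourbaki_ideal_unique (K : {pred R}) : codim K 2 -> bourbaki_ideal d e f eps K ->
  forall p, p \in K <-> I p.
Proof.
case=> hcod _ [phi [phiD phi0 phiK _]].
have phiZ a s : syz f s -> phi (a *: s) = a * phi s.
  move=> hs; have p00 : phi 0 = 0 by apply/(phi0 _ (syz0 f)); exists 0; rewrite scale0r.
  by rewrite -[a *: s]addr0 phiD ?p00 ?addr0 //; exact: syz0.
have prop s t x y : syz f s -> syz f t -> (forall i, cross (s 0) (eps 0) i = x * df i) ->
    (forall i, cross (t 0) (eps 0) i = y * df i) -> x * phi t = y * phi s.
  move=> hs ht es et; have [a ea] := cross_eps_proportional es et.
  have : phi (x *: t - y *: s) = 0 by apply/phi0; [apply: syzB; exact: syzZ | exists a].
  rewrite -scaleN1r addrC phiD; try exact: syzZ.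
  by rewrite !phiZ // mulN1r addrC => /subr0_eq.
have ck l i : cross (koszul f l 0) (eps 0) i = - eps 0 l * df i.
  by rewrite mulNr -(cross_koszul l eps_syz) cross_anti.
have sk l := syz_koszul f l.
have [u hu] : exists u, forall l, phi (koszul f l) = u * eps 0 l.
  have [l el] := eps_entry eps0.
  apply: (@primitive_proportional _ (@factorial_mpoly k 3) 'I_3 (fun l => phi (koszul f l))
    (eps 0) (eps 0 l) (phi (koszul f l)) el).
    by move=> p; exact: (eps_coprime k0 f0 fh eps_syz eps_homog eps0).
  move=> i; have := prop _ _ _ _ (sk l) (sk i) (ck l) (ck i).
  by rewrite !mulNr => /oppr_inj ->; rewrite mulrC.
have phiE s x : syz f s -> (forall i, cross (s 0) (eps 0) i = x * df i) ->
    phi s = - (u * x).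
  move=> hs es; have [l el] := eps_entry eps0; apply: (mulIf el).
  have := prop _ _ _ _ hs (sk l) es (ck l); rewrite hu mulNr => h.
  by rewrite [_ * eps 0 l]mulrC -[eps 0 l * _]opprK -h; ring.
have Ku p : p \in K -> principal u p.
  case/phiK => s [hs <-]; have [x ex] := syz_cross k0 f0 fh fn hs eps_syz.
  by rewrite (phiE s x hs ex); apply: principalN; exists x; rewrite mulrC.
(* Otherwise [K] lies in the zero ideal or in the ideal of a prime factor of [u], a prime of height
   less than two. *)
have uu : u \is a GRing.unit.
  apply: contrapT => /negP nu; have [uz|un] := eqVneq u 0.
    have hK : {subset K <= (fun q : R => q == 0)}.
      by move=> p /Ku[c ->]; rewrite uz mulr0 unfold_in eqxx.
    have [Q [[[Q0 _ _] _] _ nsub _]] := hcod _ (zero_prime_ideal k) hK.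
    by apply: nsub => x; rewrite unfold_in => /eqP ->.
  have [p pp pu] := prime_divisor (@factorial_mpoly k 3) un nu.
  apply: (principal_prime_height pp (principal_prime_ideal pp)).
    by move=> q; split=> [/asboolP|h]; last exact/asboolP.
  apply: hcod; first exact: principal_prime_ideal.
  by move=> q /Ku h; apply/asboolP; exact: principal_trans h.
move=> p; split=> [/phiK[s [hs <-]]|[s [hs sp]]].
  have [x ex] := syz_cross k0 f0 fh fn hs eps_syz.
  rewrite (phiE s x hs ex) -mulNr; apply: idealMl; first exact: bourbaki_ideal_closed.
  by exists s.
apply/phiK; exists (- u^-1 *: s); split; first exact: syzZ.
by rewrite phiZ // (phiE s p hs sp) mulrNN mulrA mulVr // mul1r.
Qed.

End BourbakiIdeal.

Section BourbakiDegreeBound.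
Variable (k : closedFieldType).
Local Notation R := {mpoly k[3]}.
Hypothesis k0 : [pchar k] =i pred0.
Variables (d : nat) (f : R).
Hypotheses (f0 : f != 0) (fh : f \is d.+1.-homog) (fn : nodal f).
Local Notation e := (indeg (syz f)).
Hypothesis nfree : ~ free_divisor f.

Lemma is_bour_exists : exists b, is_bour d f b.
Proof.
have [[eps [hs eps0 hh]] _] := indegP k0 f0 fh.
have [b [hb _ _]] := bourbaki_multiplicity k0 f0 fh fn nfree hs hh eps0.
exists b, eps, (bourbaki_pred f eps); split=> //.
- exact: (indeg_minimal_generator k0 f0 fh).
- split.
  + split.
    * by apply/bourbaki_predE; apply: ideal0; exact: bourbaki_ideal_closed.
    * by apply/asboolP; exact: (bourbaki_proper k0 f0 fh fn hs hh eps0 nfree).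
    move=> a p q /bourbaki_predE hp /bourbaki_predE hq; apply/bourbaki_predE.
    have [_ h] := bourbaki_ideal_closed f eps; exact: h.
  + move=> p n /bourbaki_predE hp; apply/bourbaki_predE.
    exact: (bourbaki_homog k0 f0 fh hh).
  exact: (bourbaki_codim k0 f0 fh fn nfree hs hh eps0).
exact: (bourbaki_isomorphism k0 f0 fh fn hs hh eps0).
Qed.

(** The witness behind [Bour] is arbitrary, so the ideal [K] is first identified with the one given
    by cross products with the same [eps]. *)
Lemma is_bour_bound b m : is_bour d f b -> (m + d < e + e)%N -> ('C(m + 2, m) <= b)%N.
Proof.
case=> eps [K [mg hh [_ _ hcod] iso hmu]]; have hs := proj1 mg.
have eps0 := minimal_generator_neq0 mg.
have eK : K = bourbaki_pred f eps.
  apply/funext => p; apply/idP/idP => h.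
    by apply/bourbaki_predE/(bourbaki_ideal_unique k0 f0 fh fn hs hh eps0 hcod iso).
  by apply/(bourbaki_ideal_unique k0 f0 fh fn hs hh eps0 hcod iso)/bourbaki_predE.
have [c [_ uc hc]] := bourbaki_multiplicity k0 f0 fh fn nfree hs hh eps0.
rewrite eK in hmu; rewrite (uc b hmu); exact: hc.
Qed.

Lemma Bour_bound m : (m + d < e + e)%N -> ((m + 2) * (m + 1) <= 2 * Bour d f)%N.
Proof.
move=> lt; rewrite -bin_plane mulnC leq_pmul2l // /Bour.
case: pselect => [/nfree//|nf]; case: pselect => [h|nh]; last first.
  by case: nh; exact: is_bour_exists.
by case: (cid h) => b hb /=; exact: is_bour_bound hb lt.
Qed.

End BourbakiDegreeBound.

Theorem proposition3p7 (k : closedFieldType) (k_char0 : [pchar k] =i pred0)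
    (d : nat) (d_ge1 : (1 <= d)%N)
    (f : {mpoly k[3]}) (f_neq0 : f != 0) (f_homog : f \is d.+1.-homog)
    (f_nodal : nodal f) :
  let e := indeg (syz f) in
  [/\ (d - 1 <= e)%N,
      [/\ e = d -> d%:R * (d%:R - 1) / 2 <= (Bour d f)%:R :> rat,
          e = (d - 1)%N -> d%:R * (d%:R - 3) / 2 - 1 <= (Bour d f)%:R :> rat
        & irreducible f ->
            (e = d -> d%:R * (d%:R + 1) / 2 <= (Bour d f)%:R :> rat) /\
            (e = (d - 1)%N ->
               1 + d%:R * (d%:R - 1) / 2 <= (Bour d f)%:R :> rat)]
    & (irreducible f -> ~ free_divisor f) /\
      (free_divisor f ->
         (d.+1 <= 3)%N /\
         exists A : 'M[k]_3, A \in unitmx /\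
           (linear_change A f = 'X_0 * 'X_1 \/
            linear_change A f = 'X_0 * 'X_1 * 'X_2))].
Proof.
move=> e.
have e_ge : (d <= e.+1)%N := indeg_bound k_char0 d_ge1 f_neq0 f_homog f_nodal.
have irr_e (fi : irreducible f) : (d <= e)%N :=
  indeg_irreducible k_char0 d_ge1 f_neq0 f_homog f_nodal fi.
have irr_nfree := irreducible_not_free k_char0 d_ge1 f_neq0 f_homog f_nodal.
have free_e : free_divisor f -> (e + e <= d)%N := free_indeg k_char0 f_neq0 f_homog f_nodal.
have bound : ~ free_divisor f -> forall m, (m + d < e + e)%N ->
    (m%:R + 2) * (m%:R + 1) <= 2 * (Bour d f)%:R :> rat.
  move=> nf m lt; have := Bour_bound k_char0 f_neq0 f_homog f_nodal nf lt.
  by rewrite -(ler_nat rat) !natrM !natrD.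
have nfree_d : e = d -> ~ free_divisor f by move=> ed /free_e; rewrite ed; lia.
have d_case : e = d -> d%:R * (d%:R + 1) / 2 <= (Bour d f)%:R :> rat.
  move=> ed; have lt : (d - 1 + d < d + d)%N by move: d_ge1; clear; lia.
  have := bound (nfree_d ed) (d - 1)%N; rewrite ed natrB // => /(_ lt).
  by move: (d%:R : rat) ((Bour d f)%:R : rat) => x b; clear; lra.
split.
- by move: e_ge; clear; lia.
- split=> [ed|ed|fi].
  + apply: le_trans (d_case ed); clear.
    have : 0 <= d%:R :> rat by [].
    by move: (d%:R : rat) => x; clear; lra.
  + have B0 : 0 <= (Bour d f)%:R :> rat by [].
    (* For [d] equal to 1 or 2 the bound is -2. From 3 on, 2 (d - 1) exceeds [d], so the curve is
       not free, and forms of degree d - 3 give the bound. *)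
    have [d2|d3] := leqP d 2.
      apply: le_trans B0; case: d {e_ge irr_e d_case bound nfree_d free_e} d_ge1 d2 ed
        f_homog => [|[|[|]]] //.
    have nf : ~ free_divisor f by move=> /free_e; rewrite ed; move: d3; clear; lia.
    have lt : (d - 3 + d < (d - 1) + (d - 1))%N by move: d3; clear; lia.
    have := bound nf (d - 3)%N; rewrite ed natrB // => /(_ lt).
    by move: (d%:R : rat) ((Bour d f)%:R : rat) => x b; clear; lra.
  split=> // ed; exfalso; have := irr_e fi; rewrite ed; move: d_ge1; clear; lia.
split=> // fd.
have [[ed ee]|[ed ee]] := free_degree k_char0 d_ge1 f_neq0 f_homog f_nodal fd.
  have d2 : d = 2 by move: ed ee; clear; lia.
  rewrite d2; split=> //.
  have [A [Au hA]] := free_three_lines k_char0 d_ge1 f_neq0 f_homog f_nodal d2 fd.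
  by exists A; split=> //; right.
rewrite ed; split=> //.
have [A [Au hA]] := free_two_lines k_char0 d_ge1 f_neq0 f_homog f_nodal ed fd.
by exists A; split=> //; left.
Qed.
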